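(* Let $\mathbb{K}=\mathbb{R}$ or $\mathbb{C}$, and fix one of the classes of smooth functions described in the context. Let $\mathfrak{g}$ be a finite-dimensional Lie algebra over $\mathbb{K}$ and let $m\ge 0$ be an integer. If the coadjoint representation $(\mathfrak{g},\mathrm{ad}^*,\mathfrak{g}^* )$ of $\mathfrak{g}$ has the Dixmier property, then the coadjoint representation of $\mathfrak{g}_m$ in $(\mathfrak{g}_m)^*$ has the Dixmier property (with respect to the same class of smooth functions).
   Context: Smooth functions. The base field is $\mathbb{K}=\mathbb{R}$ or $\mathbb{C}$. ''Smooth'' refers to one fixed class of (scalar- or vector-valued) functions on finite-dimensional $\mathbb{K}$-vector spaces, used throughout, among the following: polynomial functions ($\mathbb{K}=\mathbb{R}$ or $\mathbb{C}$); real analytic functions ($\mathbb{K}=\mathbb{R}$); $C^\infty$ functions ($\mathbb{K}=\mathbb{R}$); entire holomorphic functions ($\mathbb{K}=\mathbb{C}$). Vector spaces and Lie algebras are finite-dimensional over $\mathbb{K}$. Vector fields with parameters. For finite-dimensional $\mathbb{K}$-vector spaces $W$ and $E$, a vector field on $E$ with parameters in $W$ is a smooth function $a:W\times E\to E$. It acts on smooth functions $\varphi:E\to\mathbb{K}$ by $(L\varphi)(w,e)=\left.\frac{d}{dt}\right|_{t=0}\varphi(e+t\,a(w,e))$; it annihilates $\varphi$ if $(L\varphi)(w,e)=0$ for all $(w,e)\in W\times E$. Invariant functions. For a linear representation $\rho:\mathfrak{h}\to\mathfrak{gl}(E)$ of a Lie algebra $\mathfrak{h}$, a smooth function $\varphi:E\to\mathbb{K}$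 is $\mathfrak{h}$-invariant if $\left.\frac{d}{dt}\right|_{t=0}\varphi(e+t\rho(x).e)=0$ for all $x\in\mathfrak{h}$, $e\in E$. Dixmier property. The representation $(\mathfrak{h},\rho,E)$ has the Dixmier property if, for every finite-dimensional $\mathbb{K}$-vector space $W$ and every vector field with parameters $a:W\times E\to E$ annihilating all smooth $\mathfrak{h}$-invariant functions on $E$, there exists a smooth function $b:W\times E\to\mathfrak{h}$ such that $a(w,e)=\rho(b(w,e)).e$ for all $(w,e)\in W\times E$. Generalized Takiff algebras. For a Lie algebra $\mathfrak{g}$ and an integer $m\ge0$, $\mathfrak{g}_m$ is the Lie algebra of elements $X=x_0+x_1T+\cdots+x_mT^m$, $x_j\in\mathfrak{g}$, $T$ an indeterminate, with bracket $[\sum_r x_rT^r,\sum_s y_sT^s]=\sum_{r,s}[x_r,y_s]T^{r+s}$ mod $T^{m+1}$. *)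

(* Defs.v *)
From HB Require Import structures.
From mathcomp Require Import all_boot all_order all_algebra.
From mathcomp Require mpoly.
From mathcomp Require Import complex.
From mathcomp Require Import all_classical all_reals.
From mathcomp Require Import topology normedtype sequences derive.

Set Implicit Arguments.
Unset Strict Implicit.
Unset Printing Implicit Defensive.

Import Order.TTheory GRing.Theory Num.Theory VectorInternalTheory.
Import numFieldNormedType.Exports.

Local Open Scope classical_set_scope.
Local Open Scope ring_scope.

Section SmoothFunctions.
Variable K : numFieldType.
Implicit Types (n : nat).

Definition polynomial_function n (f : 'rV[K]_n -> K) : Prop :=
  exists p : mpoly.mpoly n K, forall x, f x = mpoly.meval (x 0) p.

Definition monomial n (h : 'rV[K]_n) (a : {ffun 'I_n -> nat}) : K :=
  \prod_(i < n) h 0 i ^+ a i.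

Definition multi_index n N (a : {ffun 'I_n -> 'I_N}) : {ffun 'I_n -> nat} :=
  [ffun i => a i : nat].

(* The power series sum_a c_a h^a, over all the multi-indices a, is given by its
   partial sums over the cubes a_1, ..., a_n < N.  Since the convergence is
   required to be absolute, its sum does not depend on this choice. *)
Definition analytic_function n (f : 'rV[K]_n -> K) : Prop :=
  forall x, exists c : {ffun 'I_n -> nat} -> K, exists2 r : K, 0 < r &
    forall h : 'rV[K]_n, `|h| < r ->
      let u a := c a * monomial h a in
      cvgn (fun N => \sum_(a : {ffun 'I_n -> 'I_N}) `|u (multi_index a)|) /\
      (fun N => \sum_(a : {ffun 'I_n -> 'I_N}) u (multi_index a)) @ \oo
        --> f (x + h).

Fixpoint Ck_function n (k : nat) (f : 'rV[K]_n -> K) : Prop :=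
  if k is k'.+1 then
    (forall x, differentiable f x) /\ (forall v, Ck_function k' ('D_v f))
  else continuous f.

Definition Cinfty_function n (f : 'rV[K]_n -> K) : Prop :=
  forall k, Ck_function k f.

(* The differential is K-linear: for K = R[i], this is complex
   differentiability. *)
Definition holomorphic_function n (f : 'rV[K]_n -> K) : Prop :=
  forall x, differentiable f x.

End SmoothFunctions.

Inductive smooth_class (R : realType) : numFieldType -> Type :=
| RealPolynomial : smooth_class R R
| ComplexPolynomial : smooth_class R R[i]
| RealAnalytic : smooth_class R R
| RealCinfty : smooth_class R R
| EntireHolomorphic : smooth_class R R[i].

Section Smooth.
Variables (R : realType) (K : numFieldType) (c : smooth_class R K).

Definition smooth_rV n (f : 'rV[K]_n -> K) : Prop :=
  match c with
  | RealPolynomial | ComplexPolynomial => polynomial_function f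
  | RealAnalytic => analytic_function f
  | RealCinfty => Cinfty_function f
  | EntireHolomorphic => holomorphic_function f
  end.

(* [v2r] and [r2v] are the inverse coordinate isomorphisms between V and
   'rV[K]_(dim V); the classes above are stable under linear isomorphisms, so
   that smoothness does not depend on the coordinates. *)
Definition smooth (V : vectType K) (f : V -> K) : Prop :=
  smooth_rV (fun x : 'rV[K]_(dim V) => f (r2v x)).

Definition smooth_map (V U : vectType K) (f : V -> U) : Prop :=
  forall i, smooth (fun v => v2r (f v) 0 i).

End Smooth.

HB.mixin Record Vector_isLieAlgebra (K : fieldType) g of Vector K g := {
  lie : g -> g -> g;
  lie_linearl : forall y, linear (lie^~ y);
  lie_linearr : forall x, linear (lie x);
  liexx : forall x, lie x x = 0;
  lie_jacobi : forall x y z,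
    lie x (lie y z) + lie y (lie z x) + lie z (lie x y) = 0
}.

#[short(type="lieAlgType")]
HB.structure Definition LieAlgebra (K : fieldType) :=
  {g of Vector_isLieAlgebra K g & Vector K g}.

Record representation (K : fieldType) (h : lieAlgType K) (E : vectType K) :=
  Representation {
    rep :> {linear h -> 'End(E)};
    rep_lie : forall x y,
      rep (lie x y) = (rep x \o rep y)%VF - (rep y \o rep x)%VF }.

Section LieTheory.
Variables (K : fieldType) (g : lieAlgType K).
Implicit Types x y z : g.

HB.instance Definition _ x :=
  GRing.isLinear.Build K g g _ (lie x) (lie_linearr x).

Lemma lieDr x y z : lie x (y + z) = lie x y + lie x z.
Proof. exact: linearD. Qed.

Lemma lieDl x y z : lie (x + y) z = lie x z + lie y z.
Proof. by have := lie_linearl z 1 x y; rewrite !scale1r. Qed.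

Lemma lieC x y : lie y x = - lie x y.
Proof.
apply/eqP; rewrite -addr_eq0 addrC; apply/eqP.
by have := liexx (x + y); rewrite lieDl !lieDr !liexx add0r addr0.
Qed.

Definition ad x : 'End(g) := linfun (lie x).

Lemma adE x y : ad x y = lie x y.
Proof. by rewrite lfunE. Qed.

(* The dual space g^* is 'Hom(g, K^o), on which x acts by
   (x.f)(y) = - f [x, y]. *)
Definition coad_fun x (f : 'Hom(g, K^o)) : 'Hom(g, K^o) := - (f \o ad x)%VF.

Lemma coad_fun_is_linear x : linear (coad_fun x).
Proof.
move=> a f f'; apply/lfunP => y.
by rewrite !(add_lfunE, opp_lfunE, scale_lfunE, comp_lfunE) opprD scalerN.
Qed.

HB.instance Definition _ x :=
  GRing.isLinear.Build K 'Hom(g, K^o) 'Hom(g, K^o) _ (coad_fun x)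
    (coad_fun_is_linear x).

Definition coad_lfun x : 'End('Hom(g, K^o)) := linfun (coad_fun x).

Lemma coadE x (f : 'Hom(g, K^o)) y : coad_lfun x f y = - f (lie x y).
Proof. by rewrite lfunE /= opp_lfunE comp_lfunE adE. Qed.

Lemma coad_lfun_is_linear : linear coad_lfun.
Proof.
move=> a x x'; apply/lfunP => f; apply/lfunP => y.
rewrite !(add_lfunE, scale_lfunE) !coadE.
by rewrite lie_linearl linearP opprD scalerN.
Qed.

HB.instance Definition _ :=
  GRing.isLinear.Build K g 'End('Hom(g, K^o)) _ coad_lfun coad_lfun_is_linear.

Lemma coad_lfun_lie x y :
  coad_lfun (lie x y) =
  (coad_lfun x \o coad_lfun y)%VF - (coad_lfun y \o coad_lfun x)%VF.
Proof.
apply/lfunP => f; apply/lfunP => z.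
rewrite !(add_lfunE, opp_lfunE, comp_lfunE) !coadE !opprK.
rewrite -raddfB -raddfN; congr (f _).
have /eqP := lie_jacobi x y z.
rewrite (lieC x z) (lieC (lie x y) z) raddfN /= addr_eq0 opprK => /eqP <-.
by rewrite opprD opprK addrC.
Qed.

Definition coad : representation g 'Hom(g, K^o) :=
  @Representation K g 'Hom(g, K^o) coad_lfun coad_lfun_lie.

End LieTheory.

(* An element x_0 + x_1 T + ... + x_m T^m is represented by the family of its
   coefficients. *)
Definition takiff (K : fieldType) (g : lieAlgType K) (m : nat) : Type :=
  {ffun 'I_m.+1 -> g}.

Section Takiff.
Variables (K : fieldType) (g : lieAlgType K) (m : nat).
Local Notation gm := (takiff g m).
Implicit Types X Y Z : gm.

HB.instance Definition _ := Vector.copy gm {ffun 'I_m.+1 -> g}.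

Definition takiff_lie X Y : gm :=
  [ffun k : 'I_m.+1 =>
    \sum_(r < m.+1) \sum_(s < m.+1 | (r + s == k)%N) lie (X r) (Y s)].

Lemma takiff_lie_linearl Y : linear (takiff_lie^~ Y).
Proof.
move=> a X X'; apply/ffunP => k; rewrite !ffunE scaler_sumr -big_split.
apply: eq_bigr => r _; rewrite scaler_sumr -big_split; apply: eq_bigr => s _.
by rewrite !ffunE lie_linearl.
Qed.

Lemma takiff_lie_linearr X : linear (takiff_lie X).
Proof.
move=> a Y Y'; apply/ffunP => k; rewrite !ffunE scaler_sumr -big_split.
apply: eq_bigr => r _; rewrite scaler_sumr -big_split; apply: eq_bigr => s _.
by rewrite !ffunE linearP.
Qed.

Lemma takiff_liexx X : takiff_lie X X = 0.
Proof.
apply/ffunP => k; rewrite !ffunE.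
pose F (r s : 'I_m.+1) := if (r + s == k)%N then lie (X r) (X s) else 0.
have FC r s : F s r = - F r s.
  by rewrite /F addnC; case: ifP => _; rewrite ?oppr0 // lieC.
have Fxx r : F r r = 0 by rewrite /F liexx if_same.
transitivity (\sum_r \sum_s F r s).
  by apply: eq_bigr => r _; rewrite big_mkcond.
rewrite (eq_bigr (fun r : 'I_m.+1 => \sum_(s < m.+1 | (s < r)%N) F r s +
    \sum_(s < m.+1 | (r < s)%N) F r s)); last first.
  move=> r _; rewrite (bigID (fun s : 'I_m.+1 => (s < r)%N)) /=; congr (_ + _).
  rewrite (bigD1 r) ?ltnn //= Fxx add0r; apply: eq_bigl => s.
  by rewrite -leqNgt [RHS]ltn_neqAle andbC eq_sym.
rewrite big_split /= [X in _ + X](exchange_big_dep xpredT) //= -big_split /=.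
rewrite big1 // => r _; rewrite -big_split big1 //= => s _.
by rewrite FC addNr.
Qed.

Lemma takiff_lieA X Y Z (k : 'I_m.+1) : takiff_lie X (takiff_lie Y Z) k =
  \sum_(r < m.+1) \sum_(s < m.+1) \sum_(t < m.+1 | (r + s + t == k)%N)
    lie (X r) (lie (Y s) (Z t)).
Proof.
rewrite ffunE; apply: eq_bigr => r _.
under eq_bigr do rewrite ffunE raddf_sum.
rewrite exchange_big; apply: eq_bigr => s _ /=.
under eq_bigr do rewrite raddf_sum /=.
rewrite (exchange_big_dep xpredT) //= [RHS]big_mkcond; apply: eq_bigr => t _.
case: ifP => [/eqP rst|rst].
  have st : (s + t < m.+1)%N.
    by apply: leq_ltn_trans (ltn_ord k); rewrite -rst -addnA leq_addl.
  rewrite (big_pred1 (Ordinal st)) // => l /=.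
  rewrite -val_eqE /= [RHS]eq_sym andbC; case: eqP => //= <-.
  by rewrite addnA rst eqxx.
rewrite big_pred0 // => l; apply/negP => /andP[/eqP rl /eqP st].
by rewrite -addnA st rl eqxx in rst.
Qed.

Lemma takiff_lie_jacobi X Y Z :
  takiff_lie X (takiff_lie Y Z) + takiff_lie Y (takiff_lie Z X) +
  takiff_lie Z (takiff_lie X Y) = 0.
Proof.
have rot (F : 'I_m.+1 -> 'I_m.+1 -> 'I_m.+1 -> g) :
    \sum_r \sum_s \sum_t F r s t = \sum_r \sum_s \sum_t F t r s.
  rewrite [RHS](eq_bigr (fun r => \sum_t \sum_s F t r s)); last first.
    by move=> r _; rewrite exchange_big.
  by rewrite [RHS]exchange_big.
apply/ffunP => k.
have addE (A B : gm) : (A + B) k = A k + B k by rewrite ffunE.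
have mk A B C : takiff_lie A (takiff_lie B C) k =
    \sum_(r < m.+1) \sum_(s < m.+1) \sum_(t < m.+1)
      if (r + s + t == k)%N then lie (A r) (lie (B s) (C t)) else 0.
  rewrite takiff_lieA; apply: eq_bigr => r _; apply: eq_bigr => s _.
  by rewrite big_mkcond.
rewrite !addE !mk [RHS]ffunE [X in _ + X + _]rot.
rewrite [X in _ + X + _]rot [X in _ + X]rot.
rewrite -!big_split big1 //= => r _; rewrite -!big_split big1 //= => s _.
rewrite -!big_split big1 //= => t _.
have -> : (s + t + r = r + s + t)%N by rewrite addnC addnA.
have -> : (t + r + s = r + s + t)%N by rewrite -addnA addnC.
by case: ifP => _; rewrite ?addr0 // lie_jacobi.
Qed.

HB.instance Definition _ := Vector_isLieAlgebra.Build K gm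
  takiff_lie_linearl takiff_lie_linearr takiff_liexx takiff_lie_jacobi.

End Takiff.

Section Dixmier.
Variables (R : realType) (K : numFieldType) (c : smooth_class R K).

Definition annihilates (W E : vectType K) (a : W * E -> E) (phi : E -> K) :
    Prop :=
  forall w e, derive1 (fun t : K => phi (e + t *: a (w, e))) 0 = 0.

Definition invariant_function (h : lieAlgType K) (E : vectType K)
    (rho : representation h E) (phi : E -> K) : Prop :=
  forall x e, derive1 (fun t : K => phi (e + t *: rho x e)) 0 = 0.

Definition dixmier (h : lieAlgType K) (E : vectType K)
    (rho : representation h E) : Prop :=
  forall (W : vectType K) (a : W * E -> E),
    smooth_map c a ->
    (forall phi : E -> K, smooth c phi -> invariant_function rho phi ->
       annihilates a phi) ->
    exists2 b : W * E -> h, smooth_map c b &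
      forall w e, a (w, e) = rho (b (w, e)) e.

End Dixmier.

(* Main.v *)
Require Import Defs.
From HB Require Import structures.
From mathcomp Require Import all_boot all_order all_algebra.
From mathcomp Require Import -(notations) mpoly.
From mathcomp Require Import complex.
From mathcomp Require Import all_classical all_reals.
From mathcomp Require Import topology normedtype sequences landau derive exp trigo.
From mathcomp Require Import zify ring lra.

(** Identify [xi] in [(g_m)^*] with [eta = sum_j eta_j T^j] in
    [g^* (x) K[T]/(T^{m+1})], where [eta_j] is the restriction of [xi] to
    [g T^{m-j}].  If [phi] is a [g]-invariant function, the coefficients of
    [phi (sum_j eta_j T^j)] are [g_m]-invariant, and the [k]-th one has the
    derivative [d phi (eta_0) (u_k)] in a direction [u] with
    [u_0 = ... = u_{k-1} = 0].  So, if a field annihilates the invariants and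
    its coefficients of order less than [k] vanish, then its [k]-th coefficient,
    as a field in the variable [eta_0] with all the other data as parameters,
    annihilates the [g]-invariants.  By hypothesis it is [ad^* b], and
    subtracting the action of [b T^k] raises [k].

    Only closure properties of the class of smooth functions are used, mainly
    stability under derivation.  An analytic function is described near a point
    as a limit of polynomials for the l^1 norm of the coefficients, weighted by
    the powers of a radius; this description passes to products, to linear
    substitutions and to derivatives.  For a holomorphic function of several
    variables, Goursat's argument, with trapezoidal sums in place of integrals,
    gives [f'(0) = (2 pi)^-1 int_0^{2 pi} f (e^{it}) e^{-it} dt] along every
    line, hence Lipschitz bounds on the derivatives.  In both cases the
    derivative is a pointwise limit of functions with a uniform second order
    Taylor estimate, so that it is differentiable. *)

Set Implicit Arguments.
Unset Strict Implicit.
Unset Printing Implicit Defensive.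

Import Order.TTheory GRing.Theory Num.Theory VectorInternalTheory.
Import numFieldNormedType.Exports.

Local Open Scope classical_set_scope.
Local Open Scope ring_scope.

(** * Classes of smooth functions *)

(** Expanding [phi] in a series is meaningless for a C^infty function, so the coefficients of phi
    (sum_j eta_j T^j) are produced by iterating one linear vector field on the dual, the transpose
    of [takiff_shift], which acts as d/dT. Its commutator with the coadjoint field of X is the
    coadjoint field of dX/dT, except on the last coefficient eta_m, where the truncation T^{m+1} = 0
    leaves an error. The coefficient of order k involves eta_0, ..., eta_k only, so the error is
    invisible as long as k < m, which is exactly the range in which one more derivation is taken.
    Every vector field used as an operator on functions is linear; hence multiplication by a
    coordinate is the only product among the closure properties. The symmetry of second derivatives
    is among them because commutators of vector fields rest on it. *)

Record smooth_axioms (K : numFieldType)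
    (S : forall n, ('rV[K]_n -> K) -> Prop) : Prop := SmoothAxioms {
  smooth_cst : forall n (a : K), S n (fun=> a);
  smooth_add : forall n f g, S n f -> S n g -> S n (fun x => f x + g x);
  smooth_scale : forall n a f, S n f -> S n (fun x => a * f x);
  smooth_mul_coord : forall n i f, S n f -> S n (fun x => x 0 i * f x);
  smooth_mulmx : forall n p (M : 'M[K]_(n, p)) f,
    S p f -> S n (fun x => f (x *m M));
  smooth_differentiable : forall n f, S n f -> forall x, differentiable f x;
  smooth_derive : forall n f v, S n f -> S n ('D_v f);
  smooth_deriveC : forall n f u v x,
    S n f -> 'D_u ('D_v f) x = 'D_v ('D_u f) x }.

(** The expression through which [annihilates] and [invariant_function] are phrased, isolated so
    that both unfold to statements about it. *)
Definition dird (K : numFieldType) (V : vectType K) (f : V -> K) (x u : V) : K :=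
  derive1 (fun t : K => f (x + t *: u)) 0.

Lemma dirdE (K : numFieldType) (V : vectType K) (f : V -> K) (x u : V) :
  dird f x u = 'D_(v2r u) (f \o r2v) (v2r x).
Proof.
rewrite /dird derive1E /derive.
have E h : r2v (h *: v2r u + v2r x) = x + h *: u.
  by apply: (can_inj v2rK); rewrite r2vK linearD linearZ/= addrC.
apply: (congr1 (fun F : K -> K => lim (F @ 0^'))); apply/funext => h /=.
by rewrite addr0 scale0r addr0 v2rK E [_%:A]mulr1.
Qed.

Lemma is_derive_scalar_linear (K : numFieldType) n (F : 'rV[K]_n -> K) y v :
  linear F -> is_derive y v F (F v).
Proof.
move=> lF; suff cF : h^-1 *: (F (h *: v + y) - F y) @[h --> 0^'] --> F v.
  by apply: DeriveDef; [apply/cvg_ex; exists (F v)|apply/cvg_lim].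
apply: cvg_near_cst; near=> h.
have h0 : h != 0 by near: h; exact: nbhs_dnbhs_neq.
by rewrite lF addrK scalerA mulVf ?scale1r.
Unshelve. all: by end_near. Qed.

(** * Smooth functions and directional derivatives on abstract vector spaces *)

Section VectSmooth.
Variables (K : numFieldType) (S : forall n, ('rV[K]_n -> K) -> Prop).
Hypothesis SA : smooth_axioms S.

(** For [S] the family [smooth_rV c] this is convertible to [smooth c], so that the hypothesis
    [dixmier] applies to it directly. *)
Definition vsmooth (V : vectType K) (f : V -> K) := S (fun x => f (r2v x)).

Definition vsmooth_map (V U : vectType K) (f : V -> U) :=
  forall i, vsmooth (fun v => v2r (f v) 0 i).

Implicit Types V U X : vectType K.

Lemma vsmooth_ext V (f g : V -> K) : f =1 g -> vsmooth f -> vsmooth g.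
Proof. by move=> /funext->. Qed.

Lemma vsmooth_cst V (a : K) : vsmooth (fun _ : V => a).
Proof. exact: smooth_cst. Qed.

Lemma vsmoothD V (f g : V -> K) :
  vsmooth f -> vsmooth g -> vsmooth (fun x => f x + g x).
Proof. exact: smooth_add. Qed.

Lemma vsmoothZ V a (f : V -> K) : vsmooth f -> vsmooth (fun x => a * f x).
Proof. exact: smooth_scale. Qed.

Lemma vsmooth_sum V I (r : seq I) (f : I -> V -> K) :
  (forall i, vsmooth (f i)) -> vsmooth (fun x => \sum_(i <- r) f i x).
Proof.
move=> sf; elim: r => [|i r IH].
  by apply: vsmooth_ext (vsmooth_cst V 0) => x; rewrite big_nil.
by apply: vsmooth_ext (vsmoothD (sf i) IH) => x; rewrite big_cons.
Qed.

Lemma v2r_linearE V U (l : {linear V -> U}) (x : 'rV[K]_(dim V)) :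
  v2r (l (r2v x)) = x *m lin1_mx (v2r \o l \o r2v).
Proof. by rewrite mul_rV_lin1. Qed.

Lemma vsmooth_comp V U (l : V -> U) (f : U -> K) : linear l ->
  vsmooth f -> vsmooth (fun x => f (l x)).
Proof.
move=> ll; pose L : {linear V -> U} := HB.pack l (GRing.isLinear.Build K V U _ l ll).
move=> /(smooth_mulmx SA (lin1_mx (v2r \o L \o r2v))); congr S.
by apply/funext => x; rewrite -(v2r_linearE L) v2rK.
Qed.

Lemma vsmooth_mul_coord V U (l : V -> U) i (f : V -> K) : linear l ->
  vsmooth f -> vsmooth (fun x => v2r (l x) 0 i * f x).
Proof.
move=> ll sf; pose L : {linear V -> U} := HB.pack l (GRing.isLinear.Build K V U _ l ll).
pose M := lin1_mx (v2r \o L \o r2v).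
have : vsmooth (fun x : V => \sum_j (M j i) * (v2r x 0 j * f x)).
  apply: vsmooth_sum => j; apply: vsmoothZ.
  have := smooth_mul_coord SA j sf; congr S.
  by apply/funext => x; rewrite r2vK.
apply: vsmooth_ext => x; rewrite -[in RHS](v2rK x) (v2r_linearE L) mxE mulr_suml.
by apply: eq_bigr => j _; rewrite v2rK mulrA [M _ _ * _]mulrC.
Qed.

Lemma v2r_sum V (x : V) : x = \sum_i v2r x 0 i *: r2v (delta_mx 0 i).
Proof.
by apply: (can_inj v2rK); rewrite linear_sum/= {1}[v2r x]row_sum_delta;
  apply: eq_bigr => i _; rewrite linearZ/= r2vK.
Qed.

Lemma vsmooth_map_comp V U X (l : V -> U) (f : U -> X) : linear l ->
  vsmooth_map f -> vsmooth_map (fun x => f (l x)).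
Proof. by move=> ll sf i; apply: (vsmooth_comp ll (sf i)). Qed.

Lemma vsmooth_map_linear V U X (l : U -> X) (f : V -> U) : linear l ->
  vsmooth_map f -> vsmooth_map (fun x => l (f x)).
Proof.
move=> ll sf i; pose L : {linear U -> X} := HB.pack l (GRing.isLinear.Build K U X _ l ll).
pose M := lin1_mx (v2r \o L \o r2v).
have : vsmooth (fun x : V => \sum_j (M j i) * (v2r (f x) 0 j)).
  by apply: vsmooth_sum => j; apply: vsmoothZ; apply: sf.
apply: vsmooth_ext => x; rewrite -[in RHS](v2rK (f x)) (v2r_linearE L) mxE.
by apply: eq_bigr => j _; rewrite mulrC.
Qed.

Lemma vsmooth_mapD V U (f g : V -> U) :
  vsmooth_map f -> vsmooth_map g -> vsmooth_map (fun x => f x + g x).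
Proof.
move=> sf sg i; apply: vsmooth_ext (vsmoothD (sf i) (sg i)) => x.
by rewrite linearD mxE.
Qed.

Lemma vsmooth_mapN V U (f : V -> U) :
  vsmooth_map f -> vsmooth_map (fun x => - f x).
Proof.
move=> sf i; apply: vsmooth_ext (vsmoothZ (-1) (sf i)) => x.
by rewrite linearN mxE mulN1r.
Qed.

Lemma vsmooth_map0 V U : vsmooth_map (fun _ : V => 0 : U).
Proof.
by move=> i; apply: vsmooth_ext (vsmooth_cst V 0) => x; rewrite linear0 mxE.
Qed.

(** Since [l] is linear, expanding in coordinates leaves only products of a smooth function by a
    linear coordinate. It serves to show that the coadjoint action of a smooth [b] on the point
    itself is smooth. *)
Lemma vsmooth_map_bilinear V U X (Y : vectType K) (be : U -> X -> Y)
    (b : V -> U) (l : V -> X) :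
    (forall x, linear (be^~ x)) -> (forall u, linear (be u)) -> linear l ->
  vsmooth_map b -> vsmooth_map (fun x => be (b x) (l x)).
Proof.
move=> bel ber ll sb i.
pose c k j := v2r (be (r2v (delta_mx 0 k)) (r2v (delta_mx 0 j))) 0 i.
have : vsmooth (fun x : V => \sum_k \sum_j
    c k j * (v2r (l x) 0 j * v2r (b x) 0 k)).
  apply: vsmooth_sum => k; apply: vsmooth_sum => j; apply: vsmoothZ.
  by apply: vsmooth_mul_coord => //; apply: sb.
apply: vsmooth_ext => x.
pose L : {linear U -> Y} :=
  HB.pack (be^~ (l x)) (GRing.isLinear.Build K U Y _ _ (bel (l x))).
rewrite -[RHS]/(v2r (L (b x)) 0 i) {2}(v2r_sum (b x)) !linear_sum summxE.
apply: eq_bigr => k _; rewrite !linearZ mxE.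
pose e : U := r2v (delta_mx 0 k).
pose L' : {linear X -> Y} :=
  HB.pack (be e) (GRing.isLinear.Build K X Y _ _ (ber e)).
rewrite -[L _]/(L' (l x)) {2}(v2r_sum (l x)) !linear_sum summxE mulr_sumr.
by apply: eq_bigr => j _; rewrite !linearZ mxE /c; ring.
Qed.

Lemma vdifferentiable V (f : V -> K) x :
  vsmooth f -> differentiable (f \o r2v) x.
Proof. by move=> sf; apply: (smooth_differentiable SA sf). Qed.

Lemma dird_linear V (f : V -> K) x : vsmooth f -> linear (dird f x).
Proof.
move=> sf a u v; rewrite !dirdE !deriveE; do 1?exact: vdifferentiable.
by rewrite !linearP.
Qed.

Lemma dirdD V (f : V -> K) x u v :
  vsmooth f -> dird f x (u + v) = dird f x u + dird f x v.
Proof. by move=> sf; have := dird_linear x sf 1 u v; rewrite !scale1r. Qed.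

Lemma dird0 V (f : V -> K) x : vsmooth f -> dird f x 0 = 0.
Proof.
move=> sf; have := dirdD x 0 0 sf; rewrite addr0 => /eqP.
by rewrite -subr_eq subrr eq_sym => /eqP.
Qed.

Lemma dirdZ V (f : V -> K) x a u :
  vsmooth f -> dird f x (a *: u) = a * dird f x u.
Proof.
by move=> sf; have := dird_linear x sf a u 0; rewrite !addr0 dird0 // addr0.
Qed.

Lemma dirdB V (f : V -> K) x u v :
  vsmooth f -> dird f x (u - v) = dird f x u - dird f x v.
Proof.
by move=> sf; rewrite -scaleN1r dirdD // dirdZ // mulN1r.
Qed.

Lemma dird_sum V (f : V -> K) x I (r : seq I) (u : I -> V) :
  vsmooth f -> dird f x (\sum_(i <- r) u i) = \sum_(i <- r) dird f x (u i).
Proof.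
move=> sf; elim: r => [|i r IH]; first by rewrite !big_nil dird0.
by rewrite !big_cons dirdD // IH.
Qed.

Lemma dird_cst V (a : K) (x u : V) : dird (fun=> a) x u = 0.
Proof. by rewrite /dird derive1E derive_cst. Qed.

Lemma dird_comp V U (l : V -> U) (f : U -> K) x u : linear l ->
  dird (fun y => f (l y)) x u = dird f (l x) (l u).
Proof.
move=> ll; rewrite /dird; congr (derive1 _ _); apply/funext => t.
by rewrite addrC ll addrC.
Qed.

Lemma vsmooth_dird V (f : V -> K) u :
  vsmooth f -> vsmooth (fun x => dird f x u).
Proof.
move=> /(smooth_derive SA (v2r u)); congr S; apply/funext => x.
by rewrite dirdE r2vK.
Qed.

Lemma dird_coord V (f : V -> K) x u : vsmooth f ->
  dird f x u = \sum_i v2r u 0 i * dird f x (r2v (delta_mx 0 i)).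
Proof.
move=> sf; rewrite [in LHS](v2r_sum u) dird_sum //.
by apply: eq_bigr => i _; rewrite dirdZ.
Qed.

Definition lfield V (A : V -> V) (f : V -> K) x := dird f x (A x).

Lemma vsmooth_lfield V (A : V -> V) (f : V -> K) : linear A ->
  vsmooth f -> vsmooth (lfield A f).
Proof.
move=> lA sf.
have : vsmooth (fun x : V =>
    \sum_i v2r (A x) 0 i * dird f x (r2v (delta_mx 0 i))).
  by apply: vsmooth_sum => i; apply: vsmooth_mul_coord => //; apply: vsmooth_dird.
by apply: vsmooth_ext => x; rewrite -dird_coord.
Qed.

Lemma dirdC V (f : V -> K) x u v : vsmooth f ->
  dird (fun y => dird f y u) x v = dird (fun y => dird f y v) x u.
Proof.
move=> sf; have E w : (fun y => dird f y w) \o r2v = 'D_(v2r w) (f \o r2v).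
  by apply/funext => y; rewrite /= dirdE r2vK.
by rewrite ![LHS]dirdE ![RHS]dirdE !E (smooth_deriveC SA).
Qed.

(** Product rule for the sum of the A(x)_i d_i f (x): the coefficients are linear, so their
    derivative along [u] is [A u]; in the second term the direction [A x] is frozen. *)
Lemma dird_lfield V (A : V -> V) (f : V -> K) x u : linear A -> vsmooth f ->
  dird (lfield A f) x u = dird f x (A u) + dird (fun y => dird f y (A x)) x u.
Proof.
move=> lA sf; pose e i : V := r2v (delta_mx 0 i).
pose c i : 'rV[K]_(dim V) -> K := fun y => v2r (A (r2v y)) 0 i.
pose d i : 'rV[K]_(dim V) -> K := fun y => dird f (r2v y) (e i).
have dd i y v : derivable (d i) y v.
  apply: diff_derivable; exact: (vdifferentiable _ (vsmooth_dird (e i) sf)).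
have dc i y v : is_derive y v (c i) (c i v).
  by apply: is_derive_scalar_linear => a s t; rewrite /c linearP lA linearP !mxE.
rewrite dirdE.
have -> : lfield A f \o r2v = \sum_i (c i * d i).
  by apply/funext => y; rewrite fct_sumE /= /lfield dird_coord.
have dcd i : is_derive (v2r x) (v2r u) (c i * d i)
    (c i (v2r x) *: 'D_(v2r u) (d i) (v2r x) + d i (v2r x) *: c i (v2r u)).
  apply: is_deriveM; apply: derivableP; exact: dd.
rewrite derive_val big_split addrC /= (dird_coord _ (A u)) //.
have frozen : (fun y => dird f y (A x)) \o r2v = \sum_i (c i (v2r x) *: d i).
  apply/funext => y; rewrite fct_sumE /= (dird_coord _ (A x)) //.
  by apply: eq_bigr => i _; rewrite /c v2rK.
have dcd' i : is_derive (v2r x) (v2r u) (c i (v2r x) *: d i)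
    (c i (v2r x) *: 'D_(v2r u) (d i) (v2r x)).
  by apply: is_deriveZ; apply: derivableP; exact: dd.
rewrite dirdE frozen derive_val; congr (_ + _).
by apply: eq_bigr => i _; rewrite /c /d !v2rK [LHS]mulrC.
Qed.

(** The second order terms cancel by [dirdC], which leaves the derivative along the Lie bracket of
    the two linear fields, here BA - AB. *)
Lemma lfieldC V (A B : V -> V) (f : V -> K) x :
    linear A -> linear B -> vsmooth f ->
  lfield A (lfield B f) x =
  lfield B (lfield A f) x + dird f x (B (A x) - A (B x)).
Proof.
move=> lA lB sf.
have /= eB := dird_lfield x (A x) lB sf; have /= eA := dird_lfield x (B x) lA sf.
rewrite -[LHS]/(dird (lfield B f) x (A x)) -[lfield B _ x]/(dird (lfield A f) x (B x)).
by rewrite eA eB (dirdB _ _ _ sf) (dirdC x (B x) (A x) sf); ring.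
Qed.

End VectSmooth.

(** * The coadjoint representation of a Takiff algebra *)

Definition dual_space (K : fieldType) (g : lieAlgType K) : vectType K :=
  'Hom(g, K^o).

Section TakiffDual.
Variables (K : fieldType) (g : lieAlgType K) (m : nat).
Local Notation gm := (takiff g m).
Local Notation E := 'Hom(g, K^o).
Local Notation Em := 'Hom(gm, K^o).
Implicit Types (X : gm) (xi : Em) (i k l : 'I_m.+1).

Definition takiff_monomial i (y : g) : gm := [ffun j => if j == i then y else 0].

Lemma takiff_monomial_is_linear i : linear (takiff_monomial i).
Proof.
by move=> a y z; apply/ffunP => j; rewrite !ffunE; case: eqP; rewrite ?scaler0 ?addr0.
Qed.

HB.instance Definition _ i := GRing.isLinear.Build K g gm _
  (takiff_monomial i) (takiff_monomial_is_linear i).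

Lemma takiff_sum_monomial X : X = \sum_i takiff_monomial i (X i).
Proof.
apply/ffunP => j; rewrite sum_ffunE (bigD1 j) //= ffunE eqxx big1 ?addr0 // => i ij.
by rewrite ffunE eq_sym (negbTE ij).
Qed.

(* With [eta_j := dual_coef (m - j)], the coadjoint action of [gm] on [Em]
   becomes the action of [g^* (x) K[T]/(T^{m+1})] on [sum_j eta_j T^j]. *)
Definition dual_coef i xi : E := (xi \o linfun (takiff_monomial i))%VF.

Lemma dual_coefE i xi y : dual_coef i xi y = xi (takiff_monomial i y).
Proof. by rewrite comp_lfunE lfunE. Qed.

Lemma dual_coef_is_linear i : linear (dual_coef i).
Proof.
by move=> a xi xi'; apply/lfunP => y; rewrite !(dual_coefE, add_lfunE, scale_lfunE).
Qed.

HB.instance Definition _ i := GRing.isLinear.Build K Em E _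
  (dual_coef i) (dual_coef_is_linear i).

Lemma dual_coefP xi xi' : (forall i, dual_coef i xi = dual_coef i xi') -> xi = xi'.
Proof.
move=> e; apply/lfunP => X; rewrite (takiff_sum_monomial X) !linear_sum.
by apply: eq_bigr => i _ /=; rewrite -!dual_coefE e.
Qed.

Definition takiff_coef i X : g := X i.

Lemma takiff_coef_is_linear i : linear (takiff_coef i).
Proof. by move=> a X X'; rewrite /takiff_coef !ffunE. Qed.

HB.instance Definition _ i := GRing.isLinear.Build K gm g _
  (takiff_coef i) (takiff_coef_is_linear i).

Definition dual_monomial i (e : E) : Em := (e \o linfun (takiff_coef i))%VF.

Lemma dual_monomial_is_linear i : linear (dual_monomial i).
Proof.
by move=> a xi xi'; apply/lfunP => y;
  rewrite !(comp_lfunE, add_lfunE, scale_lfunE).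
Qed.

HB.instance Definition _ i := GRing.isLinear.Build K E Em _
  (dual_monomial i) (dual_monomial_is_linear i).

Lemma dual_coef_monomial i k e :
  dual_coef i (dual_monomial k e) = if i == k then e else 0.
Proof.
apply/lfunP => y; rewrite dual_coefE comp_lfunE lfunE /= /takiff_coef ffunE.
by rewrite eq_sym; case: eqP; rewrite ?linear0 ?zero_lfunE.
Qed.

(* On the generating series [sum_j eta_j T^j], its transpose is [d/dT], up to
   the term [(m + 1) eta_{m+1} T^m]. *)
Definition takiff_shift X : gm :=
  [ffun l : 'I_m.+1 => (m - l)%:R *: X (inord l.+1)].

Lemma takiff_shift_is_linear : linear takiff_shift.
Proof.
move=> a X X'; apply/ffunP => l; rewrite !ffunE !scalerDr !scalerA.
by rewrite [a * _]mulrC.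
Qed.

HB.instance Definition _ := GRing.isLinear.Build K gm gm _
  takiff_shift takiff_shift_is_linear.

Definition dual_shift xi : Em := (xi \o linfun takiff_shift)%VF.

Lemma dual_shiftE xi X : dual_shift xi X = xi (takiff_shift X).
Proof. by rewrite comp_lfunE lfunE. Qed.

Lemma dual_shift_is_linear : linear dual_shift.
Proof.
by move=> a xi xi'; apply/lfunP => y; rewrite !(dual_shiftE, add_lfunE, scale_lfunE).
Qed.

HB.instance Definition _ := GRing.isLinear.Build K Em Em _
  dual_shift dual_shift_is_linear.

(** This is dX/dT. The test [r < m] excludes the index m + 1, at which [inord] is meaningless; in
    [takiff_shift] the factor m - l = 0 does the same. *)
Definition takiff_deriv X : gm :=
  [ffun r : 'I_m.+1 => if (r < m)%N then r.+1%:R *: X (inord r.+1) else 0].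

Lemma lie_monomialE X i y l : lie X (takiff_monomial i y) l =
  if (i <= l)%N then lie (X (inord (l - i))) y else 0.
Proof.
rewrite ffunE; transitivity (\sum_(r < m.+1 | (r + i == l)%N) lie (X r) y).
  rewrite [RHS]big_mkcond; apply: eq_bigr => r _.
  rewrite big_mkcond (bigD1 i) //= ffunE eqxx big1 ?addr0 // => s si.
  by rewrite ffunE (negbTE si) linear0 if_same.
case: leqP => il.
  have lim : (l - i < m.+1)%N by rewrite ltnS (leq_trans (leq_subr _ _)) // -ltnS.
  rewrite (big_pred1 (inord (l - i))) // => r /=.
  rewrite -val_eqE /= inordK //; lia.
by rewrite big_pred0 // => r; lia.
Qed.

(** With i = m - j, the right side is the sum over r <= j of X_r acting on eta_{j-r}: the coadjoint
    action is the product of generating series modulo T^{m+1}. *)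
Lemma dual_coef_coad i X xi : dual_coef i (coad gm X xi) =
  \sum_(r < m.+1 | (r + i <= m)%N) coad g (X r) (dual_coef (inord (r + i)) xi).
Proof.
apply/lfunP => y; rewrite dual_coefE coadE sum_lfunE.
rewrite (_ : lie X (takiff_monomial i y) =
   \sum_(r < m.+1 | (r + i <= m)%N) takiff_monomial (inord (r + i)) (lie (X r) y)).
  rewrite linear_sum -sumrN; apply: eq_bigr => r _.
  by rewrite coadE dual_coefE.
apply/ffunP => l; rewrite lie_monomialE sum_ffunE.
case: leqP => il.
  have lim : (l - i < m.+1)%N by rewrite ltnS (leq_trans (leq_subr _ _)) // -ltnS.
  have lm := ltn_ord l.
  rewrite (bigD1 (inord (l - i))) /= ?inordK //; last by lia.
  rewrite subnK // ffunE -val_eqE /= inordK // eqxx big1 ?addr0 // => r.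
  rewrite -val_eqE /= inordK // => /andP[rm rl]; rewrite ffunE -val_eqE /= inordK //.
  by case: eqP => // lr; exfalso; move: rl; rewrite lr addnK eqxx.
rewrite big1 // => r rm; rewrite ffunE -val_eqE /= inordK //.
by case: eqP => // lr; lia.
Qed.

Lemma dual_coef_coad_monomial i k y xi :
  dual_coef i (coad gm (takiff_monomial k y) xi) =
  if (k + i <= m)%N then coad g y (dual_coef (inord (k + i)) xi) else 0.
Proof.
rewrite dual_coef_coad big_mkcond (bigD1 k) //= ffunE eqxx big1 ?addr0 // => r rk.
by rewrite ffunE (negbTE rk) (linear0 (coad g)) zero_lfunE if_same.
Qed.

Lemma dual_coef_coad_max X xi :
  dual_coef ord_max (coad gm X xi) = coad g (X ord0) (dual_coef ord_max xi).
Proof.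
rewrite dual_coef_coad (big_pred1 ord0) => [|r].
  by congr (coad g _ (dual_coef _ _)); apply: val_inj; rewrite /= inordK.
by rewrite /= -(inj_eq val_inj) /=; lia.
Qed.

Lemma takiff_monomialE i y j :
  takiff_monomial i y j = if (j == i :> nat) then y else 0.
Proof. by rewrite ffunE. Qed.

Lemma takiff_shift_monomial i y : takiff_shift (takiff_monomial i y) =
  (if (0 < i)%N then (m.+1 - i)%:R *: takiff_monomial (inord i.-1) y else 0).
Proof.
have im : (i <= m)%N by rewrite -ltnS.
have i1m : (i.-1 < m.+1)%N by rewrite ltnS (leq_trans (leq_pred _)).
apply/ffunP => l; have lm : (l <= m)%N by rewrite -ltnS.
rewrite (ffunE (fun l : 'I_m.+1 => _)) takiff_monomialE.
have -> : (if (0 < i)%N then (m.+1 - i)%:R *: takiff_monomial (inord i.-1) y else 0) l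
    = if (l.+1 == i)%N then (m.+1 - i)%:R *: y else 0.
  case: (posnP i) => [->|i0]; first by rewrite ffunE.
  have -> : (l.+1 == i :> nat) = (l == i.-1 :> nat) by rewrite -{1}(prednK i0) eqSS.
  rewrite ffunE takiff_monomialE inordK //.
  by case: eqP; rewrite ?scaler0.
have [lm'|ml] := ltnP l m.
  by rewrite inordK //; case: eqP => [<-|]; rewrite ?scaler0.
have -> : (m - l)%N = 0%N by apply/eqP; rewrite subn_eq0.
by rewrite scale0r; case: eqP => // li; rewrite -li in im; rewrite ltnNge ml in im.
Qed.

Lemma dual_coef_shift i xi : dual_coef i (dual_shift xi) =
  if (0 < i)%N then (m.+1 - i)%:R *: dual_coef (inord i.-1) xi else 0.
Proof.
apply/lfunP => y; rewrite dual_coefE dual_shiftE takiff_shift_monomial.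
by case: ifP; rewrite ?linearZ ?scale_lfunE ?dual_coefE ?linear0 ?zero_lfunE.
Qed.

Lemma lieZl a (x y : g) : lie (a *: x) y = a *: lie x y.
Proof. by rewrite (lieC y (a *: x)) linearZ (lieC y x) scalerN. Qed.

Lemma takiff_derivE X l :
  (l < m)%N -> takiff_deriv X l = l.+1%:R *: X (inord l.+1).
Proof. by move=> lm; rewrite ffunE lm. Qed.

(** Leibniz rule for d/dT, transposed. In degree l both sides are multiples of [X_{l-i+1}, y], with
    l - i + 1 = (m + 1 - i) - (m - l). At i = 0 it breaks down, since the shift of y T^0 is 0. *)
Lemma lie_takiff_deriv i X y : (0 < i)%N ->
  lie (takiff_deriv X) (takiff_monomial i y) =
  lie X (takiff_shift (takiff_monomial i y)) -
  takiff_shift (lie X (takiff_monomial i y)).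
Proof.
move=> i0; have im : (i <= m)%N by rewrite -ltnS.
have i1m : (i.-1 < m.+1)%N by rewrite ltnS (leq_trans (leq_pred _)).
rewrite takiff_shift_monomial i0 linearZ; apply/ffunP => l.
have lm : (l <= m)%N by rewrite -ltnS.
have subE (A B : gm) j : (A - B) j = A j - B j by rewrite !ffunE.
have scaleE a (A : gm) j : (a *: A) j = a *: A j by rewrite ffunE.
rewrite subE scaleE (ffunE (fun l : 'I_m.+1 => _ *: _)) !lie_monomialE inordK //.
have [il|li] := leqP i l.
  have rm : (l - i < m)%N by lia.
  rewrite (_ : i.-1 <= l)%N; last by lia.
  have rm1 : (l - i < m.+1)%N by lia.
  rewrite takiff_derivE inordK //.
  rewrite (_ : l - i.-1 = (l - i).+1)%N; last by lia.
  rewrite lieZl; have [lm'|ml] := ltnP l m; last first.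
    rewrite (_ : m - l = 0)%N; last by lia.
    by rewrite scale0r subr0; congr (_%:R *: _); lia.
  rewrite inordK // (_ : i <= l.+1)%N; last by lia.
  rewrite (_ : l.+1 - i = (l - i).+1)%N; last by lia.
  by rewrite -scalerBl -natrB; [congr (_%:R *: _)|]; lia.
have lm' : (l < m)%N by lia.
rewrite inordK //; have [li'|il'] := leqP i l.+1.
  rewrite (_ : i.-1 <= l)%N; last by lia.
  rewrite (_ : l - i.-1 = l.+1 - i)%N; last by lia.
  by rewrite -scalerBl (_ : m.+1 - i = m - l)%N ?subrr ?scale0r //; lia.
rewrite (_ : (i.-1 <= l)%N = false); last by lia.
by rewrite !scaler0 subr0.
Qed.

(** The commutator of d/dT with the coadjoint field of X is that of dX/dT on eta_0, ..., eta_{m-1}.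
    The excluded index i = 0 is eta_m, where the term of order m + 1 lost in the truncation would
    enter. *)
Lemma dual_shift_coad i X xi : (0 < i)%N ->
  dual_coef i (dual_shift (coad gm X xi) - coad gm X (dual_shift xi) -
    coad gm (takiff_deriv X) xi) = 0.
Proof.
move=> i0; rewrite linearB; apply/eqP; rewrite subr_eq0; apply/eqP.
apply/lfunP => y; rewrite !dual_coefE add_lfunE opp_lfunE.
rewrite dual_shiftE !coadE dual_shiftE opprK.
by rewrite lie_takiff_deriv // linearB opprB addrC.
Qed.

(** Replaces eta_0 by [e], which turns the base point into an independent variable. It is linear in
    the pair (xi, e), so that substituting it preserves smoothness. *)
Definition rebase xi (e : E) : Em :=
  xi + dual_monomial ord_max (e - dual_coef ord_max xi).

Lemma rebase_is_linear a xi xi' (e e' : E) :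
  rebase (a *: xi + xi') (a *: e + e') = a *: rebase xi e + rebase xi' e'.
Proof.
rewrite /rebase (linearP (dual_coef ord_max)) scalerDr addrACA.
rewrite -(linearP (dual_monomial ord_max)) scalerBr; congr (_ + dual_monomial _ _).
by rewrite opprD addrACA.
Qed.

Lemma dual_coef_rebase xi e : dual_coef ord_max (rebase xi e) = e.
Proof. by rewrite /rebase linearD /= dual_coef_monomial eqxx addrC subrK. Qed.

Lemma rebase_dual_coef xi : rebase xi (dual_coef ord_max xi) = xi.
Proof. by rewrite /rebase subrr linear0 addr0. Qed.

(** The indices i >= j are the orders m - i <= m - j. The element y T^{m-j} acts by 0 in the orders
    below m - j, and by y on eta_0 in the order m - j, where it cancels [xi]. *)
Lemma dual_coef_sub_coad_monomial (i j : 'I_m.+1) xi xi' y : (j <= i)%N ->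
    (dual_coef j xi = coad g y (dual_coef ord_max xi')) ->
    ((j < i)%N -> dual_coef i xi = 0) ->
  dual_coef i (xi - coad gm (takiff_monomial (inord (m - j)) y) xi') = 0.
Proof.
move=> ji xij xi0; have [jm im] := (ltn_ord j, ltn_ord i).
rewrite linearB /= dual_coef_coad_monomial inordK; last by lia.
case: ltngtP ji => // [ji _|ji _].
  by rewrite xi0 // ifF ?subrr //; lia.
have -> : i = j by apply: val_inj.
rewrite xij ifT; last by lia.
have -> : inord (m - j + j) = ord_max :> 'I_m.+1.
  by apply: val_inj; rewrite /= inordK; lia.
by rewrite subrr.
Qed.

End TakiffDual.

(** * Invariants of the Takiff algebra obtained from an invariant of [g] *)

Section TakiffInvariants.
Variables (K : numFieldType) (S : forall n, ('rV[K]_n -> K) -> Prop).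
Hypothesis SA : smooth_axioms S.
Variables (g : lieAlgType K) (m : nat).
Local Notation gm := (takiff g m).
Local Notation E := (dual_space g).
Local Notation Em := (dual_space gm).
Local Notation coef := (@dual_coef K g m).
Local Notation shift := (@dual_shift K g m).
Variable phi : E -> K.
Hypothesis smooth_phi : vsmooth S phi.

(* [k!] times the coefficient of [T^k] in [phi (sum_j eta_j T^j)]. *)
Definition taylor_coef k : Em -> K :=
  iter k (@lfield K Em shift) (fun xi => phi (coef ord_max xi)).

Lemma vsmooth_taylor_coef k : vsmooth S (taylor_coef k).
Proof.
elim: k => [|k IH].
  exact: (vsmooth_comp SA (dual_coef_is_linear ord_max)).
exact: (vsmooth_lfield SA (@dual_shift_is_linear K g m)).
Qed.

(** The hypothesis says that u starts in order k. In the induction step, the derivative along [u] of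
    the next coefficient has a part containing the second derivative of the previous one; it
    vanishes because the previous one has zero derivative along [u] at every point. What remains is
    the derivative along du/dT, whose coefficient of order k is (k + 1) u_{k+1}, whence (k + 1)!. *)
Lemma dird_taylor_coef k (xi u : Em) : (k <= m)%N ->
    (forall i : 'I_m.+1, (m - k < i)%N -> coef i u = 0) ->
  dird (taylor_coef k) xi u =
  k`!%:R * dird phi (coef ord_max xi) (coef (inord (m - k)) u).
Proof.
elim: k xi u => [|k IH] xi u km u0.
  have /= e0 := dird_comp phi xi u (@dual_coef_is_linear K g m ord_max).
  rewrite fact0 mul1r subn0; apply: (etrans e0).
  by have -> : ord_max = inord m :> 'I_m.+1 by apply: val_inj; rewrite /= inordK.
have sk := vsmooth_taylor_coef k.
have km' : (k <= m)%N by exact: ltnW.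
have frozen : (fun y => dird (taylor_coef k) y u) = fun=> 0.
  apply/funext => y; rewrite (IH y u km'); last first.
    by move=> i ki; apply: u0; lia.
  rewrite u0; last by rewrite inordK; lia.
  by have -> := dird0 SA (coef ord_max y) smooth_phi; rewrite mulr0.
have /= eL := dird_lfield SA xi u (@dual_shift_is_linear K g m) sk.
apply: (etrans eL); have -> := dirdC SA xi (shift xi) u sk.
rewrite frozen dird_cst addr0 (IH xi (shift u) km'); last first.
  move=> i ki; have im := ltn_ord i.
  rewrite dual_coef_shift; case: ifP => // i0; rewrite u0 ?scaler0 //.
  by rewrite inordK; lia.
rewrite dual_coef_shift inordK; last by lia.
rewrite ifT; last by lia.
have -> : (m.+1 - (m - k) = k.+1)%N by lia.
have -> : ((m - k).-1 = m - k.+1)%N by lia.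
rewrite (dirdZ SA _ _ _ smooth_phi) factS natrM; ring.
Qed.

Hypothesis phi_invariant : forall y e, dird phi e (coad g y e) = 0.

(** By [lfieldC], moving the coadjoint field past d/dT leaves the derivative of the previous
    coefficient along the commutator. Up to an error concentrated in eta_m, this direction is the
    coadjoint one of dX/dT, so the induction hypothesis for that element applies. The error is not
    seen, by [dird_taylor_coef], as the previous order is less than m. *)
Lemma taylor_coef_invariant k (X : gm) (xi : Em) : (k <= m)%N ->
  dird (taylor_coef k) xi (coad gm X xi) = 0.
Proof.
elim: k X xi => [|k IH] X xi km.
  have /= e0 := dird_comp phi xi (coad gm X xi) (@dual_coef_is_linear K g m ord_max).
  by apply: (etrans e0); rewrite dual_coef_coad_max; apply: phi_invariant.
have sk := vsmooth_taylor_coef k.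
have km' : (k <= m)%N by exact: ltnW.
have lA : linear (coad gm X : Em -> Em) by move=> a u v; rewrite linearP.
have /= eC := lfieldC SA xi lA (@dual_shift_is_linear K g m) sk.
apply: (etrans eC).
have -> : lfield (coad gm X) (taylor_coef k) = fun=> 0.
  by apply/funext => y; apply: IH.
have e1 : lfield shift (fun=> 0) xi = 0 by exact: dird_cst.
rewrite e1 add0r.
have := dirdB SA xi (shift (coad gm X xi) - coad gm X (shift xi))
  (coad gm (takiff_deriv X) xi) sk.
rewrite (IH (takiff_deriv X) xi km') subr0 => <-.
have v0 i := @dual_shift_coad K g m i X xi.
rewrite (dird_taylor_coef _ km').
  rewrite v0; last by rewrite inordK; lia.
  by have -> := dird0 SA (coef ord_max xi) smooth_phi; rewrite mulr0.
by move=> i ki; apply: v0; lia.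
Qed.

End TakiffInvariants.

(** * Transfer of the Dixmier property, one order at a time *)

Section TakiffDixmier.
Variables (R : realType) (K : numFieldType) (c : smooth_class R K).
Local Notation S := (fun n => @smooth_rV R K c n).
Hypothesis SA : smooth_axioms S.
Variables (g : lieAlgType K) (m : nat).
Local Notation gm := (takiff g m).
Local Notation E := (dual_space g).
Local Notation Em := (dual_space gm).
Local Notation coef := (@dual_coef K g m).
Local Notation mono := (@takiff_monomial K g m).
Hypothesis dixmier_g : dixmier c (coad g).

Definition annihilates_invariants (W : vectType K) (a : W * Em -> Em) :=
  forall phi : Em -> K, vsmooth S phi ->
    (forall X xi, dird phi xi (coad gm X xi) = 0) ->
    forall w xi, dird phi xi (a (w, xi)) = 0.

Section Step.
Variables (W : vectType K) (a : W * Em -> Em) (j : 'I_m.+1).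
Hypothesis smooth_a : vsmooth_map S a.
Hypothesis a_annihilates : annihilates_invariants a.
Hypothesis a_above : forall p (i : 'I_m.+1), (j < i)%N -> coef i (a p) = 0.

Definition set_base (p : (W * Em) * E) : W * Em :=
  (p.1.1, @rebase K g m p.1.2 p.2).

Lemma set_base_is_linear : linear set_base.
Proof. by move=> t p q; congr (_, _); apply: rebase_is_linear. Qed.

Lemma coef_set_base p : coef ord_max (set_base p).2 = p.2.
Proof. exact: dual_coef_rebase. Qed.

Lemma set_base_id w xi : set_base ((w, xi), coef ord_max xi) = (w, xi).
Proof. by congr (_, _); apply: rebase_dual_coef. Qed.

Definition frozen_field (p : (W * Em) * E) : E := coef j (a (set_base p)).

Lemma smooth_frozen_field : vsmooth_map S frozen_field.
Proof.
apply: (vsmooth_map_linear SA (@dual_coef_is_linear K g m j)).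
exact: (vsmooth_map_comp SA set_base_is_linear).
Qed.

(** The field is tested on the invariant of order k = m - j at a point with eta_0 = e. Its lower
    order coefficients vanish, so the result is k! times the derivative of [phi] along the
    coefficient of order k, and k! is invertible in characteristic 0. *)
Lemma frozen_field_annihilates phi : vsmooth S phi ->
    (forall y e, dird phi e (coad g y e) = 0) ->
  forall w e, dird phi e (frozen_field (w, e)) = 0.
Proof.
move=> sphi iphi w e; have jm := ltn_ord j.
have kjm : (m - j <= m)%N by rewrite leq_subr.
have := a_annihilates (vsmooth_taylor_coef SA m sphi (m - j)).
move=> /(_ (fun X xi => taylor_coef_invariant SA sphi iphi X xi kjm)).
move=> /(_ (set_base (w, e)).1 (set_base (w, e)).2).
rewrite -surjective_pairing (dird_taylor_coef SA sphi) //; last first.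
  by move=> i ji; apply: a_above; lia.
rewrite coef_set_base => /eqP; rewrite mulf_eq0 pnatr_eq0 -leqn0 leqNgt fact_gt0 /=.
have -> : inord (m - (m - j)) = j by apply: val_inj; rewrite /= inordK; lia.
by move=> /eqP.
Qed.

Lemma dixmier_step : exists2 b : W * Em -> gm, vsmooth_map S b &
  forall p (i : 'I_m.+1), (j <= i)%N -> coef i (a p - coad gm (b p) p.2) = 0.
Proof.
have [b sb eb] := dixmier_g smooth_frozen_field frozen_field_annihilates.
(* The function [b] has the base point as an extra variable; it is evaluated at the actual eta_0,
   where [rebase] changes nothing. *)
exists (fun p => mono (inord (m - j)) (b (p, coef ord_max p.2))).
  apply: (vsmooth_map_linear SA (@takiff_monomial_is_linear K g m _)).
  apply: (vsmooth_map_comp SA _ sb) => t p q /=.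
  by congr (_, _); apply: dual_coef_is_linear.
case=> w xi i ji; apply: dual_coef_sub_coad_monomial => //; last exact: a_above.
have := eb (w, xi) (coef ord_max xi).
by rewrite /frozen_field set_base_id.
Qed.

End Step.

(** Here [n] bounds the indices of the coefficients that may be nonzero: n = 0 means a = 0, and n =
    m + 1 is no condition. The corrected field still annihilates the invariants, because coadjoint
    directions do. *)
Lemma dixmier_takiff_below (W : vectType K) (n : nat) (a : W * Em -> Em) :
    vsmooth_map S a -> annihilates_invariants a ->
    (forall p (i : 'I_m.+1), (n <= i)%N -> coef i (a p) = 0) ->
  exists2 b : W * Em -> gm, vsmooth_map S b & forall p, a p = coad gm (b p) p.2.
Proof.
elim: n a => [|n IH] a sa anna a0.
  exists (fun=> 0); first exact: vsmooth_map0.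
  move=> p; have -> : a p = 0.
    by apply: dual_coefP => i; rewrite a0 // linear0.
  by rewrite linear0 zero_lfunE.
have [nm|mn] := ltnP n m.+1; last first.
  by apply: IH => // p i ni; have := ltn_ord i; lia.
pose j : 'I_m.+1 := Ordinal nm.
have [b sb eb] := @dixmier_step W a j sa anna a0.
have [|phi sphi iphi w xi|p i ni|b' sb' eb'] :=
    IH (fun p => a p - coad gm (b p) p.2); last first.
- exists (fun p => b' p + b p); first exact: vsmooth_mapD.
  by move=> p; rewrite linearD add_lfunE -eb' subrK.
- exact: eb.
- by rewrite (dirdB SA _ _ _ sphi) anna // iphi subrr.
- apply: (vsmooth_mapD SA sa); apply: (vsmooth_mapN SA).
  apply: (@vsmooth_map_bilinear _ _ SA _ _ _ _ (fun X xi => coad gm X xi : Em) b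
    snd _ _ _ sb) => [xi t u v|X t u v|t u v] //.
  + by rewrite linearP add_lfunE scale_lfunE.
  + by rewrite linearP.
Qed.

Lemma dixmier_takiff : dixmier c (coad gm).
Proof.
move=> W a sa anna; have [//||b sb eb] := @dixmier_takiff_below W m.+1 a sa.
- by move=> p i; have := ltn_ord i; lia.
- by exists b => // w xi; apply: eb.
Qed.

End TakiffDixmier.

(** * Polynomial functions *)

Section RowVectorCalculus.
Variable K : numFieldType.

Lemma differentiable_mul_coord n (i : 'I_n) (f : 'rV[K]_n -> K) x :
  differentiable f x -> differentiable (fun y : 'rV[K]_n => y 0 i * f y) x.
Proof.
by move=> df; apply: differentiableM => //; exact: differentiable_coord.
Qed.

Lemma derive_mul_coord n (i : 'I_n) (f : 'rV[K]_n -> K) v x :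
  differentiable f x ->
  'D_v (fun y : 'rV[K]_n => y 0 i * f y) x = v 0 i * f x + x 0 i * 'D_v f x.
Proof.
move=> df.
have dc : is_derive x v (fun y : 'rV[K]_n => y 0 i) (v 0 i).
  by apply: is_derive_scalar_linear => a s t; rewrite !mxE.
have dfv : is_derive x v f ('D_v f x) by apply: derivableP; exact: diff_derivable.
by rewrite derive_val addrC; congr (_ + _); rewrite /= [LHS]mulrC.
Qed.

Lemma differentiable_mulmx n p (M : 'M[K]_(n, p)) (x : 'rV[K]_n) :
  differentiable (fun y => y *m M) x.
Proof.
have -> : (fun y : 'rV[K]_n => y *m M) = \sum_i (fun y : 'rV[K]_n => y 0 i *: row i M).
  by apply/funext => y; rewrite fct_sumE mulmx_sum_row.
apply: differentiable_sum => i; apply: differentiableZl.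
exact: differentiable_coord.
Qed.

Lemma differentiable_comp_mulmx n p (M : 'M[K]_(n, p)) (f : 'rV[K]_p -> K) x :
  differentiable f (x *m M) -> differentiable (fun y => f (y *m M)) x.
Proof.
by move=> df; apply: differentiable_comp => //; apply: differentiable_mulmx.
Qed.

Lemma derive_comp_mulmx n p (M : 'M[K]_(n, p)) (f : 'rV[K]_p -> K) v x :
  'D_v (fun y => f (y *m M)) x = 'D_(v *m M) f (x *m M).
Proof.
rewrite /derive; apply: (congr1 (fun F : K -> K => lim (F @ 0^'))).
by apply/funext => h /=; rewrite mulmxDl scalemxAl.
Qed.

Lemma deriveD_rV n (f g : 'rV[K]_n -> K) v x :
  differentiable f x -> differentiable g x ->
  'D_v (fun y => f y + g y) x = 'D_v f x + 'D_v g x.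
Proof. by move=> df dg; rewrite -deriveD //; exact: diff_derivable. Qed.

Lemma derive_mul_coordE n (i : 'I_n) (f : 'rV[K]_n -> K) v :
  (forall y, differentiable f y) ->
  'D_v (fun y : 'rV[K]_n => y 0 i * f y) =
  fun y => v 0 i * f y + y 0 i * 'D_v f y.
Proof. by move=> df; apply/funext => y; rewrite derive_mul_coord. Qed.

Lemma deriveDE n (f g : 'rV[K]_n -> K) v :
  (forall y, differentiable f y) -> (forall y, differentiable g y) ->
  'D_v (fun y => f y + g y) = fun y => 'D_v f y + 'D_v g y.
Proof. by move=> df dg; apply/funext => y; rewrite deriveD_rV. Qed.

Lemma derive_cstE n (a : K) (v : 'rV[K]_n) : 'D_v (fun=> a) = fun=> 0.
Proof. by apply/funext => y; rewrite [LHS]derive_cst. Qed.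

Lemma deriveZ_rV n (f : 'rV[K]_n -> K) a v x :
  differentiable f x -> 'D_v (fun y => a * f y) x = a * 'D_v f x.
Proof. by move=> df; rewrite -[RHS]deriveZ //; exact: diff_derivable. Qed.

Lemma deriveZE n (f : 'rV[K]_n -> K) a v :
  (forall y, differentiable f y) ->
  'D_v (fun y => a * f y) = fun y => a * 'D_v f y.
Proof. by move=> df; apply/funext => y; rewrite deriveZ_rV. Qed.

Lemma derive2_mul_coord n (i : 'I_n) (f : 'rV[K]_n -> K) u v x :
  (forall y, differentiable f y) -> differentiable ('D_v f) x ->
  'D_u ('D_v (fun y : 'rV[K]_n => y 0 i * f y)) x =
  v 0 i * 'D_u f x + (u 0 i * 'D_v f x + x 0 i * 'D_u ('D_v f) x).
Proof.
move=> df d2f; rewrite (derive_mul_coordE _ _ df) deriveD_rV; last first.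
- exact: differentiable_mul_coord.
- by apply: (differentiableZ (v 0 i)); exact: df.
rewrite (deriveZ_rV _ _ (df x)); congr (_ + _); exact: derive_mul_coord.
Qed.

End RowVectorCalculus.

Section PolynomialFunctions.
Variable K : numFieldType.

Lemma polynomial_function_cst n (a : K) : polynomial_function (fun _ : 'rV[K]_n => a).
Proof. by exists (mpoly.mpolyC n a) => x; rewrite mpoly.mevalC. Qed.

Lemma polynomial_functionD n (f g : 'rV[K]_n -> K) :
  polynomial_function f -> polynomial_function g ->
  polynomial_function (fun x => f x + g x).
Proof.
by move=> [p pE] [q qE]; exists (p + q) => x; rewrite mpoly.mevalD pE qE.
Qed.

Lemma polynomial_functionZ n a (f : 'rV[K]_n -> K) :
  polynomial_function f -> polynomial_function (fun x => a * f x).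
Proof. by move=> [p pE]; exists (a *: p) => x; rewrite mpoly.mevalZ pE. Qed.

Lemma polynomial_function_mul_coord n i (f : 'rV[K]_n -> K) :
  polynomial_function f -> polynomial_function (fun x => x 0 i * f x).
Proof.
move=> [p pE]; exists (mpoly.mpolyX K (mpoly.mnm1 i) * p) => x.
by rewrite mpoly.mevalM mpoly.mevalXU pE.
Qed.

(** Constants, sums and multiplication by a coordinate generate all polynomials, so stability under
    substitution and derivation is checked on these three constructions only. *)
Lemma polynomial_function_ind n (P : ('rV[K]_n -> K) -> Prop) :
    (forall a, P (fun=> a)) ->
    (forall f g, P f -> P g -> P (fun x => f x + g x)) ->
    (forall i f, P f -> P (fun x => x 0 i * f x)) ->
  forall f, polynomial_function f -> P f.
Proof.
move=> P0 PD PM f [p pE]; have -> : f = fun x => mpoly.meval (x 0) p by apply/funext.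
elim/mpoly.mpolyind: p {pE} => [|c m p _ _ IH].
  by have := P0 0; congr P; apply/funext => x; rewrite mpoly.meval0.
have PX k i h : P h -> P (fun x => x 0 i ^+ k * h x).
  move=> Ph; elim: k => [|k IHk].
    by move: Ph; congr P; apply/funext => x; rewrite expr0 mul1r.
  by have := PM i _ IHk; congr P; apply/funext => x; rewrite mulrA -exprS.
have Pm (r : seq 'I_n) : P (fun x => \prod_(i <- r) x 0 i ^+ m i * c).
  elim: r => [|i r IHr].
    by have := P0 c; congr P; apply/funext => x; rewrite big_nil mul1r.
  by have := PX (m i) i _ IHr; congr P; apply/funext => x; rewrite big_cons mulrA.
have := PD _ _ (Pm (index_enum 'I_n)) IH; congr P; apply/funext => x.
by rewrite mpoly.mevalD mpoly.mevalZ mpoly.mevalX mulrC.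
Qed.

Lemma polynomial_function_mulmx n p (M : 'M[K]_(n, p)) (f : 'rV[K]_p -> K) :
  polynomial_function f -> polynomial_function (fun x => f (x *m M)).
Proof.
elim/polynomial_function_ind => [a|{}f g|i {}f IH].
- exact: polynomial_function_cst.
- exact: polynomial_functionD.
have sumP (r : seq 'I_n) : polynomial_function
    (fun x : 'rV_n => \sum_(j <- r) M j i * (x 0 j * f (x *m M))).
  elim: r => [|j r IHr].
    have := @polynomial_function_cst n 0; congr polynomial_function.
    by apply/funext => x; rewrite big_nil.
  have := polynomial_functionD (polynomial_functionZ (M j i)
    (polynomial_function_mul_coord j IH)) IHr; congr polynomial_function.
  by apply/funext => x; rewrite big_cons.
have := sumP (index_enum 'I_n); congr polynomial_function.
apply/funext => x; rewrite mxE mulr_suml; apply: eq_bigr => j _; ring.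
Qed.

Lemma polynomial_function_differentiable n (f : 'rV[K]_n -> K) :
  polynomial_function f -> forall x, differentiable f x.
Proof.
elim/polynomial_function_ind => [a x|{}f g df dg x|i {}f df x].
- exact: differentiable_cst.
- exact: differentiableD.
- exact: differentiable_mul_coord.
Qed.

Lemma polynomial_function_derive n (f : 'rV[K]_n -> K) v :
  polynomial_function f -> polynomial_function ('D_v f).
Proof.
(* The product rule at a coordinate involves [f] itself, so its polynomiality is carried through the
   induction. *)
move=> pf; suff [] : polynomial_function f /\ polynomial_function ('D_v f) by [].
elim/polynomial_function_ind: pf => [a|{}f g [pf pdf] [pg pdg]|i {}f [pf pdf]].
- split; first exact: polynomial_function_cst.
  have := @polynomial_function_cst n 0; congr polynomial_function.
  by apply/funext => x; rewrite [RHS]derive_cst.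
- split; first exact: polynomial_functionD.
  have := polynomial_functionD pdf pdg; congr polynomial_function.
  by apply/funext => x; rewrite deriveD_rV //; apply: polynomial_function_differentiable.
- split; first exact: polynomial_function_mul_coord.
  have := polynomial_functionD (polynomial_functionZ (v 0 i) pf)
    (polynomial_function_mul_coord i pdf); congr polynomial_function.
  by apply/funext => x; rewrite derive_mul_coord //;
    apply: polynomial_function_differentiable.
Qed.

Lemma polynomial_function_deriveC n (f : 'rV[K]_n -> K) u v x :
  polynomial_function f -> 'D_u ('D_v f) x = 'D_v ('D_u f) x.
Proof.
move=> pf; suff [_] : polynomial_function f /\
  forall x u v, 'D_u ('D_v f) x = 'D_v ('D_u f) x by apply.
elim/polynomial_function_ind: pf {u v x} => [a|f1 g [pf cf] [pg cg]|i f1 [pf cf]].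
- split=> [|x u v]; first exact: polynomial_function_cst.
  by rewrite !derive_cstE.
- split=> [|x u v]; first exact: polynomial_functionD.
  have df := polynomial_function_differentiable pf.
  have dg := polynomial_function_differentiable pg.
  have ddf w := polynomial_function_differentiable (polynomial_function_derive w pf).
  have ddg w := polynomial_function_differentiable (polynomial_function_derive w pg).
  rewrite (deriveDE v df dg) (deriveDE u df dg).
  rewrite (deriveD_rV u (ddf v x) (ddg v x)) (deriveD_rV v (ddf u x) (ddg u x)).
  by rewrite cf cg.
- split=> [|x u v]; first exact: polynomial_function_mul_coord.
  have df := polynomial_function_differentiable pf.
  have ddf w := polynomial_function_differentiable (polynomial_function_derive w pf).
  rewrite (derive2_mul_coord i u df (ddf v x)) (derive2_mul_coord i v df (ddf u x)).
  rewrite (cf x u v); ring.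
Qed.

Lemma polynomial_smooth_axioms : smooth_axioms (@polynomial_function K).
Proof.
split=> [n a|n f g|n a f|n i f|n p M f|n f pf x|n f v|n f u v x].
- exact: polynomial_function_cst.
- exact: polynomial_functionD.
- exact: polynomial_functionZ.
- exact: polynomial_function_mul_coord.
- exact: polynomial_function_mulmx.
- exact: polynomial_function_differentiable.
- exact: polynomial_function_derive.
- exact: polynomial_function_deriveC.
Qed.

End PolynomialFunctions.

(** * Infinitely differentiable functions *)

Section Translation.
Variables (K : numFieldType) (n : nat).
Implicit Types (f : 'rV[K]_n -> K) (a u v x : 'rV[K]_n).

Lemma derive_translate f a v x :
  'D_v (fun y => f (y + a)) x = 'D_v f (x + a).
Proof.
rewrite /derive; apply: (congr1 (fun F : K -> K => lim (F @ 0^'))).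
by apply/funext => h /=; rewrite addrA.
Qed.

Lemma differentiable_translate f a x :
  differentiable f (x + a) -> differentiable (fun y => f (y + a)) x.
Proof.
by move=> df; apply: differentiable_comp.
Qed.

Lemma derive_line f v x (t : K) :
  derive1 (fun s : K => f (x + s *: v)) t = 'D_v f (x + t *: v).
Proof.
rewrite derive1E /derive; apply: (congr1 (fun F : K -> K => lim (F @ 0^'))).
apply/funext => h; rewrite /= (_ : h%:A = h); last exact: mulr1.
by rewrite scalerDl addrCA.
Qed.

Lemma differentiable_line f v x (t : K) : differentiable f (x + t *: v) ->
  derivable (fun s : K => f (x + s *: v)) t 1.
Proof.
by move=> df; apply/diff_derivable/differentiable_comp.
Qed.

End Translation.

Lemma dist_le_split (R : numFieldType) (a b z e : R) :
  `|a - z| < e / 2 -> `|b - z| < e / 2 -> `|a - b| <= e.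
Proof.
move=> az bz; rewrite (le_trans (ler_distD z _ _)) // (distrC z) ltW //.
by rewrite (lt_le_trans (ltrD az bz)) // -splitr.
Qed.

Section CinftyFunctions.
Variable R : realType.
Implicit Types n : nat.

Lemma MVT_line n (f : 'rV[R]_n -> R) (x v : 'rV[R]_n) (h : R) : 0 < h ->
  (forall s, 0 <= s <= h -> differentiable f (x + s *: v)) ->
  exists2 s, 0 < s < h & f (x + h *: v) - f x = h * 'D_v f (x + s *: v).
Proof.
move=> h0 df; pose g s := f (x + s *: v).
have dg s : 0 <= s <= h -> derivable g s 1.
  by move=> sh; apply: differentiable_line; apply: df.
have gE s : derive1 g s = 'D_v f (x + s *: v) by exact: derive_line.
have dg1 s : s \in `]0, h[ -> is_derive s 1 g (derive1 g s).
  rewrite in_itv /= => /andP[s0 sh]; rewrite derive1E.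
  by apply: derivableP; apply: dg; rewrite !ltW.
have cg : {within `[0, h], continuous g}.
  by apply: derivable_within_continuous => s; rewrite in_itv /=; exact: dg.
have [s sh] := MVT h0 dg1 cg.
rewrite gE subr0 /g scale0r addr0 => e; exists s; last by rewrite e mulrC.
by move: sh; rewrite in_itv.
Qed.

(** Schwarz's theorem: the second difference of f over the parallelogram with sides h u and h v is,
    by two mean value theorems in either order, h^2 times each mixed derivative at some point near
    x. Both mixed derivatives are continuous at x. *)
Lemma derive_symmetric n (f : 'rV[R]_n -> R) (u v x : 'rV[R]_n) :
  (forall y, differentiable f y) ->
  (forall y, differentiable ('D_u f) y) -> (forall y, differentiable ('D_v f) y) ->
  {for x, continuous ('D_u ('D_v f))} -> {for x, continuous ('D_v ('D_u f))} ->
  'D_u ('D_v f) x = 'D_v ('D_u f) x.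
Proof.
have second_difference w w' h : 0 < h -> (forall y, differentiable f y) ->
    (forall y, differentiable ('D_w f) y) -> exists c d : R, [/\ 0 < c < h, 0 < d < h &
    f (x + h *: w + h *: w') - f (x + h *: w) - (f (x + h *: w') - f x) =
    h * (h * 'D_w' ('D_w f) (x + c *: w + d *: w'))].
  move=> h0 df dwf; pose G y := f (y + h *: w') - f y.
  have dG y : differentiable G y.
    by apply: differentiableB => //; apply: differentiable_translate.
  have [c ch e1] := MVT_line (x := x) (v := w) h0 (fun s _ => dG (x + s *: w)).
  have [d dh e2] := MVT_line (x := x + c *: w) (v := w') h0 (fun s _ => dwf _).
  exists c, d; split=> //; rewrite -[LHS]/(G (x + h *: w) - G x) e1 -e2.
  congr (_ * _).
  have -> : 'D_w G (x + c *: w) =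
      'D_w (fun y => f (y + h *: w')) (x + c *: w) - 'D_w f (x + c *: w).
    by apply: deriveB; apply: diff_derivable => //; apply: differentiable_translate.
  by rewrite derive_translate.
move=> df duf dvf cuv cvu; apply/eqP; rewrite -subr_eq0 -normr_le0.
apply/ler_addgt0Pl => e e0; rewrite addr0.
have e20 : 0 < e / 2 by rewrite divr_gt0.
have ball_of (F : 'rV[R]_n -> R) : {for x, continuous F} ->
    exists2 d, 0 < d & forall y, `|x - y| < d -> `|F x - F y| < e / 2.
  move=> cF; have [d /= d0 b] := (nbhs_ballP _ _).1 ((cvgrPdist_lt _ _).1 cF _ e20).
  by exists d => // y xy; apply: b; rewrite -ball_normE.
have [d1 d10 b1] := ball_of _ cuv; have [d2 d20 b2] := ball_of _ cvu.
pose N := `|u| + `|v|.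
have N1 : 0 < N + 1 by rewrite ltr_wpDl // addr_ge0.
(* The intermediate points are within h N of x, hence within min d1 d2; the 1 keeps the denominator
   positive when u = v = 0. *)
pose h := Num.min d1 d2 / (N + 1).
have h0 : 0 < h by rewrite divr_gt0 // lt_min d10.
have near_x (a b : R) w w' : `|w| + `|w'| = N -> 0 < a < h -> 0 < b < h ->
    `|x - (x + a *: w + b *: w')| < Num.min d1 d2.
  move=> wN /andP[a0 ah] /andP[b0 bh]; rewrite -addrA opprD addNKr normrN.
  have : `|a *: w + b *: w'| <= h * N.
    rewrite (le_trans (ler_normD _ _)) // !normrZ !gtr0_norm // -wN mulrDr.
    by rewrite lerD // ler_wpM2r // ltW.
  move=> /le_lt_trans; apply; rewrite -[ltRHS](@divfK _ (N + 1)) ?gt_eqF //.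
  by rewrite -/h ltr_pM2l // ltrDl.
have [c [d [ch dh e1]]] := second_difference u v h h0 df duf.
have [c' [d' [ch' dh' e2]]] := second_difference v u h h0 df dvf.
have /= := near_x c d u v erefl ch dh; rewrite lt_min => /andP[_ /b2].
have /= := near_x c' d' v u (addrC _ _) ch' dh'; rewrite lt_min => /andP[/b1 + _].
have -> : 'D_u ('D_v f) (x + c' *: v + d' *: u) = 'D_v ('D_u f) (x + c *: u + d *: v).
  have h1 : h != 0 by rewrite gt_eqF.
  apply: (mulfI h1); apply: (mulfI h1).
  have swap (p q r s : R) : p - q - (r - s) = p - r - (q - s) by ring.
  have xuv : x + h *: v + h *: u = x + h *: u + h *: v by exact: addrAC.
  apply: (etrans (esym e2)); apply: (etrans _ e1); rewrite xuv; exact: swap.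
set z := 'D_v ('D_u f) _; move=> l1 l2.
exact: (dist_le_split l1 l2).
Qed.

(** The C^infty functions form the largest class of differentiable functions stable under
    derivation. A closure property is thus proved by exhibiting such a class. *)
Lemma Cinfty_function_coind n (P : ('rV[R]_n -> R) -> Prop) :
    (forall f, P f -> forall x, differentiable f x) ->
    (forall f v, P f -> P ('D_v f)) ->
  forall f, P f -> Cinfty_function f.
Proof.
move=> Pd PD f Pf k; elim: k f Pf => [|k IH] f Pf /=.
  by move=> x; apply: differentiable_continuous; apply: Pd.
by split=> [|v]; [exact: Pd|apply: IH; exact: PD].
Qed.

Lemma Cinfty_function_differentiable n (f : 'rV[R]_n -> R) :
  Cinfty_function f -> forall x, differentiable f x.
Proof. by move=> /(_ 1%N)[]. Qed.

Lemma Cinfty_function_derive n (f : 'rV[R]_n -> R) v :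
  Cinfty_function f -> Cinfty_function ('D_v f).
Proof. by move=> sf k; have [_] := sf k.+1; apply. Qed.

Lemma Cinfty_function_cst n (a : R) : Cinfty_function (fun _ : 'rV[R]_n => a).
Proof.
apply: (@Cinfty_function_coind n (fun f => exists a, f = fun=> a)); last by exists a.
  by move=> f [b ->] x; exact: differentiable_cst.
by move=> f v [b ->]; exists 0; exact: derive_cstE.
Qed.

Lemma Cinfty_functionD n (f g : 'rV[R]_n -> R) :
  Cinfty_function f -> Cinfty_function g -> Cinfty_function (fun x => f x + g x).
Proof.
move=> sf sg; pose P h := exists f1 g1 : 'rV[R]_n -> R,
  [/\ Cinfty_function f1, Cinfty_function g1 & h = fun x => f1 x + g1 x].
apply: (@Cinfty_function_coind n P); last by exists f, g.
  move=> _ [f1 [g1 [sf1 sg1 ->]]] x.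
  by apply: differentiableD; exact: Cinfty_function_differentiable.
move=> _ v [f1 [g1 [sf1 sg1 ->]]]; exists ('D_v f1), ('D_v g1).
split; try exact: Cinfty_function_derive.
by apply: deriveDE; exact: Cinfty_function_differentiable.
Qed.

Lemma Cinfty_functionZ n a (f : 'rV[R]_n -> R) :
  Cinfty_function f -> Cinfty_function (fun x => a * f x).
Proof.
move=> sf; pose P h := exists2 f1 : 'rV[R]_n -> R,
  Cinfty_function f1 & h = fun x => a * f1 x.
apply: (@Cinfty_function_coind n P); last by exists f.
  move=> _ [f1 sf1 ->] x; apply: (differentiableZ a).
  exact: Cinfty_function_differentiable.
move=> _ v [f1 sf1 ->]; exists ('D_v f1); first exact: Cinfty_function_derive.
by apply: deriveZE; exact: Cinfty_function_differentiable.
Qed.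

Lemma Cinfty_function_mul_coord n i (f : 'rV[R]_n -> R) :
  Cinfty_function f -> Cinfty_function (fun x => x 0 i * f x).
Proof.
(* The products x_i g alone are not stable under derivation, as ['D_v] of such a product is v_i g +
   x_i D_v g; the summand [f1] absorbs the first term. *)
move=> sf; pose P h := exists f1 g1 : 'rV[R]_n -> R,
  [/\ Cinfty_function f1, Cinfty_function g1 & h = fun x => f1 x + x 0 i * g1 x].
have dif (h : 'rV[R]_n -> R) := @Cinfty_function_differentiable n h.
have difM (h : 'rV[R]_n -> R) :
    Cinfty_function h -> forall x, differentiable (fun y : 'rV[R]_n => y 0 i * h y) x.
  by move=> sh x; apply: differentiable_mul_coord; apply: dif.
apply: (@Cinfty_function_coind n P).
- by move=> _ [f1 [g1 [sf1 sg1 ->]]] x; apply: differentiableD; [exact: dif|exact: difM].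
- move=> _ v [f1 [g1 [sf1 sg1 ->]]].
  exists (fun x => 'D_v f1 x + v 0 i * g1 x), ('D_v g1); split.
  + by apply: Cinfty_functionD; [exact: Cinfty_function_derive|exact: Cinfty_functionZ].
  + exact: Cinfty_function_derive.
  + apply/funext => x; rewrite (deriveD_rV _ (dif _ sf1 x) (difM _ sg1 x)).
    by rewrite (derive_mul_coord _ _ (dif _ sg1 x)) addrA.
- exists (fun=> 0), f; split=> //; first exact: Cinfty_function_cst.
  by apply/funext => x; rewrite add0r.
Qed.

Lemma Cinfty_function_mulmx n p (M : 'M[R]_(n, p)) (f : 'rV[R]_p -> R) :
  Cinfty_function f -> Cinfty_function (fun x => f (x *m M)).
Proof.
move=> sf; pose P h := exists2 f1 : 'rV[R]_p -> R,
  Cinfty_function f1 & h = fun x => f1 (x *m M).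
apply: (@Cinfty_function_coind n P); last by exists f.
  move=> _ [f1 sf1 ->] x; apply: differentiable_comp_mulmx.
  exact: Cinfty_function_differentiable.
move=> _ v [f1 sf1 ->]; exists ('D_(v *m M) f1); first exact: Cinfty_function_derive.
by apply/funext => x; exact: derive_comp_mulmx.
Qed.

Lemma Cinfty_function_deriveC n (f : 'rV[R]_n -> R) u v x :
  Cinfty_function f -> 'D_u ('D_v f) x = 'D_v ('D_u f) x.
Proof.
move=> sf; apply: derive_symmetric; first exact: Cinfty_function_differentiable.
- by apply: Cinfty_function_differentiable; apply: Cinfty_function_derive.
- by apply: Cinfty_function_differentiable; apply: Cinfty_function_derive.
- exact: (Cinfty_function_derive u (Cinfty_function_derive v sf) 0%N).
- exact: (Cinfty_function_derive v (Cinfty_function_derive u sf) 0%N).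
Qed.

Lemma Cinfty_smooth_axioms : smooth_axioms (@Cinfty_function R).
Proof.
split=> [n a|n f g|n a f|n i f|n p M f|n f pf x|n f v|n f u v x].
- exact: Cinfty_function_cst.
- exact: Cinfty_functionD.
- exact: Cinfty_functionZ.
- exact: Cinfty_function_mul_coord.
- exact: Cinfty_function_mulmx.
- exact: Cinfty_function_differentiable.
- exact: Cinfty_function_derive.
- exact: Cinfty_function_deriveC.
Qed.

End CinftyFunctions.

(** * Limits of differentiable functions *)

Section SequenceLimits.
Variable K : numFieldType.
Implicit Types (u v : nat -> K) (l a : K).

(** Stated over any [numFieldType], so that the real analytic and the holomorphic cases share one
    limit argument. *)
Definition tends u l :=
  forall e, 0 < e -> exists N0, forall N, (N0 <= N)%N -> `|u N - l| <= e.

Definition cauchy_seq u := forall e, 0 < e ->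
  exists N0, forall N P, (N0 <= N)%N -> (N0 <= P)%N -> `|u N - u P| <= e.

Definition seq_complete := forall u, cauchy_seq u -> exists l, tends u l.

(** The order of K is only partial in the complex case, but positive elements are real, hence
    comparable. *)
Lemma exists_pos_le2 (a b : K) : 0 < a -> 0 < b ->
  exists t, [/\ 0 < t, t <= a & t <= b].
Proof.
move=> a0 b0; have [ab|ba] := real_leP (gtr0_real a0) (gtr0_real b0).
  by exists a; split.
by exists b; split=> //; exact: ltW.
Qed.

Lemma tends_ext u v l : u =1 v -> tends u l -> tends v l.
Proof. by move=> /funext->. Qed.

Lemma tends_cst a : tends (fun=> a) a.
Proof. by move=> e e0; exists 0%N => N _; rewrite subrr normr0 ltW. Qed.

Lemma tendsD u v l l' : tends u l -> tends v l' -> tends (fun N => u N + v N) (l + l').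
Proof.
move=> ul vl e e0; have e20 : 0 < e / 2 by rewrite divr_gt0.
have [N1 h1] := ul _ e20; have [N2 h2] := vl _ e20; exists (maxn N1 N2) => N.
rewrite geq_max => /andP[n1 n2]; rewrite opprD addrACA (le_trans (ler_normD _ _)) //.
by rewrite [leRHS](splitr e) lerD ?h1 ?h2.
Qed.

Lemma tendsM a u l : tends u l -> tends (fun N => a * u N) (a * l).
Proof.
move=> ul e e0; have a1 : 0 < `|a| + 1 by rewrite ltr_wpDl.
have [N1 h1] := ul (e / (`|a| + 1)) (divr_gt0 e0 a1); exists N1 => N /h1 h.
rewrite -mulrBr normrM (le_trans (ler_wpM2l (normr_ge0 a) h)) //.
by rewrite mulrCA ler_piMr ?(ltW e0) // ler_pdivrMr // mul1r ler_wpDr.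
Qed.

Lemma tendsN u l : tends u l -> tends (fun N => - u N) (- l).
Proof.
by move=> /(tendsM (-1)); rewrite mulN1r; apply: tends_ext => N; rewrite mulN1r.
Qed.

Lemma tendsB u v l l' : tends u l -> tends v l' -> tends (fun N => u N - v N) (l - l').
Proof. by move=> ul /tendsN; apply: tendsD. Qed.

Lemma tends_sum I (r : seq I) (u : I -> nat -> K) (l : I -> K) :
  (forall i, tends (u i) (l i)) ->
  tends (fun N => \sum_(i <- r) u i N) (\sum_(i <- r) l i).
Proof.
move=> ul; elim: r => [|i r IH].
  by rewrite big_nil; apply: tends_ext (tends_cst 0) => N; rewrite big_nil.
by rewrite big_cons; apply: tends_ext (tendsD (ul i) IH) => N; rewrite big_cons.
Qed.

Lemma tends_norm_le u l B :
  (exists N0, forall N, (N0 <= N)%N -> `|u N| <= B) -> tends u l -> `|l| <= B.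
Proof.
move=> [N0 uB] ul; apply/ler_addgt0Pl => e e0; have [N1 h1] := ul _ e0.
have := h1 (maxn N0 N1) (leq_maxr _ _); have := uB (maxn N0 N1) (leq_maxl _ _).
move=> hB he; rewrite -[l](subrK (u (maxn N0 N1))).
by rewrite (le_trans (ler_normD _ _)) // distrC lerD.
Qed.

Lemma tends_unique u l l' : tends u l -> tends u l' -> l = l'.
Proof.
move=> ul ul'; apply/eqP; rewrite -subr_eq0 -normr_le0.
apply: tends_norm_le (tendsB ul ul'); exists 0%N => N _.
by rewrite subrr normr0.
Qed.

Lemma tends_cauchy u l : tends u l -> cauchy_seq u.
Proof.
move=> ul e e0; have e20 : 0 < e / 2 by rewrite divr_gt0.
have [N0 h] := ul _ e20; exists N0 => N P NN PN.
rewrite (le_trans (ler_distD l _ _)) // [leRHS](splitr e) lerD ?h //.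
by rewrite distrC h.
Qed.

End SequenceLimits.

Section LimitDifferentiable.
Variable K : numFieldType.

Lemma linear_rV_sum n (L : 'rV[K]_n -> K) u :
  linear L -> L u = \sum_i u 0 i * L (delta_mx 0 i).
Proof.
move=> lL; pose M : {linear 'rV[K]_n -> K} :=
  HB.pack L (GRing.isLinear.Build K _ K _ L lL).
rewrite -[LHS]/(M u) [in LHS](row_sum_delta u) linear_sum.
by apply: eq_bigr => i _; rewrite linearZ.
Qed.

Lemma differentiable_quadratic n (f L : 'rV[K]_n -> K) x r M : 0 < r -> 0 <= M ->
  linear L ->
  (forall u, `|u| < r -> `|f (x + u) - f x - L u| <= M * `|u| ^+ 2) ->
  differentiable f x /\ forall u, 'D_u f x = L u.
Proof.
move=> r0 M0 lL fL.
pose Ll : {linear 'rV[K]_n -> K} := HB.pack L (GRing.isLinear.Build K _ K _ L lL).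
have cL : continuous Ll.
  have -> : Ll = (fun u : 'rV[K]_n => \sum_i u 0 i * L (delta_mx 0 i)) :> (_ -> _).
    by apply/funext => u; exact: linear_rV_sum.
  move=> u; apply: differentiable_continuous.
  have -> : (fun u : 'rV[K]_n => \sum_i u 0 i * L (delta_mx 0 i)) =
      \sum_i (fun u : 'rV[K]_n => u 0 i * L (delta_mx 0 i)).
    by apply/funext => w; rewrite fct_sumE.
  apply: differentiable_sum => i; apply: differentiableM; last first.
    exact: differentiable_cst.
  exact: differentiable_coord.
have fo : f \o shift x = cst (f x) + Ll +o_ (0 : 'rV[K]_n) id.
  apply/eqaddoP => e e0; have M1 : 0 < M + 1 by rewrite ltr_wpDl.
  have [t [t0 tr te]] := exists_pos_le2 r0 (divr_gt0 e0 M1).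
  apply/nbhs_ballP; exists t => //= u; rewrite -ball_normE /= sub0r normrN => ut.
  have ur := lt_le_trans ut tr; have uM := ltW (lt_le_trans ut te).
  rewrite !fctE /= [u + x]addrC opprD addrA (le_trans (fL u ur)) //.
  rewrite expr2 mulrA ler_wpM2r // (le_trans (ler_wpM2l M0 uM)) //.
  by rewrite mulrCA ler_piMr ?(ltW e0) // ler_pdivrMr // mul1r lerDl.
have dE : 'd f x = L :> (_ -> _) by rewrite (diff_unique cL fo).
have df : differentiable f x by apply/diff_locallyP; rewrite dE.
by split=> // u; rewrite deriveE // dE.
Qed.

(** The constant M does not depend on N. For small t, t (L N u - L P u) is a difference of
    increments of [F N] and [F P], which tends to 0 by pointwise convergence, up to 2 M t^2 |u|^2;
    dividing by t shows that L N u is Cauchy. The limit is linear, and the quadratic estimate passes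
    to it. *)
Lemma limit_differentiable (cK : seq_complete K) n (f : 'rV[K]_n -> K)
    (F L : nat -> 'rV[K]_n -> K) x r M : 0 < r -> 0 <= M ->
  (forall N, linear (L N)) ->
  (forall u, `|u| < r -> tends (fun N => F N (x + u)) (f (x + u))) ->
  (forall N u, `|u| < r -> `|F N (x + u) - F N x - L N u| <= M * `|u| ^+ 2) ->
  differentiable f x /\ forall u, tends (fun N => L N u) ('D_u f x).
Proof.
move=> r0 M0 lL Ff FL.
have LZ N t u : L N (t *: u) = t * L N u.
  have L0 : L N 0 = 0.
    by have := lL N (-1) 0 0; rewrite scaler0 addr0 scaleN1r addNr.
  by have := lL N t u 0; rewrite L0 !addr0.
have Ff0 : tends (fun N => F N x) (f x).
  by have := Ff 0; rewrite normr0 addr0; apply.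
have cauchyL u : cauchy_seq (fun N => L N u).
  move=> e e0; pose c := `|u| + 1; have c0 : 0 < c by rewrite ltr_wpDl.
  have uc : `|u| <= c by rewrite lerDl.
  have M1 : 0 < 4 * (M + 1) * c ^+ 2.
    by rewrite !mulr_gt0 ?exprn_gt0 // ltr_wpDl.
  (* The first bound keeps t u in the ball; the second makes each quadratic remainder at most e t /
     4, the increments taking the other e t / 2. *)
  have [t [t0 ta tb]] : exists t,
      [/\ 0 < t, t <= r / (2 * c) & t <= e / (4 * (M + 1) * c ^+ 2)].
    by apply: exists_pos_le2; rewrite divr_gt0 // mulr_gt0.
  have tur : `|t *: u| < r.
    rewrite normrZ gtr0_norm //; apply: (@le_lt_trans _ _ (t * c)).
      by rewrite ler_wpM2l // ltW.
    apply: (@le_lt_trans _ _ (r / 2)); last first.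
      by rewrite ltr_pdivrMr // ltr_pMr // ltr1n.
    by rewrite -ler_pdivlMr // -mulrA -invfM.
  have [N0 h0] : exists N0, forall N P, (N0 <= N)%N -> (N0 <= P)%N ->
      `|F N (x + t *: u) - F N x - (F P (x + t *: u) - F P x)| <= e * t / 2.
    by apply: (tends_cauchy (tendsB (Ff _ tur) Ff0)); rewrite divr_gt0 // mulr_gt0.
  exists N0 => N P NN PN; rewrite -(ler_pM2l t0).
  rewrite -[X in X * `|_|](gtr0_norm t0) -normrM mulrBr -!LZ.
  set w := t *: u in tur h0 *.
  have wM : M * `|w| ^+ 2 <= e * t / 4.
    have tb' : t * (4 * (M + 1) * c ^+ 2) <= e by rewrite -ler_pdivlMr.
    apply: (@le_trans _ _ ((M + 1) * (t ^+ 2 * c ^+ 2))).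
      rewrite /w normrZ gtr0_norm // exprMn ler_pM ?lerDl //.
        by rewrite mulr_ge0 ?exprn_ge0 // ltW.
      by rewrite ler_wpM2l ?exprn_ge0 ?(ltW t0) // ler_pXn2r ?nnegrE // ltW.
    have -> : (M + 1) * (t ^+ 2 * c ^+ 2) = t * (4 * (M + 1) * c ^+ 2) * t / 4 by field.
    by rewrite ler_pM2r ?invr_gt0 // ler_pM2r.
  have -> : L N w - L P w = (F N (x + w) - F N x - (F P (x + w) - F P x)) -
    (F N (x + w) - F N x - L N w) + (F P (x + w) - F P x - L P w) by ring.
  rewrite (le_trans (ler_normD _ _)) // (le_trans (lerD (ler_normB _ _) (FL P w tur))) //.
  rewrite (le_trans (lerD (lerD (h0 _ _ NN PN) (FL N w tur)) (lexx _))) //.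
  rewrite (le_trans (lerD (lerD (lexx _) wM) wM)) // le_eqVlt; apply/orP; left.
  by apply/eqP; field.
have /choice[l Ll] u : exists l, tends (fun N => L N u) l by apply: cK.
have lin_l : linear l.
  move=> a u v; apply: (tends_unique (Ll _)).
  by apply: tends_ext (tendsD (tendsM a (Ll u)) (Ll v)) => N; rewrite lL.
have [|df dl] := @differentiable_quadratic n f l x r M r0 M0 lin_l.
  move=> u ur; apply: (tends_norm_le _ (tendsB (tendsB (Ff u ur) Ff0) (Ll u))).
  by exists 0%N => N _; apply: FL.
by split=> // u; rewrite dl.
Qed.

Lemma derive_is_linear n (f : 'rV[K]_n -> K) x :
  differentiable f x -> linear (fun v : 'rV[K]_n => 'D_v f x).
Proof. by move=> df a u v; rewrite !deriveE // linearP. Qed.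

Lemma deriveZv n (f : 'rV[K]_n -> K) x a v :
  differentiable f x -> 'D_(a *: v) f x = a * 'D_v f x.
Proof. by move=> df; rewrite !deriveE // linearZ. Qed.

(** Cauchy's formula on circles x + e^{it} v stays in a region where f is bounded only for short v;
    homogeneity in [v] extends the conclusions to all directions. *)
Lemma derive_rescale n (f : 'rV[K]_n -> K) (c : K) v : c != 0 ->
  (forall y, differentiable f y) -> 'D_v f = fun y => c^-1 * 'D_(c *: v) f y.
Proof.
by move=> c0 df; apply/funext => y; rewrite (deriveZv c v (df y)) (mulKf c0).
Qed.

Lemma linear_bound n (l : 'rV[K]_n -> K) (r B : K) : linear l -> 0 < r ->
  (forall v, `|v| <= r -> `|l v| <= B) -> forall v, `|l v| <= B / r * `|v|.
Proof.
move=> ll r0 lB v.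
have l0 : l 0 = 0 by have := ll (-1) 0 0; rewrite scaler0 addr0 scaleN1r addNr.
have lZ a w : l (a *: w) = a * l w by have := ll a w 0; rewrite l0 !addr0.
have [->|v0] := eqVneq v 0; first by rewrite l0 !normr0 mulr0.
have nv : 0 < `|v| by rewrite normr_gt0.
have := lB ((r / `|v|) *: v); rewrite normrZ normrM normfV normr_id.
rewrite (gtr0_norm r0) divfK ?gt_eqF // lexx => /(_ isT).
rewrite lZ normrM normrM normfV normr_id (gtr0_norm r0) -mulrA.
move=> lr; have -> : `|l v| = r * (`|v|^-1 * `|l v|) / r * `|v|.
  by field; rewrite !gt_eqF.
by rewrite ler_pM2r // ler_pM2r ?invr_gt0.
Qed.

Lemma exists_scale n (v : 'rV[K]_n) (r : K) : 0 < r ->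
  exists c : K, 0 < c /\ `|c *: v| <= r.
Proof.
move=> r0; have v1 : 0 < `|v| + 1 by rewrite ltr_wpDl.
exists (r / (`|v| + 1)); split; first by rewrite divr_gt0.
rewrite normrZ gtr0_norm ?divr_gt0 // mulrAC ler_pdivrMr // ler_wpM2l ?lerDl //.
exact: ltW.
Qed.

Lemma locally_bounded n (f : 'rV[K]_n -> K) x0 : {for x0, continuous f} ->
  exists r B, 0 < r /\ forall y, `|y - x0| <= r -> `|f y| <= B.
Proof.
move=> cf; have [d /= d0 b] := (nbhs_ballP _ _).1 ((cvgrPdist_lt _ _).1 cf _ ltr01).
exists (d / 2), (`|f x0| + 1); split=> [|y yd]; first by rewrite divr_gt0.
have : `|f x0 - f y| < 1.
  apply: b; rewrite -ball_normE /= distrC (le_lt_trans yd) //.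
  by rewrite ltr_pdivrMr // ltr_pMr // ltr1n.
move=> /ltW fy; rewrite -[f y](subrK (f x0)) addrC.
by rewrite (le_trans (ler_normD _ _)) // lerD // distrC.
Qed.

Lemma deriveC_rescale n (f : 'rV[K]_n -> K) (c : K) u v x : c != 0 ->
    (forall y, differentiable f y) -> differentiable ('D_(c *: v) f) x ->
    differentiable ('D_u f) x ->
    'D_u ('D_(c *: v) f) x = 'D_(c *: v) ('D_u f) x ->
  'D_u ('D_v f) x = 'D_v ('D_u f) x.
Proof.
move=> c0 df dcv du e; rewrite (derive_rescale v c0 df) (deriveZ_rV _ _ dcv) e.
have eV := deriveZv c v du; rewrite eV.
move: ('D_v ('D_u f) x : K) => d; clear - c0.
by rewrite mulrA mulVf // mul1r.
Qed.

End LimitDifferentiable.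

Lemma tendsP (K : numFieldType) (u : nat -> K) l : tends u l <-> u @ \oo --> l.
Proof.
split=> [ul|/cvgrPdist_le ul e e0].
  apply/cvgrPdist_le => e e0; have [N0 h] := ul e e0.
  by exists N0 => // N /= /h; rewrite distrC.
by have [N0 _ h] := ul e e0; exists N0 => N /h /=; rewrite distrC.
Qed.

Lemma real_seq_complete (R : realType) : seq_complete R.
Proof.
move=> u cu; suff /cvg_ex[l ul] : cvgn u by exists l; apply/tendsP.
apply/cauchy_cvgP/cauchy_exP => e e0.
have e20 : 0 < e / 2 by rewrite divr_gt0.
have [N0 h] := cu _ e20; exists (u N0); exists N0 => // N /= NN.
rewrite -ball_normE /= (le_lt_trans (h _ _ _ NN)) //.
by rewrite ltr_pdivrMr // ltr_pMr // ltr1n.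
Qed.

(** * Analytic functions *)

Section WeightedNorm.
Variables (R : realType) (n : nat).
Implicit Types (p q : mpoly n R) (s : R) (m : multinom n).

Definition mnorm s p := \sum_(m <- msupp p) `|mcoeff m p| * s ^+ mdeg m.

Lemma mnorm_seq_le s p (r : seq (multinom n)) : 0 <= s -> uniq r ->
  \sum_(m <- r) `|mcoeff m p| * s ^+ mdeg m <= mnorm s p.
Proof.
move=> s0 ur; have pos m : 0 <= `|mcoeff m p| * s ^+ mdeg m by rewrite mulr_ge0 ?exprn_ge0.
rewrite (bigID (mem (msupp p))) /= [X in _ + X]big1 ?addr0; last first.
  by move=> m /memN_msupp_eq0 ->; rewrite normr0 mul0r.
rewrite -big_filter /mnorm [leRHS](bigID (mem r)) /= -[X in _ <= X + _]big_filter.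
rewrite (perm_big [seq m <- msupp p | m \in r]) /=.
  by rewrite lerDl sumr_ge0.
apply: uniq_perm; rewrite ?filter_uniq ?msupp_uniq // => m.
by rewrite !mem_filter andbC.
Qed.

Lemma mnorm_seq s p (r : seq (multinom n)) : uniq r -> {subset msupp p <= r} ->
  mnorm s p = \sum_(m <- r) `|mcoeff m p| * s ^+ mdeg m.
Proof.
move=> ur pr; rewrite [RHS](bigID (mem (msupp p))) /= [X in _ + X]big1 ?addr0.
  rewrite -[RHS]big_filter; apply: perm_big.
  apply: uniq_perm; rewrite ?filter_uniq ?msupp_uniq // => m.
  by rewrite mem_filter andb_idr // => /pr.
by move=> m /memN_msupp_eq0 ->; rewrite normr0 mul0r.
Qed.

Lemma mnorm_ge0 s p : 0 <= s -> 0 <= mnorm s p.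
Proof. by move=> s0; rewrite sumr_ge0 // => m _; rewrite mulr_ge0 ?exprn_ge0. Qed.

Lemma mnormD s p q : 0 <= s -> mnorm s (p + q) <= mnorm s p + mnorm s q.
Proof.
move=> s0; pose r := undup (msupp (p + q) ++ msupp p ++ msupp q).
have ur : uniq r by exact: undup_uniq.
rewrite !(@mnorm_seq _ _ r) // => [|m mq|m mp|m mpq];
  rewrite ?mem_undup ?mem_cat ?mq ?mp ?mpq ?orbT //.
rewrite -big_split ler_sum // => m _ /=.
by rewrite mcoeffD -mulrDl ler_wpM2r ?exprn_ge0 // ler_normD.
Qed.

Lemma mnormZ s a p : mnorm s (a *: p) = `|a| * mnorm s p.
Proof.
have [->|a0] := eqVneq a 0.
  by rewrite scale0r normr0 mul0r /mnorm msupp0 big_nil.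
rewrite (@mnorm_seq _ _ (msupp p)) ?msupp_uniq //; last first.
  by move=> m; rewrite !mcoeff_msupp mcoeffZ mulf_eq0 negb_or => /andP[].
by rewrite mulr_sumr; apply: eq_bigr => m _; rewrite mcoeffZ normrM mulrA.
Qed.

Lemma mnorm0 s : mnorm s 0 = 0.
Proof. by rewrite /mnorm msupp0 big_nil. Qed.

Lemma mnorm_sum s I (r : seq I) (F : I -> mpoly n R) : 0 <= s ->
  mnorm s (\sum_(i <- r) F i) <= \sum_(i <- r) mnorm s (F i).
Proof.
move=> s0; elim: r => [|i r IH]; first by rewrite !big_nil mnorm0.
by rewrite !big_cons (le_trans (mnormD _ _ s0)) // lerD.
Qed.

Lemma mnormX s m : mnorm s (mpolyX R m) = s ^+ mdeg m.
Proof. by rewrite /mnorm msuppX big_seq1 mcoeffX eqxx normr1 mul1r. Qed.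

Lemma mnormM_X s m q : 0 <= s -> mnorm s (mpolyX R m * q) <= s ^+ mdeg m * mnorm s q.
Proof.
move=> s0; rewrite {1}[q]mpolyE mulr_sumr (le_trans (mnorm_sum _ _ s0)) //.
rewrite mulr_sumr ler_sum // => m' _.
by rewrite -scalerAr -mpolyXD mnormZ mnormX mdegD exprD mulrCA.
Qed.

Lemma mnormM s p q : 0 <= s -> mnorm s (p * q) <= mnorm s p * mnorm s q.
Proof.
move=> s0; rewrite {1}[p]mpolyE mulr_suml (le_trans (mnorm_sum _ _ s0)) //.
rewrite mulr_suml ler_sum // => m _.
rewrite -scalerAl mnormZ -mulrA ler_wpM2l //; exact: mnormM_X.
Qed.

Lemma mnorm_le s t p : 0 <= s -> s <= t -> mnorm s p <= mnorm t p.
Proof.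
move=> s0 st; rewrite ler_sum // => m _; rewrite ler_wpM2l //.
by rewrite lerXn2r // nnegrE (le_trans s0).
Qed.

Lemma norm_coord_le (h : 'rV[R]_n) i : `|h 0 i| <= `|h|.
Proof.
by rewrite [leRHS]mx_normrE; apply: (le_bigmax _ (fun ij => `|h ij.1 ij.2|) (0, i)).
Qed.

Lemma norm_const_mx_le s : 0 <= s -> `|const_mx s : 'rV[R]_n| <= s.
Proof.
move=> s0; rewrite [leLHS]mx_normrE; apply: bigmax_le => // i _.
by rewrite mxE ger0_norm.
Qed.

Lemma meval_le_mnorm s p (h : 'rV[R]_n) : 0 <= s -> `|h| <= s ->
  `|meval (h 0) p| <= mnorm s p.
Proof.
move=> s0 hs; rewrite mevalE (le_trans (ler_norm_sum _ _ _)) // ler_sum // => m _.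
rewrite normrM ler_wpM2l // normr_prod mdegE -prodrXr ler_prod // => i _.
by rewrite normr_ge0 normrX lerXn2r ?nnegrE // (le_trans (norm_coord_le h i)).
Qed.

(** Derivation is bounded after shrinking the radius: on a monomial of degree d + 1, halving it
    gains 2^d, which together with the factor 2 absorbs m_i <= 2^{d+1}. *)
Lemma mnorm_mderiv s p i : 0 < s -> mnorm (s / 2) (mderiv i p) <= 2 / s * mnorm s p.
Proof.
move=> s0; have s20 : 0 <= s / 2 by rewrite divr_ge0 // ltW.
rewrite {1}[p]mpolyE linear_sum /= (le_trans (mnorm_sum _ _ s20)) //.
rewrite mulr_sumr ler_sum // => m _.
rewrite mderivZ mderivX scalerA mnormZ mnormX normrM normr_nat.
have -> : 2 / s * (`|mcoeff m p| * s ^+ mdeg m) =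
    `|mcoeff m p| * (2 / s * s ^+ mdeg m) by ring.
rewrite -[leLHS]mulrA; apply: ler_wpM2l => //.
have [->|mi] := posnP (m i).
  by rewrite mul0r mulr_ge0 ?exprn_ge0 ?divr_ge0 // ltW.
have dm : mdeg m = (mdeg (mnm_sub m (mnm1 i))).+1.
  by rewrite -{1}(@submK _ (mnm1 i) m) ?lep1mP -?lt0n // mdegD mdeg1 addn1.
have mid : (m i <= 2 ^ mdeg m)%N.
  apply: (@leq_trans (mdeg m)); last by rewrite ltnW // ltn_expl.
  by rewrite mdegE (bigD1 i) //= leq_addr.
rewrite dm in mid *; set d := mdeg _ in mid *.
have -> : 2 / s * s ^+ d.+1 = 2 ^+ d.+1 * (s / 2) ^+ d.
  rewrite exprMn exprVn !exprS; field.
  by rewrite expf_neq0 ?pnatr_eq0 // gt_eqF.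
by rewrite ler_wpM2r ?exprn_ge0 // -natrX ler_nat.
Qed.

Lemma mnorm1 s : mnorm s 1 = 1.
Proof. by rewrite -mpolyX0 mnormX mdeg0 expr0. Qed.

Lemma mnorm_prod s I (r : seq I) (F : I -> mpoly n R) : 0 <= s ->
  mnorm s (\prod_(i <- r) F i) <= \prod_(i <- r) mnorm s (F i).
Proof.
move=> s0; elim: r => [|i r IH]; first by rewrite !big_nil mnorm1.
rewrite !big_cons (le_trans (mnormM _ _ s0)) //.
by rewrite ler_wpM2l // mnorm_ge0.
Qed.

Lemma mnormXn s p k : 0 <= s -> mnorm s (p ^+ k) <= mnorm s p ^+ k.
Proof.
move=> s0; elim: k => [|k IH]; first by rewrite !expr0 mnorm1.
rewrite !exprS (le_trans (mnormM _ _ s0)) //.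
by rewrite ler_wpM2l // mnorm_ge0.
Qed.

Definition mderiv_dir (v : 'rV[R]_n) p := \sum_i v 0 i *: mderiv i p.

Lemma mderiv_dirB v p q : mderiv_dir v (p - q) = mderiv_dir v p - mderiv_dir v q.
Proof.
by rewrite /mderiv_dir -sumrB; apply: eq_bigr => i _; rewrite mderivB scalerBr.
Qed.

Lemma mnorm_mderiv_dir s v p : 0 < s ->
  mnorm (s / 2) (mderiv_dir v p) <= n%:R * `|v| * (2 / s) * mnorm s p.
Proof.
move=> s0; have s20 : 0 <= s / 2 by rewrite divr_ge0 // ltW.
rewrite (le_trans (mnorm_sum _ _ s20)) //.
have -> : n%:R * `|v| * (2 / s) * mnorm s p =
    \sum_(i < n) `|v| * (2 / s * mnorm s p).
  by rewrite sumr_const card_ord -mulr_natl; ring.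
rewrite ler_sum // => i _; rewrite mnormZ ler_pM ?mnorm_ge0 ?norm_coord_le //.
exact: mnorm_mderiv.
Qed.

Lemma meval_is_polynomial p : polynomial_function (fun x : 'rV[R]_n => meval (x 0) p).
Proof. by exists p. Qed.

Lemma meval_mderiv_dir v p (x : 'rV[R]_n) :
  meval (x 0) (mderiv_dir v p) = \sum_i v 0 i * meval (x 0) (mderiv i p).
Proof. by rewrite /mderiv_dir raddf_sum; apply: eq_bigr => i _; exact: mevalZ. Qed.

(** Links the analytic derivative to the formal one, to which the norm estimates apply. On monomials
    the proof is by induction on the degree, splitting off one variable. *)
Lemma derive_meval p v (x : 'rV[R]_n) :
  'D_v (fun y : 'rV[R]_n => meval (y 0) p) x = meval (x 0) (mderiv_dir v p).
Proof.
have dif q y := polynomial_function_differentiable (meval_is_polynomial q) y.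
have derX m : 'D_v (fun y : 'rV[R]_n => meval (y 0) (mpolyX R m)) x =
    \sum_i v 0 i * meval (x 0) (mderiv i (mpolyX R m)).
  elim: {m}(mdeg m) {-2}m (erefl (mdeg m)) => [|d IH] m md.
    have -> : m = mnm0 by apply/eqP; rewrite -mdeg_eq0 md.
    rewrite mpolyX0 (_ : (fun _ => _) = fun=> 1); last first.
      by apply/funext => y; rewrite meval1.
    have D0 := congr1 (fun F => F x) (@derive_cstE R n 1 v). rewrite [LHS]D0 .
    rewrite big1 // => i _.
    by rewrite -mpolyC1 mderivC meval0 mulr0.
  have [i mi] : exists i, (0 < m i)%N.
    apply: contrapT => nm; suff m0 : mdeg m = 0%N by rewrite m0 in md.
    rewrite mdegE big1 // => i _; apply/eqP; rewrite -leqn0 leqNgt.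
    by apply/negP => mi; apply: nm; exists i.
  have mK : mnm_add (mnm_sub m (mnm1 i)) (mnm1 i) = m.
    by apply: submK; rewrite lep1mP -lt0n.
  have dm : mdeg (mnm_sub m (mnm1 i)) = d.
    by apply/eqP; rewrite -eqSS -md -{2}mK mdegD mdeg1 addn1.
  have mE : mpolyX R m = mpolyX R (mnm1 i) * mpolyX R (mnm_sub m (mnm1 i)).
    by rewrite -mpolyXD addmC mK.
  have dU j : mderiv j (mpolyX R (mnm1 i)) = mpolyC n (i == j)%:R.
    rewrite mderivX mnm1E; case: eqP => [->|_]; last by rewrite scale0r mpolyC0.
    rewrite (_ : mnm_sub _ _ = mnm0) ?mpolyX0 ?scale1r //.
    by apply/mnmP => k; rewrite mnmBE subnn mnm0E.
  rewrite mE; move: (mnm_sub m (mnm1 i)) dm => m' dm'.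
  rewrite (_ : (fun _ => _) = fun y : 'rV[R]_n =>
      y 0 i * meval (y 0) (mpolyX R m')); last first.
    by apply/funext => y; rewrite mevalM mevalXU.
  rewrite derive_mul_coord; last exact: dif.
  rewrite IH // mulr_sumr (bigD1 i) //= [RHS](bigD1 i) //= addrA; congr (_ + _).
    rewrite mderivM dU eqxx mevalD !mevalM mevalXU mevalC /=.
    by set a := meval _ _; set b := meval _ _; clearbody a b; ring.
  apply: eq_bigr => j ji; rewrite mderivM dU eq_sym (negbTE ji).
  rewrite mevalD !mevalM mevalXU mevalC /=.
  by set a := meval _ _; set b := meval _ _; clearbody a b; ring.
rewrite meval_mderiv_dir; elim/mpolyind: p => [|c m p _ _ IH].
  rewrite (_ : (fun _ => _) = fun=> 0); last by apply/funext => y; rewrite meval0.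
  have D0 := congr1 (fun F => F x) (@derive_cstE R n 0 v); rewrite [LHS]D0.
  by rewrite big1 // => i _; rewrite mderiv0 meval0 mulr0.
rewrite (_ : (fun _ => _) = fun y : 'rV[R]_n =>
    c * meval (y 0) (mpolyX R m) + meval (y 0) p); last first.
  by apply/funext => y; rewrite mevalD mevalZ.
rewrite deriveD_rV; [|by apply: (differentiableZ c); exact: dif|exact: dif].
rewrite deriveZ_rV ?derX ?IH; last exact: dif.
rewrite mulr_sumr -big_split; apply: eq_bigr => i _ /=.
by rewrite mderivD mderivZ mevalD mevalZ; ring.
Qed.

End WeightedNorm.

Section PolynomialTaylor.
Variables (R : realType) (n : nat).
Implicit Types (p q : mpoly n R) (s : R).

Lemma mderiv_dir_is_linear p (x : 'rV[R]_n) :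
  linear (fun v : 'rV[R]_n => meval (x 0) (mderiv_dir v p)).
Proof.
move=> a u v; rewrite !meval_mderiv_dir scaler_sumr -big_split; apply: eq_bigr => i _.
rewrite !mxE mulrDl -[a *: _]/(a * _); congr (_ + _).
by rewrite mulrA.
Qed.

Lemma mnorm_mderiv_dir2 s u p : 0 < s ->
  mnorm (s / 4) (mderiv_dir u (mderiv_dir u p)) <=
    8 * n%:R ^+ 2 / s ^+ 2 * mnorm s p * `|u| ^+ 2.
Proof.
move=> s0; have s20 : 0 < s / 2 by rewrite divr_gt0.
have -> : s / 4 = s / 2 / 2 by field.
rewrite (le_trans (mnorm_mderiv_dir _ _ s20)) //.
have -> : 8 * n%:R ^+ 2 / s ^+ 2 * mnorm s p * `|u| ^+ 2 =
    n%:R * `|u| * (2 / (s / 2)) * (n%:R * `|u| * (2 / s) * mnorm s p).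
  by field; rewrite gt_eqF.
rewrite ler_wpM2l ?mnorm_mderiv_dir // !mulr_ge0 // invr_ge0; exact: ltW.
Qed.

(** Two mean value theorems reduce the remainder to a second derivative at a point of norm at most
    s/8 + s/8 = s/4, the radius left after two halvings; they cost n (2/s) and n (4/s). The bound
    depends on [p] only through its norm. *)
Lemma meval_taylor s p (h u : 'rV[R]_n) : 0 < s -> `|h| <= s / 8 -> `|u| <= s / 8 ->
  `|meval ((h + u) 0) p - meval (h 0) p - meval (h 0) (mderiv_dir u p)| <=
    8 * n%:R ^+ 2 / s ^+ 2 * mnorm s p * `|u| ^+ 2.
Proof.
move=> s0 hs us; pose F q := fun y : 'rV[R]_n => meval (y 0) q.
have dif q y : differentiable (F q) y.
  by apply: polynomial_function_differentiable; exists q.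
have [t /andP[t0 t1]] := @MVT_line R n (F p) h u 1 ltr01 (fun _ _ => dif p _).
rewrite scale1r mul1r derive_meval => ->.
have [r /andP[r0 rt]] := @MVT_line R n (F (mderiv_dir u p)) h u t t0 (fun _ _ => dif _ _).
rewrite derive_meval => ->; rewrite normrM gtr0_norm //.
have s40 : 0 <= s / 4 by rewrite divr_ge0 // ltW.
have r1 : r <= 1 by rewrite ltW // (lt_trans rt).
have hru : `|h + r *: u| <= s / 4.
  rewrite (le_trans (ler_normD _ _)) // (_ : s / 4 = s / 8 + s / 8); last by field.
  rewrite lerD // normrZ gtr0_norm // (le_trans _ us) //.
  by rewrite ler_piMl.
rewrite (le_trans _ (mnorm_mderiv_dir2 u p s0)) //.
apply: le_trans (meval_le_mnorm _ s40 hru); rewrite ler_piMl //; exact: ltW.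
Qed.

End PolynomialTaylor.

(** * Functions that are local limits of polynomials *)

Section PowerSeriesExpansion.
Variable R : realType.

Lemma mnorm_comp_mpoly n k s t (p : mpoly n R) (lq : n.-tuple (mpoly k R)) :
  0 <= t -> 0 <= s -> (forall i, mnorm t (tnth lq i) <= s) ->
  mnorm t (comp_mpoly lq p) <= mnorm s p.
Proof.
move=> t0 s0 lqs; rewrite comp_mpolyE (le_trans (mnorm_sum _ _ t0)) //.
rewrite ler_sum // => m _; rewrite mnormZ ler_wpM2l // (le_trans (mnorm_prod _ _ t0)) //.
rewrite mdegE -prodrXr ler_prod // => i _; rewrite mnorm_ge0 //=.
rewrite (le_trans (mnormXn _ _ t0)) // lerXn2r ?nnegrE //; exact: mnorm_ge0.
Qed.

(** The Cauchy condition bears on a sequence of polynomials rather than on a series, so products and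
    substitutions involve no rearrangement of terms. *)
Definition expands_at n (f : 'rV[R]_n -> R) (x : 'rV[R]_n) s (p : nat -> mpoly n R) :=
  [/\ 0 < s,
      forall e, 0 < e -> exists N0, forall N M, (N0 <= N)%N -> (N0 <= M)%N ->
        mnorm s (p N - p M) <= e
    & forall h : 'rV[R]_n, `|h| <= s ->
        tends (fun N => meval (h 0) (p N)) (f (x + h))].

Definition expandable n (f : 'rV[R]_n -> R) :=
  forall x, exists s p, expands_at f x s p.

Lemma expands_at_le n (f : 'rV[R]_n -> R) x s t p : 0 < t -> t <= s ->
  expands_at f x s p -> expands_at f x t p.
Proof.
move=> t0 ts [s0 cp fp]; split=> // [e /cp[N0 h]|h ht]; last first.
  by apply: fp; apply: le_trans ts.
exists N0 => N M NN NM; apply: le_trans (h N M NN NM).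
by apply: mnorm_le => //; exact: ltW.
Qed.

Lemma expands_at_bounded n (f : 'rV[R]_n -> R) x s p : expands_at f x s p ->
  exists q B, expands_at f x s q /\ forall N, mnorm s (q N) <= B.
Proof.
move=> [s0 cp fp]; have [N0 h0] := cp 1 ltr01.
exists (fun N => p (N0 + N)%N), (1 + mnorm s (p N0)); split; last first.
  move=> N; rewrite -[p (N0 + N)%N](subrK (p N0)) (le_trans (mnormD _ _ (ltW s0))) //.
  by rewrite lerD // h0 // leq_addr.
split=> // [e /cp[N1 h1]|h /fp hf e /hf[N1 h1]].
  by exists N1 => N M NN NM; rewrite h1 // (leq_trans _ (leq_addl _ _)).
by exists N1 => N NN; rewrite h1 // (leq_trans _ (leq_addl _ _)).
Qed.

Lemma expandable_cst n (a : R) : expandable (fun _ : 'rV[R]_n => a).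
Proof.
move=> x; exists 1, (fun=> mpolyC n a); split=> // [e e0|h _].
  by exists 0%N => N M _ _; rewrite subrr mnorm0 ltW.
by apply: tends_ext (tends_cst a) => N; rewrite mevalC.
Qed.

Lemma expandableD n (f g : 'rV[R]_n -> R) :
  expandable f -> expandable g -> expandable (fun x => f x + g x).
Proof.
move=> ef eg x; have [s [p fp]] := ef x; have [t [q gq]] := eg x.
have [s0 _ _] := fp; have [t0 _ _] := gq.
have [r [r0 rs rt]] := exists_pos_le2 s0 t0.
have [_ cp {}fp] := expands_at_le r0 rs fp; have [_ cq {}gq] := expands_at_le r0 rt gq.
exists r, (fun N => p N + q N); split=> // [e e0|h hr].
  have e20 : 0 < e / 2 by rewrite divr_gt0.
  have [N1 h1] := cp _ e20; have [N2 h2] := cq _ e20; exists (maxn N1 N2) => N M.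
  rewrite !geq_max => /andP[n1 n2] /andP[m1 m2].
  rewrite opprD addrACA (le_trans (mnormD _ _ (ltW r0))) // (splitr e).
  by rewrite lerD ?h1 ?h2.
by apply: tends_ext (tendsD (fp h hr) (gq h hr)) => N; rewrite mevalD.
Qed.

Lemma expands_at_mul n (f : 'rV[R]_n -> R) x s p (q : mpoly n R) :
  expands_at f x s p ->
  expands_at (fun y => meval ((y - x) 0) q * f y) x s (fun N => q * p N).
Proof.
move=> [s0 cp fp]; split=> // [e e0|h hs].
  have q1 : 0 < mnorm s q + 1 by rewrite ltr_wpDl // mnorm_ge0 // ltW.
  have [N0 h0] := cp _ (divr_gt0 e0 q1); exists N0 => N M NN NM.
  rewrite -mulrBr (le_trans (mnormM _ _ (ltW s0))) //.
  apply: (@le_trans _ _ ((mnorm s q + 1) * (e / (mnorm s q + 1)))).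
    by rewrite ler_pM ?h0 ?mnorm_ge0 ?lerDl // ltW.
  by rewrite mulrCA divff ?mulr1 // gt_eqF.
rewrite addrC addKr; apply: tends_ext (tendsM _ (fp h hs)) => N.
by rewrite mevalM.
Qed.

Lemma expandableZ n a (f : 'rV[R]_n -> R) : expandable f -> expandable (fun x => a * f x).
Proof.
move=> ef x; have [s [p /(expands_at_mul (mpolyC n a)) fp]] := ef x.
by exists s; eexists; move: fp; under [X in expands_at X]eq_fun do rewrite mevalC; exact.
Qed.

Lemma expandable_mul_coord n i (f : 'rV[R]_n -> R) :
  expandable f -> expandable (fun x => x 0 i * f x).
Proof.
move=> ef x; have [s [p fp]] := ef x.
(* In the local variable h = y - x the coordinate is the polynomial h_i + x_i. *)
have := expands_at_mul (mpolyX R (mnm1 i) + mpolyC n (x 0 i)) fp.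
rewrite (_ : (fun _ => _) = (fun y : 'rV[R]_n => y 0 i * f y)); last first.
  by apply/funext => y; rewrite mevalD mevalXU mevalC !mxE subrK.
by exists s; eexists; eassumption.
Qed.

Lemma expandable_mulmx n k (M : 'M[R]_(n, k)) (f : 'rV[R]_k -> R) :
  expandable f -> expandable (fun x => f (x *m M)).
Proof.
move=> ef x; have [s [p [s0 cp fp]]] := ef (x *m M).
pose lq : k.-tuple (mpoly n R) := [tuple \sum_i M i j *: mpolyX R (mnm1 i) | j < k].
pose B := \sum_i \sum_j `|M i j|.
have B0 : 0 <= B by apply: sumr_ge0 => i _; apply: sumr_ge0 => j _.
(* [B] dominates the absolute sum of each column of [M], so the linear forms substituted for the
   variables have norm at most t B <= s. *)
pose t := s / (B + 1); have B1 : 0 < B + 1 by rewrite ltr_wpDl.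
have t0 : 0 < t by rewrite divr_gt0.
have lqs j : mnorm t (tnth lq j) <= s.
  rewrite tnth_mktuple (le_trans (mnorm_sum _ _ (ltW t0))) //.
  have -> : s = t * B + t by rewrite /t; clear - B1; field; rewrite gt_eqF.
  rewrite ler_wpDr ?(ltW t0) // /B mulr_sumr ler_sum // => i _.
  rewrite mnormZ mnormX mdeg1 expr1 mulrC ler_wpM2l ?(ltW t0) //.
  by rewrite (bigD1 j) //= lerDl sumr_ge0.
have lqE (h : 'rV[R]_n) j : meval (h 0) (tnth lq j) = (h *m M) 0 j.
  rewrite tnth_mktuple raddf_sum mxE; apply: eq_bigr => i _ /=.
  by rewrite mevalZ mevalXU mulrC.
exists t, (fun N => comp_mpoly lq (p N)); split=> // [e /cp[N0 h0]|h ht].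
  exists N0 => N P NN NP; rewrite -comp_mpolyB.
  exact: le_trans (mnorm_comp_mpoly _ (ltW t0) (ltW s0) lqs) (h0 N P NN NP).
rewrite mulmxDl; have hM : `|h *m M| <= s.
  rewrite [leLHS]mx_normrE; apply: bigmax_le => [|[i j] _]; first exact: ltW.
  rewrite ord1 /= -lqE; apply: le_trans (lqs j).
  exact: meval_le_mnorm (ltW t0) ht.
apply: tends_ext (fp _ hM) => N; rewrite comp_mpoly_meval.
by apply: meval_eq => j; rewrite lqE.
Qed.

(** Bounded norms give second order Taylor estimates uniform in N, with increments up to s/8, at
    every point of the ball of radius s/8. The convergence of the derivatives is what expands
    ['D_v f] in turn. *)
Lemma expands_at_derive n (f : 'rV[R]_n -> R) x s p B :
  expands_at f x s p -> (forall N, mnorm s (p N) <= B) ->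
  forall h : 'rV[R]_n, `|h| <= s / 8 -> differentiable f (x + h) /\
    forall u, tends (fun N => meval (h 0) (mderiv_dir u (p N))) ('D_u f (x + h)).
Proof.
move=> [s0 cp fp] pB h hs; have s80 : 0 < s / 8 by rewrite divr_gt0.
have B0 : 0 <= B by apply: le_trans (pB 0%N); rewrite mnorm_ge0 // ltW.
pose F N (y : 'rV[R]_n) := meval ((y - x) 0) (p N).
pose M := 8 * n%:R ^+ 2 / s ^+ 2 * B.
have c0 : 0 <= 8 * n%:R ^+ 2 / s ^+ 2 by rewrite divr_ge0 ?mulr_ge0 ?exprn_ge0 // ltW.
have M0 : 0 <= M by rewrite mulr_ge0.
apply: (limit_differentiable (@real_seq_complete R) (F := F) s80 M0).
- by move=> N; exact: mderiv_dir_is_linear.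
- move=> u us; have hus : `|h + u| <= s.
    rewrite (le_trans (ler_normD _ _)) // (le_trans (lerD hs (ltW us))) //.
    by clear - s0; lra.
  rewrite -addrA; apply: tends_ext (fp _ hus) => N.
  by rewrite /F [x + _]addrC addrK.
- move=> N u us; have FE w : F N (x + w) = meval (w 0) (p N).
    by rewrite /F [x + _]addrC addrK.
  rewrite -[x + h + u]addrA !FE.
  apply: le_trans (meval_taylor (p N) s0 hs (ltW us)) _.
  by rewrite ler_wpM2r ?exprn_ge0 // ler_wpM2l.
Qed.

Lemma expandable_differentiable n (f : 'rV[R]_n -> R) x :
  expandable f -> differentiable f x.
Proof.
move=> ef; have [s [p /expands_at_bounded[q [B [fq qB]]]]] := ef x.
have [s0 _ _] := fq; have [|+ _] := expands_at_derive fq qB (h := 0).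
  by rewrite normr0 divr_ge0 // ltW.
by rewrite addr0.
Qed.

Lemma expandable_derive n (f : 'rV[R]_n -> R) v : expandable f -> expandable ('D_v f).
Proof.
move=> ef x; have [s [p /expands_at_bounded[q [B [fq qB]]]]] := ef x.
have [s0 cq _] := fq; have dq := expands_at_derive fq qB.
exists (s / 8), (fun N => mderiv_dir v (q N)); split; first by rewrite divr_gt0.
  pose c := n%:R * `|v| * (2 / s) + 1.
  have c00 : 0 <= n%:R * `|v| * (2 / s) by rewrite !mulr_ge0 // invr_ge0 ltW.
  have c0 : 0 < c by rewrite ltr_wpDl.
  move=> e e0; have [N0 h0] := cq _ (divr_gt0 e0 c0); exists N0 => N M NN NM.
  rewrite -mderiv_dirB; apply: (@le_trans _ _ (mnorm (s / 2) (mderiv_dir v (q N - q M)))).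
    apply: mnorm_le; first by rewrite divr_ge0 // ltW.
    by clear - s0; lra.
  rewrite (le_trans (mnorm_mderiv_dir _ _ s0)) //.
  apply: (@le_trans _ _ (c * (e / c))); last by rewrite mulrCA divff ?mulr1 // gt_eqF.
  by rewrite ler_pM ?h0 ?mnorm_ge0 ?lerDl // ltW.
by move=> h hs; have [_] := dq h hs; apply.
Qed.

Lemma expandable_deriveC n (f : 'rV[R]_n -> R) u v x :
  expandable f -> 'D_u ('D_v f) x = 'D_v ('D_u f) x.
Proof.
move=> ef; apply: Cinfty_function_deriveC.
apply: (@Cinfty_function_coind R n (@expandable n)) ef => [g eg y|g w].
  exact: expandable_differentiable.
exact: expandable_derive.
Qed.

End PowerSeriesExpansion.

(** * Equivalence of power series with limits of polynomials *)

Section AnalyticFunctions.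
Variables (R : realType) (n : nat).
Implicit Types (p q : mpoly n R) (s : R) (a : {ffun 'I_n -> nat}).

Definition cube N : seq {ffun 'I_n -> nat} :=
  [seq multi_index b | b <- enum {: {ffun 'I_n -> 'I_N}}].

Lemma big_cube N (F : {ffun 'I_n -> nat} -> R) :
  \sum_(a : {ffun 'I_n -> 'I_N}) F (multi_index a) = \sum_(a <- cube N) F a.
Proof. by rewrite big_map big_enum. Qed.

Lemma cube_uniq N : uniq (cube N).
Proof.
rewrite map_inj_uniq ?enum_uniq // => a b /ffunP ab; apply/ffunP => i; apply: val_inj.
by have := ab i; rewrite !ffunE.
Qed.

Lemma mem_cube N a : (a \in cube N) = [forall i, (a i < N)%N].
Proof.
apply/mapP/forallP => [[b _ ->] i|aN]; first by rewrite ffunE.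
exists [ffun i => Ordinal (aN i)]; first by rewrite mem_enum.
by apply/ffunP => i; rewrite !ffunE.
Qed.

Lemma cube_subset N M : (N <= M)%N -> {subset cube N <= cube M}.
Proof.
move=> NM a; rewrite !mem_cube => /forallP aN; apply/forallP => i.
exact: leq_trans (aN i) NM.
Qed.

Lemma cube_split (V : zmodType) N M (F : {ffun 'I_n -> nat} -> V) : (N <= M)%N ->
  \sum_(a <- cube M) F a =
    \sum_(a <- cube N) F a + \sum_(a <- cube M | a \notin cube N) F a.
Proof.
move=> NM; rewrite (bigID (mem (cube N))) /=; congr (_ + _).
rewrite -big_filter; apply: perm_big; apply: uniq_perm.
- exact: filter_uniq (cube_uniq M).
- exact: cube_uniq.
- move=> a; rewrite mem_filter /= andb_idr //; exact: cube_subset.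
Qed.

Definition mnm_of a : multinom n := Multinom [tuple a i | i < n].

Lemma mnm_ofE a i : mnm_of a i = a i.
Proof. by rewrite multinomE tnth_mktuple. Qed.

Lemma mnm_of_inj : injective mnm_of.
Proof. by move=> a b ab; apply/ffunP => i; rewrite -!mnm_ofE ab. Qed.

Lemma meval_seq p (h : 'rV[R]_n) (r : seq (multinom n)) : uniq r ->
  {subset msupp p <= r} ->
  meval (h 0) p = \sum_(m <- r) mcoeff m p * \prod_i h 0 i ^+ m i.
Proof.
move=> ur pr; rewrite mevalE [RHS](bigID (mem (msupp p))) /= [X in _ + X]big1 ?addr0.
  rewrite -[RHS]big_filter; apply: perm_big.
  apply: uniq_perm; rewrite ?filter_uniq ?msupp_uniq // => m.
  by rewrite mem_filter andb_idr // => /pr.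
by move=> m /memN_msupp_eq0 ->; rewrite mul0r.
Qed.

Lemma msupp_cube p K : (msize p <= K)%N ->
  {subset msupp p <= [seq mnm_of a | a <- cube K]}.
Proof.
move=> pK m mp; apply/mapP; exists [ffun i => m i]; last first.
  by apply/mnmP => i; rewrite mnm_ofE ffunE.
rewrite mem_cube; apply/forallP => i; rewrite ffunE.
apply: leq_trans (leq_trans (msize_mdeg_lt mp) pK); rewrite ltnS.
by rewrite mdegE (bigD1 i) //= leq_addr.
Qed.

Lemma meval_cube p (h : 'rV[R]_n) K : (msize p <= K)%N ->
  meval (h 0) p = \sum_(a <- cube K) mcoeff (mnm_of a) p * monomial h a.
Proof.
move=> pK; rewrite (meval_seq _ (r := [seq mnm_of a | a <- cube K])).
- rewrite big_map; apply: eq_bigr => a _; congr (_ * _).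
  by apply: eq_bigr => i _; rewrite mnm_ofE.
- rewrite map_inj_uniq ?cube_uniq //; exact: mnm_of_inj.
- exact: msupp_cube.
Qed.

Lemma mnorm_cube_le s p K : 0 <= s ->
  \sum_(a <- cube K) `|mcoeff (mnm_of a) p| * s ^+ mdeg (mnm_of a) <= mnorm s p.
Proof.
move=> s0; have := mnorm_seq_le p (r := [seq mnm_of a | a <- cube K]) s0.
rewrite big_map; apply; rewrite map_inj_uniq ?cube_uniq //; exact: mnm_of_inj.
Qed.

Lemma norm_monomial_le s (h : 'rV[R]_n) a : `|h| <= s ->
  `|monomial h a| <= s ^+ mdeg (mnm_of a).
Proof.
move=> hs; rewrite normr_prod mdegE -prodrXr ler_prod // => i _.
have his := le_trans (norm_coord_le h i) hs.
by rewrite normr_ge0 normrX mnm_ofE lerXn2r ?nnegrE // (le_trans _ his).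
Qed.

Lemma monomial_const s a :
  monomial (const_mx s : 'rV[R]_n) a = s ^+ mdeg (mnm_of a).
Proof.
by rewrite mdegE -prodrXr; apply: eq_bigr => i _; rewrite mxE mnm_ofE.
Qed.

Lemma mnorm_distC s p q : mnorm s (p - q) = mnorm s (q - p).
Proof. by rewrite -opprB -scaleN1r mnormZ normrN normr1 mul1r. Qed.

(** Absolute convergence at the single point (s, ..., s) is convergence of the sum of the |c_a|
    s^{|a|}, which makes the cubic partial sums Cauchy for [mnorm s]. *)
Lemma analytic_expandable (f : 'rV[R]_n -> R) : analytic_function f -> expandable f.
Proof.
move=> af x; have [c [r r0 cf]] := af x; pose s := r / 2.
have s0 : 0 < s by rewrite divr_gt0.
have sr : s < r by rewrite ltr_pdivrMr // ltr_pMr // ltr1n.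
pose w a := `|c a| * s ^+ mdeg (mnm_of a).
pose p N := \sum_(a <- cube N) c a *: mpolyX R (mnm_of a).
have pw N M : (N <= M)%N ->
    mnorm s (p M - p N) <= \sum_(a <- cube M) w a - \sum_(a <- cube N) w a.
  move=> NM; rewrite (cube_split w NM) addrAC subrr add0r.
  have -> : p M - p N = \sum_(a <- cube M | a \notin cube N) c a *: mpolyX R (mnm_of a).
    by rewrite /p (cube_split _ NM) addrAC subrr add0r.
  rewrite -big_filter -[leRHS]big_filter (le_trans (mnorm_sum _ _ (ltW s0))) //.
  by rewrite ler_sum // => a _; rewrite mnormZ mnormX.
have cw : cauchy_seq (fun N => \sum_(a <- cube N) w a).
  have [|/cvg_ex[l wl] _] := cf (const_mx s).
    by rewrite (le_lt_trans (norm_const_mx_le _ (ltW s0))).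
  apply: (@tends_cauchy _ _ l); apply/tendsP.
  rewrite (_ : (fun N => \sum_(a <- cube N) w a) =
    (fun N => \sum_(a : {ffun 'I_n -> 'I_N})
      `|c (multi_index a) * monomial (const_mx s) (multi_index a)|)) //.
  apply/funext => N; rewrite (big_cube N (fun a => `|c a * monomial (const_mx s) a|)).
  apply: eq_bigr => a _; rewrite normrM monomial_const /w; congr (_ * _).
  by rewrite ger0_norm // exprn_ge0 // ltW.
exists s, p; split=> // [e /cw[N0 h0]|h hs].
  exists N0 => N M; wlog NM : N M / (N <= M)%N => [wl NN NN'|NN NN'].
    have [NM|/ltnW MN] := leqP N M; first exact: wl.
    by rewrite mnorm_distC wl.
  rewrite mnorm_distC (le_trans (pw _ _ NM)) // (le_trans (ler_norm _)) //.
  exact: h0.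
have [_ hf] := cf h (le_lt_trans hs sr).
apply/tendsP; rewrite (_ : (fun N => _) =
  (fun N => \sum_(a : {ffun 'I_n -> 'I_N})
      c (multi_index a) * monomial h (multi_index a))) //.
apply/funext => N; rewrite (big_cube N (fun a => c a * monomial h a)) /p raddf_sum.
apply: eq_bigr => a _; rewrite /= mevalZ mevalX; congr (_ * _).
by apply: eq_bigr => i _; rewrite mnm_ofE.
Qed.

Lemma tends_norm (K : numFieldType) (u : nat -> K) l :
  tends u l -> tends (fun N => `|u N|) `|l|.
Proof.
move=> ul e /ul[N0 h]; exists N0 => N /h; exact: le_trans (ler_dist_dist _ _).
Qed.

(** Each coefficient is controlled by the norm, so the coefficients of the p N converge one by one;
    their limits are the coefficients of the series. *)
Lemma expandable_analytic (f : 'rV[R]_n -> R) : expandable f -> analytic_function f.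
Proof.
move=> ef x; have [s [p [s0 cp fp]]] := ef x; have s0' := ltW s0.
have /choice[c cE] a : exists l, tends (fun N => mcoeff (mnm_of a) (p N)) l.
  apply: (@real_seq_complete R) => e e0; pose d := s ^+ mdeg (mnm_of a).
  have d0 : 0 < d by rewrite exprn_gt0.
  have [N0 h0] := cp _ (mulr_gt0 e0 d0); exists N0 => N M NN NM.
  rewrite -mcoeffB -(ler_pM2r d0); apply: le_trans (h0 N M NN NM).
  by have := mnorm_seq_le (p N - p M) (r := [:: mnm_of a]) s0'; rewrite big_seq1; apply.
(* The bound is uniform in K: it is obtained by letting M tend to infinity in a finite sum over the
   cube. *)
have cpK e : 0 < e -> exists N0, forall N K, (N0 <= N)%N ->
    \sum_(a <- cube K) `|c a - mcoeff (mnm_of a) (p N)| * s ^+ mdeg (mnm_of a) <= e.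
  move=> e0; have [N0 h0] := cp _ e0; exists N0 => N K NN.
  pose u a M := s ^+ mdeg (mnm_of a) * `|mcoeff (mnm_of a) (p M) - mcoeff (mnm_of a) (p N)|.
  have uc a : tends (u a) (s ^+ mdeg (mnm_of a) * `|c a - mcoeff (mnm_of a) (p N)|).
    by apply: tendsM; apply: tends_norm; apply: tendsB (cE a) (tends_cst _).
  under eq_bigr do rewrite mulrC.
  apply: le_trans (ler_norm _) _; apply: tends_norm_le (tends_sum _ uc).
  exists N0 => M NM; rewrite ger0_norm; last first.
    by rewrite sumr_ge0 // => a _; rewrite mulr_ge0 // exprn_ge0.
  apply: le_trans (h0 M N NM NN); apply: le_trans (mnorm_cube_le _ K s0').
  by rewrite ler_sum // => a _; rewrite mcoeffB mulrC.
exists c, s => // h hs u; have hs' := ltW hs.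
have uE K : \sum_(a : {ffun 'I_n -> 'I_K}) `|u (multi_index a)| = \sum_(a <- cube K) `|u a|.
  exact: (big_cube K (fun a => `|u a|)).
split.
  have [N0 /(_ N0) h0] := cpK 1 ltr01.
  rewrite (_ : (fun N => _) = (fun K => \sum_(a <- cube K) `|u a|)); last first.
    by apply/funext => K; exact: uE.
  apply: nondecreasing_is_cvgn => [K M KM|].
    by rewrite (cube_split _ KM) lerDl sumr_ge0.
  exists (1 + mnorm s (p N0)) => _ [K _ <-].
  apply: le_trans (lerD (h0 K (leqnn _)) (mnorm_cube_le (p N0) K s0')).
  rewrite -big_split ler_sum // => a _ /=; rewrite -mulrDl normrM.
  rewrite ler_pM ?norm_monomial_le // -{1}[c a](subrK (mcoeff (mnm_of a) (p N0))).
  exact: ler_normD.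
apply/tendsP => e e0; have e20 : 0 < e / 2 by rewrite divr_gt0.
have [N1 h1] := cpK _ e20; have [N2 h2] := fp h hs' _ e20.
(* Beyond [msize (p N)] the cube contains the whole support of [p N]. *)
pose N := maxn N1 N2; exists (msize (p N)) => K pK.
rewrite (big_cube K u) -[\sum_(_ <- _) _](subrK (meval (h 0) (p N))) -addrA.
rewrite (le_trans (ler_normD _ _)) // [leRHS]splitr lerD //; last first.
  by apply: h2; rewrite leq_maxr.
rewrite (meval_cube _ pK) -sumrB (le_trans (ler_norm_sum _ _ _)) //.
apply: le_trans (h1 N K (leq_maxl _ _)); rewrite ler_sum // => a _.
by rewrite -mulrBl normrM ler_wpM2l // norm_monomial_le.
Qed.

End AnalyticFunctions.

Lemma analytic_smooth_axioms (R : realType) : smooth_axioms (@analytic_function R).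
Proof.
have AE n := @analytic_expandable R n; have EA n := @expandable_analytic R n.
split=> [n a|n f g|n a f|n i f|n p M f|n f /AE ef x|n f v /AE ef|n f u v x /AE ef].
- by apply: EA; exact: expandable_cst.
- by move=> /AE ef /AE eg; apply: EA; exact: expandableD.
- by move=> /AE ef; apply: EA; exact: expandableZ.
- by move=> /AE ef; apply: EA; exact: expandable_mul_coord.
- by move=> /AE ef; apply: EA; exact: expandable_mulmx.
- exact: expandable_differentiable.
- by apply: EA; exact: expandable_derive.
- exact: expandable_deriveC.
Qed.

(** * Holomorphic functions *)

Section Bisection.
Variable R : realType.
Implicit Types a b p q s t : R.

Lemma nested_limit (u w : nat -> R) :
  (forall n, u n <= u n.+1) -> (forall n, w n.+1 <= w n) ->
  (forall n, u n <= w n) -> exists s, forall n, u n <= s <= w n.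
Proof.
move=> du dw uw.
have mu n m : (n <= m)%N -> u n <= u m.
  by move=> /subnK <-; elim: (m - n)%N => // k IH; rewrite addSn (le_trans IH).
have mw n m : (n <= m)%N -> w m <= w n.
  by move=> /subnK <-; elim: (m - n)%N => // k IH; rewrite addSn (le_trans _ IH).
have uwnm n m : u n <= w m.
  rewrite (le_trans (mu _ _ (leq_maxl n m))) // (le_trans (uw _)) //.
  by rewrite mw // leq_maxr.
exists (sup (range u)) => n; apply/andP; split.
  apply: ub_le_sup; last by exists n.
  by exists (w 0%N) => _ [k _ <-].
by apply: ge_sup => [|_ [k _ <-]]; [exists (u 0%N), 0%N|].
Qed.

(** The n-th cell has sides p / 2^n and q / 2^n. Goursat's argument uses it for rectangles, and with
    [q = 0] it is the bisection of an interval used in [mean_value_le]. *)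
Lemma bisection (Bad : nat -> R -> R -> Prop) a b p q : 0 <= p -> 0 <= q ->
    Bad 0%N a b ->
    (forall n a b, Bad n a b -> exists a' b',
      [/\ a' = a \/ a' = a + p / 2 ^+ n.+1, b' = b \/ b' = b + q / 2 ^+ n.+1 &
       Bad n.+1 a' b']) ->
  exists s t, forall n, exists a' b',
    [/\ a' <= s <= a' + p / 2 ^+ n, b' <= t <= b' + q / 2 ^+ n & Bad n a' b'].
Proof.
move=> p0 q0 Bad0 step.
have /choice[g gP] (x : nat * (R * R)) : exists y : R * R,
    Bad x.1 x.2.1 x.2.2 ->
    [/\ y.1 = x.2.1 \/ y.1 = x.2.1 + p / 2 ^+ x.1.+1,
        y.2 = x.2.2 \/ y.2 = x.2.2 + q / 2 ^+ x.1.+1 & Bad x.1.+1 y.1 y.2].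
  have [/step[a' [b' ab]]|nB] := pselect (Bad x.1 x.2.1 x.2.2).
    by exists (a', b').
  by exists (0, 0).
pose st := fix st n := if n is k.+1 then g (k, st k) else (a, b).
have stB n : Bad n (st n).1 (st n).2.
  by elim: n => // n IH; have [] := gP (n, st n) IH.
have half x n : x / 2 ^+ n.+1 + x / 2 ^+ n.+1 = x / 2 ^+ n :> R.
  by rewrite exprS; field; rewrite expf_neq0 // pnatr_eq0.
have pos x n : 0 <= x -> 0 <= x / 2 ^+ n :> R by move=> x0; rewrite divr_ge0 ?exprn_ge0.
have lim (x : R) (u : nat -> R) : 0 <= x ->
    (forall n, u n.+1 = u n \/ u n.+1 = u n + x / 2 ^+ n.+1) ->
    exists s, forall n, u n <= s <= u n + x / 2 ^+ n.
  move=> x0 du; apply: (@nested_limit u (fun n => u n + x / 2 ^+ n)) => n.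
  - by have := pos x n.+1 x0; case: (du n) => ->; lra.
  - by have := pos x n.+1 x0; have := half x n; case: (du n) => ->; lra.
  - by have := pos x n x0; lra.
have [s sP] : exists s, forall n, (st n).1 <= s <= (st n).1 + p / 2 ^+ n.
  by apply: (lim p (fun n => (st n).1)) => // n; have [] := gP (n, st n) (stB n).
have [t tP] : exists t, forall n, (st n).2 <= t <= (st n).2 + q / 2 ^+ n.
  by apply: (lim q (fun n => (st n).2)) => // n; have [] := gP (n, st n) (stB n).
by exists s, t => n; exists (st n).1, (st n).2; split.
Qed.

Lemma exists_pow2_small (x e : R) : 0 <= x -> 0 < e -> exists n, x / 2 ^+ n < e.
Proof.
move=> x0 e0; exists (Num.bound (x / e)).
rewrite ltr_pdivrMr ?exprn_gt0 // mulrC -ltr_pdivrMr //.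
have xe : 0 <= x / e by rewrite divr_ge0 // ltW.
have xlt : x / e < (Num.bound (x / e))%:R by have := archi_boundP xe.
rewrite (lt_le_trans xlt) // -natrX ler_nat ltnW //; exact: ltn_expl.
Qed.

End Bisection.

Import ComplexField.Normc.

Section ComplexNorm.
Variable R : realType.
Local Notation C := R[i].
Implicit Types (z w : C) (x : R).
Local Open Scope complex_scope.

Lemma normc_real x : normc x%:C = `|x|.
Proof. by rewrite /normc /= expr0n addr0 sqrtr_sqr. Qed.

Lemma normc_i : normc ('i : C) = 1.
Proof. by rewrite /normc /= expr0n expr1n add0r sqrtr1. Qed.

Lemma normc_ge0 z : 0 <= normc z.
Proof. by case: z => a b; exact: sqrtr_ge0. Qed.

Lemma norm_normc z : `|z| = (normc z)%:C.
Proof. by rewrite normc_def; case: z. Qed.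

Lemma normcD z w : normc (z + w) <= normc z + normc w.
Proof. exact: le_normcD. Qed.

Lemma normc_opp z : normc (- z) = normc z.
Proof. exact: normcN. Qed.

Lemma normcB z w : normc (z - w) <= normc z + normc w.
Proof. by rewrite -[normc w]normc_opp normcD. Qed.

Lemma normc_le_parts z : normc z <= `|complex.Re z| + `|complex.Im z|.
Proof.
by rewrite {1}[z]complexE (le_trans (normcD _ _)) // normcM normc_i mul1r !normc_real.
Qed.

Lemma gt0c_real z : 0 < z -> exists2 x, 0 < x & z = x%:C.
Proof.
case: z => a b; rewrite ltcE /= => /andP[/eqP -> a0]; by exists a.
Qed.

End ComplexNorm.

(** * Goursat's theorem for trapezoidal sums *)

Section Goursat.
Variable R : realType.
Local Notation C := R[i].
Local Open Scope complex_scope.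
Implicit Types (f g : R -> C) (a b p q s t : R) (F : R -> R -> C).

(** The trapezoidal rule on 2^k equal subintervals. It is exact on affine functions and, by
    recursion on halves, exactly additive when the interval is bisected: the two properties of the
    integral that Goursat's argument uses. *)
Fixpoint trapezoid k f a p : C :=
  if k is k'.+1 then trapezoid k' f a (p / 2) + trapezoid k' f (a + p / 2) (p / 2)
  else (p / 2)%:C * (f a + f (a + p)).

Lemma trapezoidD k f g a p :
  trapezoid k (fun x => f x + g x) a p = trapezoid k f a p + trapezoid k g a p.
Proof.
elim: k a p => [|k IH] a p /=; first by rewrite -mulrDr addrACA.
by rewrite !IH addrACA.
Qed.

Lemma trapezoidM k c f a p :
  trapezoid k (fun x => c * f x) a p = c * trapezoid k f a p.
Proof.
elim: k a p => [|k IH] a p /=; first by rewrite -mulrDr mulrCA.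
by rewrite !IH mulrDr.
Qed.

Lemma trapezoid_affine k (al be : C) a p :
  trapezoid k (fun x => al + be * x%:C) a p =
  p%:C * al + be * (p * a + p ^+ 2 / 2)%:C.
Proof.
have h2 : (2 : C) != 0 by rewrite pnatr_eq0.
elim: k a p => [|k IH] a p /=; last rewrite !IH;
  rewrite !(rmorphD, rmorphM, rmorphXn, fmorphV, rmorph1) /=; by field.
Qed.

Lemma trapezoid_cst k (al : C) a p : trapezoid k (fun=> al) a p = p%:C * al.
Proof.
have := trapezoid_affine k al 0 a p; rewrite mul0r addr0 => <-.
by congr trapezoid; apply/funext => x; rewrite mul0r addr0.
Qed.

Lemma trapezoid_bound k f a p (B : R) : 0 <= p ->
  (forall x, a <= x <= a + p -> normc (f x) <= B) ->
  normc (trapezoid k f a p) <= p * B.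
Proof.
elim: k a p => [|k IH] a p p0 fB /=.
  rewrite normcM normc_real ger0_norm; last by lra.
  have fa : normc (f a) <= B by apply: fB; lra.
  have fp : normc (f (a + p)) <= B by apply: fB; lra.
  have := normcD (f a) (f (a + p)); nra.
have h1 : normc (trapezoid k f a (p / 2)) <= p / 2 * B.
  by apply: IH => [|x ax]; [lra|apply: fB; lra].
have h2 : normc (trapezoid k f (a + p / 2) (p / 2)) <= p / 2 * B.
  by apply: IH => [|x ax]; [lra|apply: fB; lra].
have := normcD (trapezoid k f a (p / 2)) (trapezoid k f (a + p / 2) (p / 2)); lra.
Qed.

(** Approximates the integral of F d(s + it) along the boundary of the rectangle,
    counterclockwise. *)
Definition contour k F a b p q : C :=
  trapezoid k (F^~ b) a p + 'i * trapezoid k (F (a + p)) b q -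
  trapezoid k (F^~ (b + q)) a p - 'i * trapezoid k (F a) b q.

(** Inner edges cancel in pairs; outer edges split by the recursion of [trapezoid], which costs one
    level. *)
Lemma contour_split k F a b p q : contour k.+1 F a b p q =
  contour k F a b (p / 2) (q / 2) + contour k F (a + p / 2) b (p / 2) (q / 2) +
  contour k F a (b + q / 2) (p / 2) (q / 2) +
  contour k F (a + p / 2) (b + q / 2) (p / 2) (q / 2).
Proof.
rewrite /contour /=.
have -> : a + p / 2 + p / 2 = a + p by field.
have -> : b + q / 2 + q / 2 = b + q by field.
ring.
Qed.

Lemma contourD k F G a b p q :
  contour k (fun s t => F s t + G s t) a b p q =
  contour k F a b p q + contour k G a b p q.
Proof. rewrite /contour !trapezoidD; ring. Qed.

Lemma contour_affine k (al D : C) a b p q :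
  contour k (fun s t => al + D * (s%:C + 'i * t%:C)) a b p q = 0.
Proof.
pose horizontal t := fun s : R => (al + D * 'i * t%:C) + D * s%:C.
pose vertical s := fun t : R => (al + D * s%:C) + (D * 'i) * t%:C.
have hE t : (fun s => al + D * (s%:C + 'i * t%:C)) = horizontal t.
  by apply/funext => s; rewrite /horizontal; ring.
have vE s : (fun t => al + D * (s%:C + 'i * t%:C)) = vertical s.
  by apply/funext => t; rewrite /vertical; ring.
rewrite /contour !hE !vE !trapezoid_affine !(rmorphD, rmorphM) /=; ring.
Qed.

Lemma contour_bound k F a b p q (B : R) : 0 <= p -> 0 <= q ->
  (forall s t, a <= s <= a + p -> b <= t <= b + q -> normc (F s t) <= B) ->
  normc (contour k F a b p q) <= 2 * (p + q) * B.
Proof.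
move=> p0 q0 FB; rewrite /contour.
have h1 : normc (trapezoid k (F^~ b) a p) <= p * B.
  by apply: trapezoid_bound => // s sp; apply: FB => //; lra.
have h2 : normc (trapezoid k (F (a + p)) b q) <= q * B.
  by apply: trapezoid_bound => // t tq; apply: FB => //; lra.
have h3 : normc (trapezoid k (F^~ (b + q)) a p) <= p * B.
  by apply: trapezoid_bound => // s sp; apply: FB => //; lra.
have h4 : normc (trapezoid k (F a) b q) <= q * B.
  by apply: trapezoid_bound => // t tq; apply: FB => //; lra.
set X1 := trapezoid _ _ _ _ in h1 *; set X2 := trapezoid _ _ _ _ in h2 *.
set X3 := trapezoid _ _ _ _ in h3 *; set X4 := trapezoid _ _ _ _ in h4 *.
have := normcB (X1 + 'i * X2 - X3) ('i * X4); have := normcB (X1 + 'i * X2) X3.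
have := normcD X1 ('i * X2); rewrite !normcM !normc_i !mul1r; lra.
Qed.

(* The Cauchy-Riemann equations at a point of the plane, in integrated form. *)
Definition holomorphic_at F s0 t0 := exists D : C, forall e, 0 < e ->
  exists2 d, 0 < d & forall s t, `|s - s0| < d -> `|t - t0| < d ->
    normc (F s t - F s0 t0 - D * ((s - s0)%:C + 'i * (t - t0)%:C)) <=
    e * (`|s - s0| + `|t - t0|).

(** If it fails, some quarter of the rectangle carries at least a quarter of the defect, and so on.
    At the limit point the affine part of F has contour 0 at every level k, so the remainder alone
    contributes, and it is too small. *)
Lemma goursat F a b p q e : 0 < p -> 0 < q -> 0 < e ->
  (forall s t, holomorphic_at F s t) ->
  exists N0, forall k, (N0 <= k)%N -> normc (contour k F a b p q) <= e.
Proof.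
move=> p0 q0 e0 hF; apply: contrapT => nN.
(* Badness is required for arbitrarily large levels, because each subdivision lowers the level by
   one. *)
pose Bad n a b := forall N0, exists2 k, (N0 <= k)%N &
  normc (contour k F a b (p / 2 ^+ n) (q / 2 ^+ n)) > e / 4 ^+ n.
have Bad0 : Bad 0%N a b.
  move=> N0; apply: contrapT => nk; apply: nN; exists N0 => k Nk.
  rewrite leNgt; apply/negP => ek; apply: nk; exists k => //.
  by rewrite !expr0 !divr1.
have half x n : x / 2 ^+ n / 2 = x / 2 ^+ n.+1 :> R.
  by rewrite exprSr invfM mulrA.
have Bad_step n a1 b1 : Bad n a1 b1 -> exists a' b',
    [/\ a' = a1 \/ a' = a1 + p / 2 ^+ n.+1, b' = b1 \/ b' = b1 + q / 2 ^+ n.+1 &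
     Bad n.+1 a' b'].
  move=> B; apply: contrapT => nB.
  have small a' b' : a' = a1 \/ a' = a1 + p / 2 ^+ n.+1 ->
      b' = b1 \/ b' = b1 + q / 2 ^+ n.+1 -> exists N0, forall k, (N0 <= k)%N ->
      normc (contour k F a' b' (p / 2 ^+ n.+1) (q / 2 ^+ n.+1)) <= e / 4 ^+ n.+1.
    move=> a'E b'E; apply: contrapT => nN0; apply: nB; exists a', b'; split=> // N0.
    apply: contrapT => nk; apply: nN0; exists N0 => k Nk.
    by rewrite leNgt; apply/negP => ek; apply: nk; exists k.
  have [N1 s1] := small a1 b1 (or_introl erefl) (or_introl erefl).
  have [N2 s2] := small _ b1 (or_intror erefl) (or_introl erefl).
  have [N3 s3] := small a1 _ (or_introl erefl) (or_intror erefl).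
  have [N4 s4] := small _ _ (or_intror erefl) (or_intror erefl).
  have [k] := B (maxn (maxn N1 N2) (maxn N3 N4)).+1.
  case: k => // k; rewrite ltnS !geq_max => /andP[/andP[/s1 h1 /s2 h2] /andP[/s3 h3 /s4 h4]].
  rewrite contour_split !half ltNge => /negP; apply.
  have e4 : e / 4 ^+ n = 4 * (e / 4 ^+ n.+1).
    by rewrite exprS; field; rewrite expf_neq0 // pnatr_eq0.
  rewrite e4; move: (e / _) h1 h2 h3 h4 => E.
  set X1 := contour _ _ _ _ _ _; set X2 := contour _ _ _ _ _ _.
  set X3 := contour _ _ _ _ _ _; set X4 := contour _ _ _ _ _ _ => h1 h2 h3 h4.
  have := normcD (X1 + X2 + X3) X4; have := normcD (X1 + X2) X3.
  have := normcD X1 X2; lra.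
have [s0 [t0 st]] := bisection (ltW p0) (ltW q0) Bad0 Bad_step.
(* With this [e1], the bound 2 (p + q) sup |G| on the n-th rectangle is exactly e / 4^n. *)
have [D HD] := hF s0 t0; pose e1 := e / (2 * (p + q) ^+ 2).
have pq0 : 0 < (p + q) ^+ 2 by rewrite exprn_gt0 // addr_gt0.
have e10 : 0 < e1 by rewrite divr_gt0 // mulr_gt0.
have [d d0 Hd] := HD _ e10.
have [n pqn] := exists_pow2_small (ltW (addr_gt0 p0 q0)) d0.
have [a' [b' [sa tb B]]] := st n; have [k _] := B 0%N.
rewrite ltNge => /negP; apply.
have pn0 : 0 < p / 2 ^+ n by rewrite divr_gt0 // exprn_gt0.
have qn0 : 0 < q / 2 ^+ n by rewrite divr_gt0 // exprn_gt0.
rewrite mulrDl in pqn.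
pose A s t := (F s0 t0 - D * (s0%:C + 'i * t0%:C)) + D * (s%:C + 'i * t%:C).
pose G s t := F s t - A s t.
have -> : contour k F a' b' (p / 2 ^+ n) (q / 2 ^+ n) =
    contour k G a' b' (p / 2 ^+ n) (q / 2 ^+ n).
  rewrite -[RHS]addr0 -(contour_affine k (F s0 t0 - D * (s0%:C + 'i * t0%:C)) D
    a' b' (p / 2 ^+ n) (q / 2 ^+ n)) -contourD.
  by congr contour; apply/funext => s; apply/funext => t; rewrite subrK.
have -> : e / 4 ^+ n = 2 * (p / 2 ^+ n + q / 2 ^+ n) * (e1 * (p / 2 ^+ n + q / 2 ^+ n)).
  have -> : 4 ^+ n = 2 ^+ n * 2 ^+ n :> R by rewrite -exprMn; congr (_ ^+ _); ring.
  rewrite /e1; field; rewrite ?expf_neq0 ?pnatr_eq0 //=.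
  by rewrite gt_eqF // addr_gt0.
apply: contour_bound => [||s t sp tq]; try exact: ltW.
have -> : G s t = F s t - F s0 t0 - D * ((s - s0)%:C + 'i * (t - t0)%:C).
  by rewrite /G /A !rmorphB /=; ring.
have ss : `|s - s0| <= p / 2 ^+ n by rewrite ler_norml; lra.
have tt : `|t - t0| <= q / 2 ^+ n by rewrite ler_norml; lra.
apply: le_trans (Hd _ _ _ _) _; [lra|lra|].
by rewrite ler_pM2l // lerD.
Qed.

(** By periodicity the horizontal sides of the rectangle cancel, so Goursat's theorem compares the
    two vertical ones. *)
Lemma trapezoid_homotopy F q s1 s2 e : 0 < q -> 0 < e -> s1 < s2 ->
  (forall s t, holomorphic_at F s t) -> (forall s, F s 0 = F s q) ->
  exists N0, forall k, (N0 <= k)%N ->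
    normc (trapezoid k (F s2) 0 q - trapezoid k (F s1) 0 q) <= e.
Proof.
move=> q0 e0 s12 hF pF.
have s120 : 0 < s2 - s1 by rewrite subr_gt0.
have [N0 NP] := goursat s1 0 s120 q0 e0 hF; exists N0 => k /NP.
rewrite /contour add0r.
have -> : (fun s => F s q) = F^~ 0 by apply/funext => s; rewrite -pF.
rewrite (addrC s1) subrK; set X := trapezoid _ _ _ _; set Y := trapezoid _ _ _ _.
set Z := trapezoid _ _ _ _.
have -> : X + 'i * Y - X - 'i * Z = 'i * (Y - Z) by ring.
by rewrite normcM normc_i mul1r.
Qed.

End Goursat.

Section Completeness.
Variable R : realType.

Local Open Scope complex_scope.

Lemma complex_seq_complete : seq_complete R[i].
Proof.
move=> u cu.
have part (P : R[i] -> R) : (forall z, `|P z| <= normc z) ->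
    (forall z w, P (z - w) = P z - P w) -> exists l, tends (fun N => P (u N)) l.
  move=> Pn PB; apply: real_seq_complete => e e0.
  have [N0 h] := cu e%:C (etrans (ltcR 0 e) e0); exists N0 => N M NN NM.
  rewrite -PB (le_trans (Pn _)) // -lecR -norm_normc; exact: h.
have norm_parts (a b : R) : `|a| <= normc (a +i* b) /\ `|b| <= normc (a +i* b).
  by split; rewrite /normc -sqrtr_sqr ler_wsqrtr // ?lerDl ?lerDr sqr_ge0.
have [a ua] : exists l, tends (fun N => complex.Re (u N)) l.
  by apply: part => [[x y]|[x y] [x' y']] //; have [] := norm_parts x y.
have [b ub] : exists l, tends (fun N => complex.Im (u N)) l.
  by apply: part => [[x y]|[x y] [x' y']] //; have [] := norm_parts x y.
exists (a +i* b) => _ /gt0c_real[e e0 ->].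
have e20 : 0 < e / 2 by rewrite divr_gt0.
have [N1 h1] := ua _ e20; have [N2 h2] := ub _ e20.
exists (maxn N1 N2) => N; rewrite geq_max => /andP[/h1 n1 /h2 n2].
rewrite norm_normc lecR (le_trans (normc_le_parts _)) // (splitr e) lerD //.
  by case: (u N) n1.
by case: (u N) n2.
Qed.

End Completeness.

Lemma first_order (K : numFieldType) (f : K -> K) (x df e : K) :
  is_derive x (1 : K) f df -> 0 < e ->
  exists2 d, 0 < d & forall h, `|h| < d -> `|f (x + h) - f x - df * h| <= e * `|h|.
Proof.
move=> [dfx <-] e0; have /cvgrPdist_le/(_ e e0) := dfx.
move=> /nbhs_ballP[d /= d0 b]; exists d => // h hd.
have [->|h0] := eqVneq h 0.
  by rewrite addr0 subrr mulr0 subrr !normr0 mulr0.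
have := b h; rewrite -ball_normE /= sub0r normrN => /(_ hd h0).
rewrite (_ : h%:A = h); last exact: mulr1.
rewrite (addrC h) -[_ *: _]/(_ * _) => le_e.
set D := lim _ in le_e *; rewrite -/D.
have -> : f (x + h) - f x - D * h = - (h * (D - h^-1 * (f (x + h) - f x))) by field.
by rewrite normrN normrM mulrC ler_wpM2r.
Qed.

(* Normed structures are only inferred on sorts of a [numFieldType]. *)
Definition Cfield (R : realType) : numFieldType := R[i].

(** * The exponential e^{s+it} and functions on circles *)

Section LogPolar.
Variable R : realType.
Local Notation C := R[i].
Local Open Scope complex_scope.
Implicit Types (s t : R) (z w : C).

Definition cis t : C := cos t +i* sin t.
Definition log_polar s t : C := (expR s)%:C * cis t.

Lemma cisD s t : cis (s + t) = cis s * cis t.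
Proof. by rewrite /cis cosD sinD; simpc; rewrite addrC [X in _ +i* X]addrC. Qed.

Lemma normc_cis t : normc (cis t) = 1.
Proof. by rewrite /normc /cis cos2Dsin2 sqrtr1. Qed.

Lemma cis_periodic : cis 0 = cis (pi *+ 2).
Proof. by rewrite /cis cos0 sin0 cos2pi sin2pi. Qed.

Lemma normc_log_polar s t : normc (log_polar s t) = expR s.
Proof. by rewrite normcM normc_cis normc_real mulr1 ger0_norm // expR_ge0. Qed.

Lemma log_polarD s t s' t' :
  log_polar (s + s') (t + t') = log_polar s t * log_polar s' t'.
Proof. rewrite /log_polar expRD cisD rmorphM /=; ring. Qed.

Lemma log_polar_neq0 s t : log_polar s t != 0.
Proof.
apply/eqP => e0; have := expR_gt0 s; rewrite -(normc_log_polar s t) e0 normc0.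
by rewrite ltxx.
Qed.

Lemma log_polar_first_order e : 0 < e -> exists2 d, 0 < d & forall s t,
  `|s| < d -> `|t| < d ->
  normc (log_polar s t - 1 - (s%:C + 'i * t%:C)) <= e * (`|s| + `|t|).
Proof.
(* The terms add up to at most 5 e1 (|s| + |t|); e1 <= 1 gives e^s <= 2. *)
move=> e0; pose e1 := Num.min 1 (e / 6).
have e10 : 0 < e1 by rewrite lt_min ltr01 divr_gt0.
have e11 : e1 <= 1 by rewrite ge_min lexx.
have e16 : e1 <= e / 6 by rewrite ge_min lexx orbT.
have dE : is_derive (0 : R) 1 expR 1.
  by rewrite -[X in is_derive _ _ _ X](@expR0 R); exact: is_derive_expR.
have dC : is_derive (0 : R) 1 (@cos R) 0.
  by rewrite -[X in is_derive _ _ _ X]oppr0 -[X in - X](@sin0 R); exact: is_derive_cos.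
have dS : is_derive (0 : R) 1 (@sin R) 1.
  by rewrite -[X in is_derive _ _ _ X](@cos0 R); exact: is_derive_sin.
have [d1 d10 h1] := first_order dE e10.
have [d2 d20 h2] := first_order dC e10; have [d3 d30 h3] := first_order dS e10.
exists (Num.min (e1 / 2) (Num.min d1 (Num.min d2 d3))).
  by rewrite !lt_min d10 d20 d30 divr_gt0.
move=> s t; rewrite !lt_min => /and4P[se s1 s2 s3] /and4P[te t1 t2 t3].
have {h1} := h1 s s1; have {h2} := h2 t t2; have {h3} := h3 t t3.
rewrite !add0r expR0 cos0 sin0 !mul1r mul0r !subr0 => hs hc hE.
(* The remainder of e^{s+it} is e^s times that of cos and sin, plus that of the real exponential,
   plus the cross term i t (e^s - 1). *)
have -> : log_polar s t - 1 - (s%:C + 'i * t%:C) =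
    (expR s)%:C * ((cos t - 1)%:C + 'i * (sin t - t)%:C) +
    ((expR s - 1 - s)%:C + 'i * (t * (expR s - 1))%:C).
  rewrite /log_polar /cis; apply/eqP; rewrite eq_complex /=; apply/andP.
  by split; apply/eqP; simpc => /=; ring.
have T0 := normr_ge0 t; have S0 := normr_ge0 s.
have E1 : `|expR s - 1| <= e1.
  have := ler_normD (expR s - 1 - s) s; rewrite subrK.
  have : e1 * `|s| <= 1 * `|s| by rewrite ler_wpM2r.
  lra.
have E2 : `|expR s| <= 2.
  by have := ler_normD (expR s - 1) 1; rewrite subrK normr1; lra.
set A := (cos t - 1)%:C + _; set B := (expR s - 1 - s)%:C + _.
have nA : normc A <= 2 * (e1 * `|t|).
  rewrite (le_trans (normcD _ _)) // normcM normc_i mul1r !normc_real; lra.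
have nB : normc B <= e1 * `|s| + e1 * `|t|.
  rewrite (le_trans (normcD _ _)) // normcM normc_i mul1r !normc_real normrM.
  by rewrite lerD // mulrC ler_wpM2r.
have nEA : `|expR s| * normc A <= 2 * (2 * (e1 * `|t|)).
  by apply: ler_pM => //; exact: normc_ge0.
rewrite (le_trans (normcD _ _)) // normcM normc_real.
have eS : e1 * (`|s| + `|t|) <= e / 6 * (`|s| + `|t|) by rewrite ler_wpM2r ?addr_ge0.
have : 0 <= e1 * `|s| by rewrite mulr_ge0 // ltW.
have : 0 <= e1 * `|t| by rewrite mulr_ge0 // ltW.
lra.
Qed.

(* Conjugating by the exponential makes functions on circles periodic functions
   on a strip, where the contours are rectangles. *)
Lemma holomorphic_at_log_polar (h : Cfield R -> Cfield R) s0 t0 D :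
  is_derive (log_polar s0 t0 : Cfield R) (1 : Cfield R) h D ->
  holomorphic_at (fun s t => h (log_polar s t)) s0 t0.
Proof.
move=> hD; set z0 := log_polar s0 t0 in hD *.
have z00 : normc z0 > 0 by rewrite normc_log_polar expR_gt0.
exists (D * z0) => e e0.
(* Half of [e] goes to the remainder of [h] at z0, with |w| <= 2 (S + T), and half to the remainder
   of the exponential, multiplied by D z0. *)
pose e1 := e / (2 * normc z0 * 2).
pose e2 := Num.min 1 (e / (2 * (normc D + 1) * normc z0)).
have D1 : 0 < normc D + 1 by rewrite ltr_wpDl // normc_ge0.
have e10 : 0 < e1%:C by rewrite ltcR divr_gt0 // !mulr_gt0.
have e20 : 0 < e2 by rewrite lt_min ltr01 divr_gt0 // !mulr_gt0.
have [_ /gt0c_real[d1 d10 ->] h1] := first_order hD e10.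
have [d2 d20 h2] := log_polar_first_order e20.
exists (Num.min d2 (d1 / (normc z0 * 4))).
  by rewrite lt_min d20 divr_gt0 // mulr_gt0.
move=> s t; rewrite !lt_min => /andP[s2 s1] /andP[t2 t1].
set S := `|s - s0| in s2 s1 *; set T := `|t - t0| in t2 t1 *.
have [S0 T0] : 0 <= S /\ 0 <= T by split; exact: normr_ge0.
set w := log_polar (s - s0) (t - t0) - 1.
set l := (s - s0)%:C + 'i * (t - t0)%:C.
have wl : normc (w - l) <= e2 * (S + T) by exact: h2.
have nl : normc l <= S + T.
  by rewrite (le_trans (normcD _ _)) // normcM normc_i mul1r !normc_real.
have e21 : e2 * (S + T) <= 1 * (S + T).
  by rewrite ler_wpM2r ?addr_ge0 // ge_min lexx.
have nw : normc w <= 2 * (S + T).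
  have := normcD (w - l) l; rewrite subrK; lra.
have zE : log_polar s t = z0 + z0 * w.
  rewrite /w mulrBr mulr1 addrC subrK /z0 -log_polarD.
  by congr log_polar; ring.
have small : normc (z0 * w) < d1.
  rewrite normcM (le_lt_trans (ler_wpM2l (ltW z00) nw)) //.
  rewrite mulrC -ltr_pdivlMr //.
  have -> : d1 / normc z0 = 4 * (d1 / (normc z0 * 4)) by field; rewrite gt_eqF.
  lra.
have := h1 (z0 * w); rewrite !norm_normc ltcR => /(_ small).
rewrite -rmorphM lecR normcM -zE => hh.
have -> : h (log_polar s t) - h z0 - D * z0 * l =
    (h (log_polar s t) - h z0 - D * (z0 * w)) + D * z0 * (w - l) by ring.
rewrite (le_trans (normcD _ _)) // normcM.
have b1 : e1 * (normc z0 * normc w) <= e / 2 * (S + T).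
  have -> : e / 2 * (S + T) = e1 * (normc z0 * (2 * (S + T))).
    by rewrite /e1; field; rewrite gt_eqF.
  by rewrite ler_wpM2l ?ler_wpM2l // ltW // -ltcR.
have b2 : normc (D * z0) * normc (w - l) <= e / 2 * (S + T).
  apply: (@le_trans _ _ ((normc D + 1) * normc z0 * (e2 * (S + T)))).
    apply: ler_pM => //; [exact: normc_ge0|exact: normc_ge0|].
    by rewrite normcM ler_wpM2r ?lerDl // ltW.
  rewrite mulrA ler_wpM2r ?addr_ge0 // mulrC -ler_pdivlMr ?mulr_gt0 //.
  have -> : e / 2 / ((normc D + 1) * normc z0) = e / (2 * (normc D + 1) * normc z0).
    by field; rewrite !gt_eqF.
  by rewrite ge_min lexx orbT.
lra.
Qed.

End LogPolar.

Section HolomorphicFunctions.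
Variable R : realType.
Local Notation K := (Cfield R).
Local Open Scope complex_scope.
Implicit Types (n k : nat).

Lemma is_derive_line n (f : 'rV[K]_n -> K) (x v : 'rV[K]_n) (z : K) :
  differentiable f (x + z *: v) ->
  is_derive z (1 : K) (fun w : K => f (x + w *: v)) ('D_v f (x + z *: v)).
Proof.
by move=> df; apply: DeriveDef; [exact: differentiable_line|rewrite -derive1E derive_line].
Qed.

Lemma le_norm_real (z B : K) : `|z| <= B -> exists2 b : R, B = b%:C & normc z <= b.
Proof.
rewrite norm_normc => zB; have /complex_realP[b Bb] : B \is Num.real.
  by rewrite ger0_real // (le_trans _ zB) // ler0c normc_ge0.
by exists b => //; rewrite -lecR -Bb.
Qed.

(** The mean value equality fails for complex values. If the increment were too large, bisection
    would give intervals shrinking to a point s on which it exceeds m + e times the length; the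
    first order expansion at s forbids it. *)
Lemma mean_value_le n (f : 'rV[K]_n -> K) (x u : 'rV[K]_n) (M : K) :
  (forall t : R, 0 <= t <= 1 -> differentiable f (x + t%:C *: u) /\
     `|'D_u f (x + t%:C *: u)| <= M) ->
  `|f (x + u) - f x| <= M.
Proof.
have ar1 (a l : R) : 0 < l -> a + (l + l) <= 1 -> a + l <= 1 by lra.
have ar2 (a l : R) : 0 <= a -> 0 < l -> 0 <= a + l by lra.
have ar3 (c l n1 n2 n3 : R) : c * (l + l) < n1 -> n2 <= c * l -> n1 <= n3 + n2 ->
  c * l < n3 by lra.
have ar4 (a s l : R) : a <= s <= a + l -> 0 <= a + l - s /\ a - s <= 0 by lra.
have ar5 (a s l d : R) : a <= s <= a + l -> l < d -> a + l - s < d /\ - (a - s) < d.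
  by lra.
have ar6 (c a s l n1 n2 n3 : R) : n1 <= c * (a + l - s) -> n2 <= c * - (a - s) ->
  n3 <= n1 + n2 -> n3 <= c * l by lra.
have ar7 (c d h n1 n2 n3 : R) : n1 <= d * h -> n2 <= c * h -> n3 <= n2 + n1 ->
  n3 <= (d + c) * h by lra.
have ar8 (a s : R) : 0 <= a -> a + 1 <= 1 -> a <= s <= a + 1 -> 0 <= s <= 1 by lra.
move=> dfM; have [|_ fM0] := dfM 0; first by rewrite lexx ler01.
have [m ME m0] := le_norm_real fM0; have {}m0 := le_trans (normc_ge0 _) m0.
pose g (t : R) : K := f (x + t%:C *: u).
have g0 : g 0 = f x by rewrite /g rmorph0 scale0r addr0.
have g1 : g 1 = f (x + u) by rewrite /g rmorph1 scale1r.
rewrite -g0 -g1 ME norm_normc lecR leNgt; apply/negP => mg.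
(* Half of the excess, so that m + e is still exceeded on [0, 1]. *)
pose e := (normc (g 1 - g 0) - m) / 2.
have e0 : 0 < e by rewrite divr_gt0 // subr_gt0.
pose Bad n (a b : R) := [/\ 0 <= a, a + 1 / 2 ^+ n <= 1 &
  (m + e) * (1 / 2 ^+ n) < normc (g (a + 1 / 2 ^+ n) - g a)].
have Bad0 : Bad 0%N 0 0.
  rewrite /Bad expr0 divr1 add0r; split=> //.
  rewrite mulr1 /e -ltrBrDl ltr_pdivrMr // ltr_pMr ?ltr1n // subr_gt0 //.
have half N : 1 / 2 ^+ N = 1 / 2 ^+ N.+1 + 1 / 2 ^+ N.+1 :> R.
  by rewrite exprS; field; rewrite expf_neq0 // pnatr_eq0.
have step N (a b : R) : Bad N a b -> exists a' b' : R,
    [/\ a' = a \/ a' = a + 1 / 2 ^+ N.+1, b' = b \/ b' = b + 0 / 2 ^+ N.+1 &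
     Bad N.+1 a' b'].
  have : 0 < 1 / 2 ^+ N.+1 :> R by rewrite divr_gt0 // exprn_gt0.
  rewrite /Bad (half N); move: (1 / 2 ^+ N.+1) => l l0 [a0 a1 gl].
  have [gl1|gl1] := ltP ((m + e) * l) (normc (g (a + l) - g a)).
    by exists a, b; split; [left|left|split=> //; exact: ar1 l0 a1].
  exists (a + l), b; split; [by right|by left|split].
  - exact: ar2.
  - by rewrite -addrA.
  have -> : g (a + l + l) - g (a + l) = (g (a + (l + l)) - g a) - (g (a + l) - g a).
    by rewrite addrA opprB addrA subrK.
  apply: ar3 gl gl1 _.
  by have := normcD ((g (a + (l + l)) - g a) - (g (a + l) - g a)) (g (a + l) - g a);
    rewrite subrK.
have [s [s' sP]] := bisection ler01 (lexx 0) Bad0 step.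
have s01 : 0 <= s <= 1.
  have [a [b [sa _ []]]] := sP 0%N; rewrite expr0 divr1 in sa * => a0 a1 _.
  exact: ar8 a0 a1 sa.
have [df fM] := dfM s s01; rewrite ME norm_normc lecR in fM.
have e0C : 0 < e%:C by rewrite ltcR.
have [_ /gt0c_real[d d0 ->] hd] := first_order (is_derive_line df) e0C.
have near_s (t : R) : `|t - s| < d -> normc (g t - g s) <= (m + e) * `|t - s|.
  move=> td; have := hd (t - s)%:C; rewrite !norm_normc normc_real ltcR => /(_ td).
  have -> : s%:C + (t - s)%:C = t%:C by rewrite -rmorphD addrCA subrr addr0.
  set D := 'D_u f _ => le0.
  have le1 : normc (g t - g s - D * (t - s)%:C) <= e * `|t - s|.
    by rewrite -lecR rmorphM.
  have : normc (D * (t - s)%:C) <= m * `|t - s| by rewrite normcM normc_real ler_wpM2r.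
  move=> le2; apply: ar7 le2 le1 _.
  by have := normcD (g t - g s - D * (t - s)%:C) (D * (t - s)%:C); rewrite subrK.
have [N Nd] := exists_pow2_small ler01 d0.
have [a [b [sa _ [a0 a1]]]] := sP N; rewrite ltNge => /negP; apply.
move: (1 / _) Nd sa a1 => l Nd sa a1.
have [p1 p2] := ar4 _ _ _ sa; have [q1 q2] := ar5 _ _ _ _ sa Nd.
have := near_s (a + l); rewrite ger0_norm // => /(_ q1) h1.
have := near_s a; rewrite ler0_norm // => /(_ q2) h2.
apply: ar6 h1 h2 _; have := normcB (g (a + l) - g s) (g a - g s).
by rewrite opprB addrA subrK.
Qed.

(* Tends to [(2 pi)^-1 int_0^{2 pi} f t e^{-it} dt]. *)
Definition circle_mean k (f : R -> K) : K :=
  ((pi *+ 2)^-1)%:C * trapezoid k (fun t => f t / cis t) 0 (pi *+ 2).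

Lemma circle_meanD k f g :
  circle_mean k (fun t => f t + g t) = circle_mean k f + circle_mean k g.
Proof.
rewrite /circle_mean -mulrDr -trapezoidD; congr (_ * trapezoid _ _ _ _).
by apply/funext => t; rewrite mulrDl.
Qed.

Lemma circle_meanM k a f :
  circle_mean k (fun t => a * f t) = a * circle_mean k f.
Proof.
have -> : circle_mean k (fun t => a * f t) =
    ((pi *+ 2)^-1)%:C * trapezoid k (fun t => a * (f t / cis t)) 0 (pi *+ 2).
  by congr (_ * _); congr trapezoid; apply/funext => t; rewrite mulrA.
by rewrite trapezoidM mulrCA.
Qed.

Lemma circle_meanB k f g :
  circle_mean k (fun t => f t - g t) = circle_mean k f - circle_mean k g.
Proof.
rewrite -[in RHS]mulN1r -circle_meanM -circle_meanD; congr circle_mean.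
by apply/funext => t; rewrite mulN1r.
Qed.

Lemma circle_mean_le k f (B : K) : (forall t, `|f t| <= B) -> `|circle_mean k f| <= B.
Proof.
move=> fB; have [b Bb _] := le_norm_real (fB 0).
have pi20 : 0 < pi *+ 2 :> R by rewrite pmulrn_lgt0 // pi_gt0.
rewrite Bb norm_normc lecR normcM normc_real ger0_norm ?invr_ge0 ?(ltW pi20) //.
rewrite -ler_pdivlMl ?invr_gt0 // invrK; apply: trapezoid_bound => [|t _].
  exact: ltW.
rewrite normcM normcV normc_cis invr1 mulr1 -lecR.
by have := fB t; rewrite norm_normc Bb.
Qed.

(** The difference quotient h is holomorphic off 0. In logarithmic polar coordinates it is periodic,
    so its means over the unit circle and over a small circle differ by little once k is large; on
    the small circle h is close to the derivative. The singularity at 0 is never met. *)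
Lemma circle_mean_derive n (f : 'rV[K]_n -> K) x v :
  (forall y, differentiable f y) ->
  tends (fun k => circle_mean k (fun t => f (x + (cis t : K) *: v) - f x)) ('D_v f x).
Proof.
move=> df; pose h (z : K) : K := (f (x + z *: v) - f x) / z.
have dh (z : K) : z != 0 -> exists D : K, is_derive z (1 : K) h D.
  move=> z0; exists ('D_1 h z); apply: derivableP.
  apply: derivableM; last by apply: derivableV.
  apply: derivableB; first exact: differentiable_line.
  exact: derivable_cst.
pose F s t := h (log_polar s t).
have hF s t : holomorphic_at F s t.
  by have [D hD] := dh _ (log_polar_neq0 s t); exact: holomorphic_at_log_polar hD.
have pF s : F s 0 = F s (pi *+ 2) by rewrite /F /log_polar cis_periodic.
have pi4 : 4 <= pi *+ 2 :> R.
  by have := pi_ge2 R; rewrite mulr2n; lra.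
have pi20 : 0 < pi *+ 2 :> R by lra.
move=> _ /gt0c_real[e e0 ->].
have e20 : 0 < (e / 2)%:C by rewrite ltcR divr_gt0.
have dfx : differentiable f (x + 0 *: v) by exact: df.
have [_ /gt0c_real[d d0 ->] hd] := first_order (is_derive_line dfx) e20.
rewrite scale0r addr0 in hd.
have d10 : 0 < d^-1 by rewrite invr_gt0.
(* A radius e^s below d, since e^{1/d} >= 1 + 1/d > 1/d. *)
have s1d : expR (- d^-1) < d.
  rewrite expRN invf_plt ?posrE ?expR_gt0 // (lt_le_trans _ (expR_ge1Dx _)) //.
  by rewrite ltrDr.
have s10 : - d^-1 < 0 by rewrite oppr_lt0.
have [N0 hN] := trapezoid_homotopy pi20 e0 s10 hF pF.
exists N0 => k /hN.
rewrite norm_normc lecR.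
have -> : circle_mean k (fun t => f (x + (cis t : K) *: v) - f x) =
    ((pi *+ 2)^-1)%:C * trapezoid k (F 0) 0 (pi *+ 2).
  congr (_ * trapezoid _ _ _ _); apply/funext => t.
  by rewrite /F /h /log_polar expR0 mul1r.
set J0 := trapezoid _ _ _ _; set J1 := trapezoid _ _ _ _; set D := 'D_v f x => hJ.
have hJ1 : normc (J1 - (pi *+ 2)%:C * D) <= pi *+ 2 * (e / 2).
  have -> : J1 - (pi *+ 2)%:C * D =
      trapezoid k (fun t => F (- d^-1) t + (-1) * D) 0 (pi *+ 2).
    by rewrite trapezoidD trapezoid_cst mulN1r mulrN.
  apply: trapezoid_bound => [|t _]; first exact: ltW.
  set w := log_polar (- d^-1) t.
  have nw : normc w = expR (- d^-1) by exact: normc_log_polar.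
  have w0 : w != 0 by exact: log_polar_neq0.
  have := hd w; rewrite !norm_normc add0r ltcR nw => /(_ s1d).
  rewrite -rmorphM lecR => hw.
  rewrite -(ler_pM2r (expR_gt0 (- d^-1))) -{1}nw -normcM.
  suff -> : (F (- d^-1) t + -1 * D) * w = f (x + w *: v) - f x - D * w by [].
  by rewrite /F /h -/w; field.
have -> : (pi *+ 2)^-1%:C * J0 - D =
    (pi *+ 2)^-1%:C * ((J0 - J1) + (J1 - (pi *+ 2)%:C * D)).
  have : ((pi *+ 2)^-1)%:C * (pi *+ 2)%:C = 1 :> R[i].
    by rewrite -rmorphM mulVf ?gt_eqF // rmorph1.
  move: ((pi *+ 2)^-1)%:C ((pi *+ 2)%:C) => i2 t2 it.
  by rewrite -[in LHS](mul1r D) -it; ring.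
rewrite normcM normc_real ger0_norm ?invr_ge0 ?(ltW pi20) //.
rewrite ler_pdivrMl //; have := normcD (J0 - J1) (J1 - (pi *+ 2)%:C * D).
nra.
Qed.

Lemma norm_cisZ n (v : 'rV[K]_n) t : `|(cis t : K) *: v| = `|v|.
Proof. by rewrite normrZ norm_normc normc_cis rmorph1 mul1r. Qed.

Lemma norm_segment n (a u : 'rV[K]_n) (r : K) (t : R) : 0 <= t <= 1 ->
  `|a| <= r -> `|a + u| <= r -> `|a + t%:C *: u| <= r.
Proof.
move=> /andP[t0 t1] ar aur.
have -> : a + t%:C *: u = (1 - t)%:C *: a + t%:C *: (a + u).
  by rewrite scalerDr addrA -scalerDl -rmorphD subrK rmorph1 scale1r.
rewrite (le_trans (ler_normD _ _)) // !normrZ !norm_normc !normc_real !ger0_norm ?subr_ge0 //.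
have -> : r = (1 - t)%:C * r + t%:C * r by rewrite -mulrDl -rmorphD subrK rmorph1 mul1r.
by rewrite lerD // ler_wpM2l // ler0c // subr_ge0.
Qed.

(** * Cauchy estimates and differentiability of the derivatives *)

Section CauchyEstimates.
Variables (n : nat) (f : 'rV[K]_n -> K) (x0 : 'rV[K]_n) (r B : K).
Hypothesis df : forall y, differentiable f y.
Hypothesis r0 : 0 < r.
Hypothesis fB : forall y, `|y - x0| <= r -> `|f y| <= B.

Let B0 : 0 <= B.
Proof. by rewrite (le_trans (normr_ge0 (f x0))) // fB // subrr normr0 ltW. Qed.

Let r20 : 0 < r / 2. Proof. by rewrite divr_gt0. Qed.
Let r40 : 0 < r / 4. Proof. by rewrite divr_gt0. Qed.

(** For |v| <= r/2 the circle y + e^{it} v stays in the ball where |f| <= B, so the means are at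
    most 2 B; [linear_bound] extends this to all v. *)
Lemma derive_bound y v : `|y - x0| <= r / 2 ->
  `|'D_v f y| <= (B + B) / (r / 2) * `|v|.
Proof.
move=> yr; apply: (linear_bound (derive_is_linear (df y)) r20) => {}v vr.
apply: tends_norm_le (circle_mean_derive _ _ df); exists 0%N => k _.
apply: circle_mean_le => t; rewrite (le_trans (ler_normB _ _)) // lerD // fB //.
  rewrite addrAC (splitr r) (le_trans (ler_normD _ _)) // lerD //.
  by rewrite norm_cisZ.
by rewrite (le_trans yr) // ler_pdivrMr // ler_peMr ?ltW // ltr1n.
Qed.

Let L := (B + B) / (r / 2).
Let L0 : 0 <= L. Proof. by rewrite divr_ge0 ?addr_ge0 // ltW. Qed.

Lemma lipschitz_bound y u : `|y - x0| <= r / 2 -> `|y + u - x0| <= r / 2 ->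
  `|f (y + u) - f y| <= L * `|u|.
Proof.
move=> yr yur; apply: mean_value_le => t t01; split; first exact: df.
apply: derive_bound; rewrite addrAC; apply: norm_segment => //.
by rewrite addrAC.
Qed.

Let half4 : r / 2 = r / 4 + r / 4. Proof. by field. Qed.

(** Exchanging the increments in u and in w = e^{it} v turns the difference of derivatives into a
    mean of two increments of f along u, each at most L |u|. *)
Lemma derive_lipschitz y u v : `|y - x0| <= r / 4 -> `|y + u - x0| <= r / 4 ->
  `|'D_v f (y + u) - 'D_v f y| <= (L + L) * `|u| / (r / 4) * `|v|.
Proof.
move=> yr yur.
have le42 (z : K) : z <= r / 4 -> z <= r / 2.
  by move=> zr; rewrite half4 (le_trans zr) // lerDl ltW.
have swap (p q s t : K) : p - q - (s - t) = p - s - (q - t) by ring.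
have lD : linear (fun v : 'rV[K]_n => 'D_v f (y + u) - 'D_v f y).
  move=> a w w'; rewrite (derive_is_linear (df _)) (derive_is_linear (df y)).
  by rewrite scalerBr opprD addrACA.
apply: (linear_bound lD r40) => {}v vr.
apply: tends_norm_le (tendsB (circle_mean_derive (y + u) v df) (circle_mean_derive y v df)).
exists 0%N => k _; rewrite -circle_meanB; apply: circle_mean_le => t.
set w := (cis t : K) *: v; have wr : `|w| <= r / 4 by rewrite norm_cisZ.
have -> : f (y + u + w) - f (y + u) - (f (y + w) - f y) =
    (f (y + w + u) - f (y + w)) - (f (y + u) - f y).
  by rewrite (addrAC y u w) swap.
rewrite mulrDl (le_trans (ler_normB _ _)) // lerD //.
  apply: lipschitz_bound.
    by rewrite addrAC half4 (le_trans (ler_normD _ _)) // lerD.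
  have -> : y + w + u - x0 = (y + u - x0) + w.
    by rewrite (addrAC y w u) (addrAC (y + u) w).
  by rewrite half4 (le_trans (ler_normD _ _)) // lerD.
by apply: lipschitz_bound; apply: le42.
Qed.

Let M := (L + L) / (r / 4).

(** The mean value inequality for f minus its differential at y, whose derivative along u is bounded
    by [derive_lipschitz]. *)
Lemma taylor2_bound y u : `|y - x0| <= r / 4 -> `|y + u - x0| <= r / 4 ->
  `|f (y + u) - f y - 'D_u f y| <= M * `|u| ^+ 2.
Proof.
move=> yr yur; pose g z := f z - 'd f y z.
have dd z : differentiable ('d f y) z.
  by apply: linear_differentiable; apply: diff_continuous; exact: df.
have sub4 (p q s d : K) : p - q - d = p - (s + d) - (q - s) by ring.
have -> : f (y + u) - f y - 'D_u f y = g (y + u) - g y.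
  by rewrite /g linearD deriveE // -sub4.
apply: mean_value_le => t t01; split; first by apply: differentiableB.
have dg z : 'D_u g z = 'D_u f z - 'D_u f y.
  have [ld1 ld2] : is_derive z u ('d f y : 'rV[K]_n -> K) ('d f y u).
    by apply: is_derive_scalar_linear => a v w; rewrite linearP.
  have fd : derivable f z u by apply: diff_derivable; exact: df.
  by have := deriveB fd ld1; rewrite ld2 -(deriveE u (df y)).
rewrite dg; set w := t%:C *: u.
have wu : `|w| <= `|u|.
  rewrite normrZ norm_normc normc_real; case/andP: t01 => t0 t1.
  by rewrite ger0_norm // ler_piMl // -(rmorph1 (real_complex R)) lecR.
have yw : `|y + w - x0| <= r / 4.
  by rewrite addrAC; apply: norm_segment => //; rewrite addrAC.
rewrite (le_trans (derive_lipschitz u yr yw)) // expr2 mulrA ler_wpM2r //.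
by rewrite /M mulrAC ler_wpM2l ?divr_ge0 ?addr_ge0 // ltW.
Qed.

(** ['D_v f] is the limit of circle means of increments of f, which inherit the Taylor estimate with
    the constant 2 M for every k. The second conclusion exhibits D_u D_v f as a limit of means of
    ['D_u f], for comparison with Cauchy's formula. *)
Lemma derive_differentiable_small v : `|v| <= r / 8 ->
  differentiable ('D_v f) x0 /\ forall u,
  tends (fun k => circle_mean k (fun t => 'D_u f (x0 + (cis t : K) *: v) - 'D_u f x0))
    ('D_u ('D_v f) x0).
Proof.
move=> vr; have r80 : 0 < r / 8 by rewrite divr_gt0.
have quarter : r / 4 = r / 8 + r / 8 by field.
have M0 : 0 <= M by rewrite divr_ge0 ?addr_ge0 // ltW.
have swap (p q s t a b : K) : p - q - (s - t) - (a - b) = (p - s - a) - (q - t - b).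
  by ring.
pose F k z := circle_mean k (fun t => f (z + (cis t : K) *: v) - f z).
pose L1 k u := circle_mean k (fun t => 'D_u f (x0 + (cis t : K) *: v) - 'D_u f x0).
have lL1 k : linear (L1 k).
  move=> a u w; rewrite -[a *: L1 k u]/(a * L1 k u) /L1 -circle_meanM -circle_meanD.
  congr circle_mean; apply/funext => t.
  rewrite (derive_is_linear (df _)) (derive_is_linear (df x0)).
  by rewrite opprD addrACA -scalerBr.
apply: (@limit_differentiable K (@complex_seq_complete R) n ('D_v f) F L1 x0 (r / 8)
  (M + M) r80 (addr_ge0 M0 M0) lL1) => [u _|k u ur].
  exact: circle_mean_derive.
rewrite /F /L1 -!circle_meanB; apply: circle_mean_le => t.
set w := (cis t : K) *: v; have wr : `|w| <= r / 8 by rewrite norm_cisZ.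
rewrite swap (addrAC x0 u w) mulrDl (le_trans (ler_normB _ _)) // lerD //.
  apply: taylor2_bound.
    by rewrite addrAC subrr add0r (le_trans wr) // quarter lerDl ltW.
  have -> : x0 + w + u - x0 = w + u by rewrite addrC !addrA addNr add0r.
  rewrite quarter (le_trans (ler_normD _ _)) // lerD //; exact: ltW.
apply: taylor2_bound; first by rewrite subrr normr0 ltW.
by rewrite addrAC subrr add0r (le_trans (ltW ur)) // quarter lerDl ltW.
Qed.

End CauchyEstimates.

Lemma holomorphic_function_derive n (f : 'rV[K]_n -> K) v :
  holomorphic_function f -> holomorphic_function ('D_v f).
Proof.
move=> df x0; have cf : {for x0, continuous f} by exact: differentiable_continuous.
have [r [B [r0 fB]]] := locally_bounded cf.
have r80 : 0 < r / 8 by rewrite divr_gt0.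
have [c [c0 cv]] := exists_scale v r80.
have [dcv _] := derive_differentiable_small df r0 fB cv.
have c1 : c != 0 by rewrite gt_eqF.
by rewrite (derive_rescale v c1 df); apply: (differentiableZ c^-1).
Qed.

(** Along a short multiple of [v], both iterated derivatives are limits of the same circle means of
    ['D_u f]: one by differentiating the means of f, the other by Cauchy's formula for ['D_u f]. *)
Lemma holomorphic_function_deriveC n (f : 'rV[K]_n -> K) u v x0 :
  holomorphic_function f -> 'D_u ('D_v f) x0 = 'D_v ('D_u f) x0.
Proof.
move=> df; have cf : {for x0, continuous f} by exact: differentiable_continuous.
have [r [B [r0 fB]]] := locally_bounded cf.
have r80 : 0 < r / 8 by rewrite divr_gt0.
have [c [c0 cv]] := exists_scale v r80.
have [dcv /(_ u) lim1] := derive_differentiable_small df r0 fB cv.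
have lim2 := circle_mean_derive x0 (c *: v) (holomorphic_function_derive u df).
have e := tends_unique lim1 lim2.
have c1 : c != 0 by rewrite gt_eqF.
exact: deriveC_rescale c1 df dcv (holomorphic_function_derive u df x0) e.
Qed.

Lemma holomorphic_smooth_axioms : smooth_axioms (@holomorphic_function K).
Proof.
split=> [n a x|n f g sf sg x|n a f sf x|n i f sf x|n p M f sf x|n f pf x|n f v|n f u v x].
- exact: differentiable_cst.
- by apply: differentiableD; [exact: sf|exact: sg].
- by apply: (differentiableZ a); exact: sf.
- by apply: differentiable_mul_coord; exact: sf.
- by apply: differentiable_comp_mulmx; exact: sf.
- exact: pf.
- exact: holomorphic_function_derive.
- exact: holomorphic_function_deriveC.
Qed.

End HolomorphicFunctions.

Lemma smooth_rV_axioms (R : realType) (K : numFieldType) (c : smooth_class R K) :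
  smooth_axioms (fun n => @smooth_rV R K c n).
Proof.
case: c; [exact: polynomial_smooth_axioms | exact: polynomial_smooth_axioms
  | exact: analytic_smooth_axioms | exact: Cinfty_smooth_axioms
  | exact: holomorphic_smooth_axioms].
Qed.

Theorem mainTheorem2 (R : realType) (K : numFieldType) (c : smooth_class R K)
    (g : lieAlgType K) (m : nat) :
  dixmier c (coad g) -> dixmier c (coad (takiff g m)).
Proof. exact: (dixmier_takiff (smooth_rV_axioms c)). Qed.
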